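(* Let $G$ be an ample groupoid with compact unit space $G^{(0)}$, and assume that $|G(x)|\geq 3$ for every $x\in G^{(0)}$. Then the following conditions are equivalent: (i) $\mathrm{C}^*(G)$ admits no tracial state; (ii) $\mathrm{C}^*_\pi([[G]])$ admits no character; (iii) $\pi$ does not weakly contain the trivial representation; (iv) $\mathrm{C}^*_\pi([[G]])=\mathrm{C}^*(G)$.
   Context: A topological groupoid $G$ is ample if it is locally compact, Hausdorff, étale (the range and source maps $r,s\colon G\to G$ are local homeomorphisms onto $G^{(0)}$) and its unit space $G^{(0)}$ is totally disconnected. The orbit of $x\in G^{(0)}$ is $G(x):=r(s^{-1}(x))$. A bisection is a subset $U\subset G$ such that $r|_U$ and $s|_U$ are injective. For $G$ ample with compact unit space, the topological full group $[[G]]$ is the group of compact open bisections $U$ with $r(U)=s(U)=G^{(0)}$, with product $UV=\{uv\mid u\in U, v\in V, s(u)=r(v)\}$, inverse $U^{-1}=\{u^{-1}\mid u\in U\}$ and identity $G^{(0)}$. $C_c(G)$ is the $*$-algebra of continuous compactly supported complex functions on $G$ with $(f\star g)(\gamma)=\sum_{\alpha\beta=\gamma}f(\alpha)g(\beta)$ and $f^*(\gamma)=\overline{f(\gamma^{-1})}$. $\mathrm{C}^*(G)$ is the full groupoid $\mathrm{C}^*$-algebra (the completion of $C_c(G)$ in the universal $\mathrm{C}^*$-norm). The unitary representation $\pi\colon[[G]]\to \mathrm{C}^*(G)$ is $\pi(U):=1_U$, the indicator function of $U$, and $\mathrm{C}^*_\pi([[G]])$ is the $\mathrm{C}^*$-subalgebra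 of $\mathrm{C}^*(G)$ generated by $\pi([[G]])$. A character of a unital $\mathrm{C}^*$-algebra is a unital $*$-homomorphism to $\mathbb{C}$. If $\sigma,\eta$ are unitary representations of a group $\Gamma$ in unital $\mathrm{C}^*$-algebras, $\sigma$ weakly contains $\eta$ if $\|\sum_i\alpha_i\eta(g_i)\|\leq\|\sum_i\alpha_i\sigma(g_i)\|$ for every $\sum_i\alpha_ig_i\in\mathbb{C}\Gamma$. The trivial representation is $\Gamma\to\mathbb{C}$, $g\mapsto 1$. *)

(* Defs.v *)
(* The complex numbers are R[i], for an arbitrary R : realType. *)
From HB Require Import structures.
From mathcomp Require Import all_boot all_order all_algebra complex.
From mathcomp Require Import all_classical all_reals all_analysis.

Set Implicit Arguments.
Unset Strict Implicit.
Unset Printing Implicit Defensive.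
Import Order.TTheory GRing.Theory Num.Theory.
Import numFieldNormedType.Exports.
Local Open Scope classical_set_scope.
Local Open Scope card_scope.
Local Open Scope complex_scope.
Local Open Scope ring_scope.

(** * Topological groupoids *)

(* A groupoid is identified with its set of arrows, units being arrows.  The
   product [gmul a b] is total; it is meaningful only when [src a = rng b]. *)
HB.mixin Record isGroupoid G := {
  rng : G -> G;
  src : G -> G;
  ginv : G -> G;
  gmul : G -> G -> G;
  rng_rng : forall g, rng (rng g) = rng g;
  src_rng : forall g, src (rng g) = rng g;
  rng_src : forall g, rng (src g) = src g;
  rng_gmul : forall a b, src a = rng b -> rng (gmul a b) = rng a;
  src_gmul : forall a b, src a = rng b -> src (gmul a b) = src b;
  gmulA : forall a b c, src a = rng b -> src b = rng c ->
    gmul a (gmul b c) = gmul (gmul a b) c;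
  gmul_rng : forall g, gmul (rng g) g = g;
  gmul_src : forall g, gmul g (src g) = g;
  rng_ginv : forall g, rng (ginv g) = src g;
  src_ginv : forall g, src (ginv g) = rng g;
  gmulgV : forall g, gmul g (ginv g) = rng g;
  gmulVg : forall g, gmul (ginv g) g = src g
}.

#[short(type="groupoidType")]
HB.structure Definition Groupoid := {G of Choice G & isGroupoid G}.

Definition composable {G : groupoidType} : set (G * G) :=
  [set p | src p.1 = rng p.2].

Definition unit_space (G : groupoidType) : set G := range rng.
Arguments unit_space G : clear implicits.

Definition groupoid_orbit {G : groupoidType} (x : G) : set G :=
  rng @` (src @^-1` [set x]).

HB.mixin Record Groupoid_isTopological G of Topological G & Groupoid G := {
  ginv_continuous : continuous (@ginv G);
  gmul_continuous :
    {within @composable G, continuous (fun p : G * G => gmul p.1 p.2)}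
}.

#[short(type="topGroupoidType")]
HB.structure Definition TopGroupoid :=
  {G of Topological G & Groupoid G & Groupoid_isTopological G}.

(* [f] is a local homeomorphism of [T] onto the subspace [Y]; the last condition
   of the conjunction says that [f] restricted to [U] is open onto [Y]. *)
Definition local_homeo_onto {T : topologicalType} (Y : set T) (f : T -> T) :=
  range f = Y /\
  forall g, exists U : set T, [/\ open U, U g, set_inj U f,
    {within U, continuous f} &
    forall W, open W -> W `<=` U -> exists2 V, open V & f @` W = V `&` Y].

Definition etale (G : topGroupoidType) :=
  local_homeo_onto (unit_space G) rng /\ local_homeo_onto (unit_space G) src.

Definition ample (G : topGroupoidType) :=
  [/\ locally_compact [set: G], hausdorff_space G, etale G &
      totally_disconnected (unit_space G)].

Definition bisection {G : groupoidType} (U : set G) :=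
  set_inj U rng /\ set_inj U src.

(* The elements of the topological full group; the set is used as a type. *)
Definition full_group (G : topGroupoidType) : set (set G) :=
  [set U | [/\ bisection U, compact U, open U,
               rng @` U = unit_space G & src @` U = unit_space G]].
Arguments full_group G : clear implicits.

(** * C*-algebras *)

(* Unital complex C*-algebras; the zero algebra is allowed.  The product and the
   unit are new operations: a join of the library's rings with its normed
   modules cannot be declared, since [Num.NumDomain] already inherits both. *)
HB.mixin Record isCstarAlgebra (R : realType) A of CompleteNormedModule R[i] A := {
  cmul : A -> A -> A;
  cone : A;
  star : A -> A;
  cmulA : forall a b c : A, cmul a (cmul b c) = cmul (cmul a b) c;
  cmul1r : forall a : A, cmul cone a = a;
  cmulr1 : forall a : A, cmul a cone = a;
  cmulDl : forall a b c : A, cmul (a + b) c = cmul a c + cmul b c;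
  cmulDr : forall a b c : A, cmul a (b + c) = cmul a b + cmul a c;
  cmulZl : forall (k : R[i]) (a b : A), cmul (k *: a) b = k *: cmul a b;
  cmulZr : forall (k : R[i]) (a b : A), cmul a (k *: b) = k *: cmul a b;
  starD : forall a b : A, star (a + b) = star a + star b;
  starZ : forall (k : R[i]) (a : A), star (k *: a) = (k^*)%R *: star a;
  starM : forall a b : A, star (cmul a b) = cmul (star b) (star a);
  starK : forall a : A, star (star a) = a;
  ler_norm_cmul : forall a b : A, `|cmul a b| <= `|a| * `|b|;
  norm_star_cmul : forall a : A, `|cmul (star a) a| = `|a| ^+ 2
}.

#[short(type="cstarAlgType")]
HB.structure Definition CstarAlgebra (R : realType) :=
  {A of CompleteNormedModule R[i] A & isCstarAlgebra R A}.

Arguments cone {R s}.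

Section CstarAlgebras.
Context {R : realType} {A : cstarAlgType R}.

Definition tracial_state (tau : {scalar A}) :=
  [/\ tau cone = 1, forall a, 0 <= tau (cmul (star a) a) &
      forall a b, tau (cmul a b) = tau (cmul b a)].

Record cstar_subalgebra (B : set A) : Prop := {
  cstar_subalgebra0 : B 0;
  cstar_subalgebraD : forall a b, B a -> B b -> B (a + b);
  cstar_subalgebraZ : forall (k : R[i]) a, B a -> B (k *: a);
  cstar_subalgebraM : forall a b, B a -> B b -> B (cmul a b);
  cstar_subalgebra_star : forall a, B a -> B (star a);
  cstar_subalgebra_closed : closed B
}.

Definition cstar_generated (S : set A) : set A := smallest cstar_subalgebra S.

(* A character of the subalgebra [B], which shares the unit of [A]; the values
   of [chi] outside [B] are irrelevant. *)
Record character (B : set A) (chi : A -> R[i]) : Prop := {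
  character1 : chi cone = 1;
  characterD : forall a b, B a -> B b -> chi (a + b) = chi a + chi b;
  characterZ : forall (k : R[i]) a, B a -> chi (k *: a) = k * chi a;
  characterM : forall a b, B a -> B b -> chi (cmul a b) = chi a * chi b;
  character_star : forall a, B a -> chi (star a) = (chi a)^*
}.

End CstarAlgebras.

(* An element of the group algebra is given as a formal finite sum, i.e. a list
   of pairs (coefficient, group element).  Only the linear extensions of [sigma]
   and [eta] to the group algebra enter, not the group law of [Gamma]. *)
Definition weakly_contains {R : realType} {Gamma : Type}
    {A B : normedModType R[i]} (sigma : Gamma -> A) (eta : Gamma -> B) :=
  forall x : seq (R[i] * Gamma),
    `|\sum_(p <- x) p.1 *: eta p.2| <= `|\sum_(p <- x) p.1 *: sigma p.2|.

Definition trivial_rep (R : realType) (Gamma : Type) : Gamma -> R[i]^o :=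
  fun=> 1.

(** * The full C*-algebra of a groupoid *)

Section GroupoidCstar.
Context {R : realType} {G : topGroupoidType}.
Implicit Types f g : G -> R[i].

Definition Cc : set (G -> R[i]) :=
  [set f | continuous (f : G -> R[i]^o) /\ compact (closure [set c | f c != 0])].

(* If [G] is etale and [f], [g] are in [Cc], only finitely many terms of the sum
   are nonzero. *)
Definition convolution f g : G -> R[i] := fun c =>
  \sum_(p \in [set p : G * G | composable p /\ gmul p.1 p.2 = c])
    f p.1 * g p.2.

Definition fstar f : G -> R[i] := fun c => (f (ginv c))^*.

Record cstar_seminorm (p : (G -> R[i]) -> R) : Prop := {
  cstar_seminorm_ge0 : forall f, Cc f -> 0 <= p f;
  cstar_seminormD : forall f g, Cc f -> Cc g ->
    p (fun c => f c + g c) <= p f + p g;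
  cstar_seminormZ : forall (k : R[i]) f, Cc f ->
    p (fun c => k * f c) = complex.Re `|k| * p f;
  cstar_seminormM : forall f g, Cc f -> Cc g -> p (convolution f g) <= p f * p g;
  cstar_seminorm_star : forall f, Cc f -> p (convolution (fstar f) f) = p f ^+ 2
}.

Definition universal_norm f : \bar R :=
  ereal_sup [set (p f)%:E | p in cstar_seminorm].

(* [iota] exhibits [A] as the completion of the *-algebra [Cc] in the universal
   norm, i.e. [A] is C*(G); this determines ([A], [iota]) up to a unique
   isomorphism.  The values of [iota] outside [Cc] are irrelevant. *)
Record groupoid_cstar (A : cstarAlgType R) (iota : (G -> R[i]) -> A) : Prop := {
  groupoid_cstarD : forall f g, Cc f -> Cc g ->
    iota (fun c => f c + g c) = iota f + iota g;
  groupoid_cstarZ : forall (k : R[i]) f, Cc f ->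
    iota (fun c => k * f c) = k *: iota f;
  groupoid_cstarM : forall f g, Cc f -> Cc g ->
    iota (convolution f g) = cmul (iota f) (iota g);
  groupoid_cstar_star : forall f, Cc f -> iota (fstar f) = star (iota f);
  groupoid_cstar_norm : forall f, Cc f ->
    (complex.Re `|iota f|)%:E = universal_norm f;
  groupoid_cstar_dense : closure (iota @` Cc) = [set: A]
}.

Definition full_group_rep (A : cstarAlgType R) (iota : (G -> R[i]) -> A) :
    full_group G -> A :=
  fun U => iota \1_(val U).

Definition full_group_cstar (A : cstarAlgType R) (iota : (G -> R[i]) -> A) :
    set A :=
  cstar_generated (range (full_group_rep iota)).

End GroupoidCstar.

(* Main.v *)
From HB Require Import structures.
Require Import Defs.
From mathcomp Require Import all_boot all_order all_algebra complex.
From mathcomp Require Import all_classical all_reals all_analysis.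
From mathcomp Require Import lra ring.
Import Order.TTheory GRing.Theory Num.Theory.
Import numFieldNormedType.Exports.
Local Open Scope classical_set_scope.
Local Open Scope card_scope.
Local Open Scope complex_scope.
Local Open Scope ring_scope.

Set Implicit Arguments.
Unset Strict Implicit.
Unset Printing Implicit Defensive.

(** Write [e U] for the image in [A] of the indicator function of a compact
    open bisection [U], and [B] for the subalgebra generated by the [e U] with
    [U] in the full group.  All implications pass through the weak containment of
    the trivial representation.

    If [B] is all of [A], there is no character on [B]: every unit has a
    neighbourhood which is the source of a bisection [W] with disjoint source
    and range, so [e W] squares to zero, a character kills [e W] and hence
    [e (src @` W)], and by compactness it kills [1] ([no_character_eqT]).

    If the trivial representation is not weakly contained, then [B] is all of
    [A] ([full_group_cstar_eqT]).  The key is that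
    [(1 - e U) ** a ** (1 - e W)] lies in [B] for all [U], [W] in the full
    group and every [a] in [A] ([corner_all]), i.e. the augmentation ideal of
    [B] is hereditary in [A].  When a corner of this form is cut down near a
    unit [x], and the arrows of [U] and of the inverse of [W] at [x] move [x]
    to two further distinct points, it is a product of an element of the full
    group and of [1 - e T] for a transposition [T] ([corner_moving]); three
    points in each orbit suffice to reduce the other cases to this one.  Since
    the trivial representation is not weakly contained, the augmentation ideal
    contains some [1 - y] with [y] of norm less than [1], so that each [a] is
    the limit of the elements [(1 - y^n) ** a ** (1 - y^n)] of [B].

    If the trivial representation is weakly contained, the theorem of Hahn and
    Banach extends it to a contractive functional [phi] on [A]
    ([weakly_contains_state]).  Such a functional absorbs the unitaries [e U],
    i.e. [phi (e U ** a) = phi a] ([absorb]), so it is a character on [B]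
    ([state_character]), and its restriction to functions on the unit space is
    invariant.

    Finally, an invariant positive functional [L] on the functions on the unit
    space yields two positive functionals on [Cc]: the one that restricts a
    function to the unit space before applying [L] is a trace, and the one that
    sums a function over the range fibres before applying [L] sends the
    indicator function of each element of the full group to [1].  A positive
    functional on [Cc] is bounded by the universal norm, because the seminorm
    of its GNS representation is a C*-seminorm ([positive_le_universal]).
    Applied to the state [phi] this yields a tracial state on [A]
    ([trace_exists], [state_trace]); applied to a tracial state on [A], it
    yields the weak containment of the trivial representation
    ([weakly_contains_trivial], [tracial_state_weakly_contains]). *)

(** * Groupoid algebra *)

Section GroupoidAlgebra.
Context {G : groupoidType}.
Implicit Types a b c x : G.

Lemma src_src a : src (src a) = src a.
Proof. by rewrite -{1}(rng_ginv a) src_rng rng_ginv. Qed.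

Lemma unitP x : unit_space G x <-> rng x = x.
Proof. by split=> [[a _ <-]|<-]; [exact: rng_rng|exists x]. Qed.

Lemma unit_src x : unit_space G x -> src x = x.
Proof. by move=> /unitP <-; rewrite src_rng. Qed.

Lemma unit_rngP a : unit_space G (rng a).
Proof. by exists a. Qed.

Lemma unit_srcP a : unit_space G (src a).
Proof. by apply/unitP; rewrite rng_src. Qed.

Lemma gmulKV a b : src a = rng b -> gmul (ginv a) (gmul a b) = b.
Proof. by move=> ab; rewrite gmulA ?src_ginv// gmulVg ab gmul_rng. Qed.

Lemma gmulVK a b : rng a = rng b -> gmul a (gmul (ginv a) b) = b.
Proof. by move=> ab; rewrite gmulA ?rng_ginv ?src_ginv// gmulgV ab gmul_rng. Qed.

Lemma gmulIK a b : src a = rng b -> gmul (gmul a b) (ginv b) = a.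
Proof. by move=> ab; rewrite -gmulA ?rng_ginv// gmulgV -ab gmul_src. Qed.

Lemma ginvK a : ginv (ginv a) = a.
Proof.
rewrite -[LHS]gmul_src src_ginv rng_ginv -gmulVg gmulA ?src_ginv ?rng_ginv//.
by rewrite gmulVg src_ginv gmul_rng.
Qed.

Lemma ginv_unit x : unit_space G x -> ginv x = x.
Proof.
move=> ux; have sx := unit_src ux; have rx := (unitP x).1 ux.
by rewrite -[LHS]gmul_src src_ginv rx gmulVg.
Qed.

Lemma gmul_injl a b c : src a = rng b -> src a = rng c ->
  gmul a b = gmul a c -> b = c.
Proof. by move=> ab ac e; rewrite -(gmulKV ab) e gmulKV. Qed.

Lemma ginv_gmul a b : src a = rng b ->
  ginv (gmul a b) = gmul (ginv b) (ginv a).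
Proof.
move=> ab; have abi : src (ginv b) = rng (ginv a) by rewrite src_ginv rng_ginv.
apply: (@gmul_injl (gmul a b)); rewrite ?rng_ginv ?rng_gmul ?src_gmul// ?rng_ginv//.
rewrite gmulgV rng_gmul// gmulA ?src_gmul// ?rng_ginv//.
by rewrite gmulIK// gmulgV.
Qed.

End GroupoidAlgebra.

(** * Compact open sets *)

(** Induction over a compact set: the sets [A] such that [P (K `\` A)] form a
    filter, which is improper as it has no cluster point in [K]. *)
Lemma compact_ind (T : topologicalType) (P : set T -> Prop) (K : set T) :
  P set0 -> (forall A B, A `<=` B -> P B -> P A) ->
  (forall A B, P A -> P B -> P (A `|` B)) ->
  compact K -> (forall x, K x -> exists2 O, nbhs x O & P O) -> P K.
Proof.
move=> P0 Psub PU cK loc; apply: contrapT => nPK.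
pose F : set_system T := fun A => P (K `\` A).
have FF : ProperFilter F.
  split; first by move=> F0; apply: nPK; apply: Psub F0 => x Kx; split.
  split; first by apply: Psub P0 => x [_]; apply.
  - move=> A B FA FB; apply: Psub (PU _ _ FA FB) => x [Kx] /not_andP[nA|nB].
      by left; split.
    by right; split.
  - move=> A B AB; apply: Psub => x [Kx nB]; split => // Ax; exact/nB/AB.
have FKK : F K by apply: Psub P0 => x [].
have [x [Kx clx]] := cK F FF FKK.
have [U nU PU0] := loc x Kx.
have FO : F (~` U) by apply: Psub PU0 => y [_] /contrapT.
by have [y [nOy Oy]] := clx _ _ FO nU.
Qed.

Definition compact_and_open (T : topologicalType) (K : set T) := compact K /\ open K.

Section CompactOpen.
Context {T : topologicalType}.
Hypothesis hT : hausdorff_space T.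
Implicit Types K L Z : set T.

Lemma coU K L : compact_and_open K -> compact_and_open L -> compact_and_open (K `|` L).
Proof. by move=> [? ?] [? ?]; split; [exact: compactU|exact: openU]. Qed.

Lemma co_closed K : compact_and_open K -> closed K.
Proof. by case=> /(compact_closed hT). Qed.

Lemma co0 : compact_and_open (@set0 T).
Proof. by split; [exact: compact0|exact: open0]. Qed.

Lemma coIclopen K L : compact_and_open K -> clopen L -> compact_and_open (K `&` L).
Proof.
move=> [cK oK] [oL cL]; split; last exact: openI.
by apply: (subclosed_compact _ cK) => //; apply: closedI => //; exact: compact_closed.
Qed.

Lemma co_clopen K : compact_and_open K -> clopen K.
Proof. by move=> cK; split; [case: cK|exact: co_closed]. Qed.

Lemma coI K L : compact_and_open K -> compact_and_open L -> compact_and_open (K `&` L).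
Proof. by move=> cK /co_clopen; exact: coIclopen. Qed.

Lemma coD K L : compact_and_open K -> clopen L -> compact_and_open (K `\` L).
Proof. by move=> cK cL; rewrite setDE; apply: coIclopen => //; exact: clopenC. Qed.

(** The form in which compactness is used throughout: an additive statement
    about compact open sets holds as soon as it holds for all small ones. *)
Lemma compact_open_ind (Q : set T -> Prop) K :
  compact_and_open K -> Q set0 ->
  (forall Z L, compact_and_open Z -> compact_and_open L -> Z `&` L = set0 ->
    Q Z -> Q L -> Q (Z `|` L)) ->
  (forall x, K x -> exists C, [/\ compact_and_open C, C x &
    forall Z, compact_and_open Z -> Z `<=` C -> Q Z]) -> Q K.
Proof.
move=> coK Q0 QU loc.
pose P A := exists C, [/\ compact_and_open C, A `<=` C &
  forall Z, compact_and_open Z -> Z `<=` C -> Q Z].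
suff [C [cC KC]] : P K by apply.
apply: compact_ind => //.
- exists set0; split => //; first exact: co0.
  by move=> Z _; rewrite subset0 => ->.
- by move=> A B AB [C [cC BC QC]]; exists C; split => //; exact: subset_trans BC.
- move=> A B [C [cC AC QC]] [D [cD BD QD]]; exists (C `|` D); split.
  + exact: coU.
  + exact: setUSS.
  + move=> Z cZ ZCD; rewrite -(setUIDK Z C).
    have cZC : compact_and_open (Z `&` C) by exact: coI.
    have cZD : compact_and_open (Z `\` C) by apply: coD => //; exact: co_clopen.
    apply: QU => //.
    * by apply/seteqP; split => x //= -[[_ ?] [_]].
    * by apply: QC => // x [].
    * by apply: QD => // x [/ZCD[]].
- by case: coK.
- move=> x Kx; have [C [cC Cx QC]] := loc x Kx.
  exists C; first by apply: open_nbhs_nbhs; split => //; case: cC.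
  by exists C; split.
Qed.

(** In a compact totally disconnected set, the intersection [Q] of the compact
    open sets containing [x] is connected, hence equal to [[set x]]: a splitting
    of [Q] into two closed pieces could be separated by open sets, and then one
    piece would be cut out by a smaller compact open set containing [x]. *)
Lemma compact_open_basis (K O : set T) x : compact_and_open K -> totally_disconnected K ->
  open O -> K x -> O x -> exists C, [/\ compact_and_open C, C x, C `<=` K & C `<=` O].
Proof.
move=> coK td oO Kx Ox.
pose S : set (set T) := [set C | [/\ compact_and_open C, C x & C `<=` K]].
pose Q : set T := \bigcap_(C in S) C.
have SK : S K by split.
have QK : Q `<=` K by move=> y; exact.
have Qx : Q x by move=> C [].
have clQ : closed Q by apply: closed_bigI => C [/co_closed].
have SI C D : S C -> S D -> S (C `&` D).
  move=> [c1 x1 k1] [c2 x2 k2]; split => //; first exact: coI.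
  by move=> y [/k1].
have QS O' : open O' -> Q `<=` O' -> exists2 C, S C & C `<=` O'.
  move=> oO' QO'.
  pose P A := exists2 C, S C & C `&` A `<=` O'.
  have : P K.
    apply: compact_ind.
    - by exists K => //; rewrite setI0.
    - by move=> A B AB [C SC CB]; exists C => //; apply: subset_trans CB; exact: setIS.
    - move=> A B [C SC CA] [D SD DB]; exists (C `&` D); first exact: SI.
      by move=> y [[Cy Dy] [Ay|By]]; [exact: CA|exact: DB].
    - by case: coK.
    - move=> y Ky; have [Oy|nOy] := pselect (O' y).
        exists O'; first exact: open_nbhs_nbhs.
        by exists K => // z [].
      have /existsNP[C /not_implyP[SC nCy]] : ~ Q y by move=> /QO'.
      exists (~` C); last by exists C => // z [].
      apply: open_nbhs_nbhs; split => //; apply: closed_openC.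
      by case: SC => /co_closed.
  move=> [C SC CK]; exists C => // y Cy; apply: CK; split => //.
  by case: SC => _ _; apply.
suff Q1 : Q = [set x].
  have [C SC CO] := QS O oO (eq_ind_r (fun Y => Y `<=` O) (fun y (yx : y = x) => eq_ind_r O Ox yx) Q1).
  by case: SC => ? ? ?; exists C; split.
apply/seteqP; split => [|y ->]//.
rewrite -(td x Kx); apply: connected_component_max => // B B0 [ O1 oO1 BO1] [F cF BF].
pose B' := Q `\` O1.
have cB : closed B by rewrite BF; exact: closedI.
have cB' : closed B' by apply: closedI => //; exact: open_closedC.
have BK : B `<=` K by rewrite BO1 => y [/QK].
have norm := @compact_normal_local T K hT (proj1 coK) B.
have KK : interior K = K by apply/interior_id; case: coK.
have /norm /(_ cB) H : B `<=` interior K by rewrite KK.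
have nB : set_nbhs B (~` B').
  apply/set_nbhsP; exists (~` B'); split => //; first exact: closed_openC.
  by rewrite BO1 => y [Qy Oy] [].
have [V /set_nbhsP[W [oW BW WV]] cVB'] := H _ nB.
have clW : closure W `<=` ~` B'.
  by apply: subset_trans cVB'; exact: closure_subset.
(* [W] and the complement of its closure separate the two pieces of [Q]. *)
have QW : Q `<=` W `|` ~` closure W.
  move=> y Qy; have [ O1y|nO1y] := pselect (O1 y).
    by left; apply: BW; rewrite BO1.
  by right => /clW; apply.
have oWW : open (W `|` ~` closure W).
  by apply: openU => //; apply: closed_openC; exact: closed_closure.
have [C SC CW] := QS _ oWW QW.
have [cC Cx CK] := SC.
have CWE : C `&` W = C `&` closure W.
  apply/seteqP; split => y [Cy Wy]; split => //; first exact: subset_closure.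
  by have [] := CW _ Cy.
have clCW : clopen (C `&` W).
  split; first by apply: openI => //; case: cC.
  by rewrite CWE; apply: closedI; [exact: co_closed|exact: closed_closure].
have [Wx|nWx] := pselect (W x).
  have SCW : S (C `&` W).
    split => //; last by move=> y [/CK].
    by rewrite -[C `&` W](setIidr (@subIsetl _ C W)); exact: coIclopen.
  apply/seteqP; split => [y|y Qy]; first by rewrite BO1 => -[].
  have [_ Wy] := Qy _ SCW.
  have := clW y (subset_closure Wy); rewrite BO1 => nB'y; split => //.
  by apply: contrapT => nO1; apply: nB'y.
have SCW : S (C `\` (C `&` W)).
  by split => //; [exact: coD|split => // -[]|move=> y [/CK]].
have [y By] := B0; have Qy : Q y by move: By; rewrite BO1 => -[].
have [_] := Qy _ SCW; elim; split; last exact: BW.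
by have [] := Qy _ SCW.
Qed.

End CompactOpen.

(** * Compact open bisections *)

Lemma local_homeo_continuous (T : topologicalType) (Y : set T) (f : T -> T) :
  local_homeo_onto Y f -> continuous f.
Proof.
move=> [_ lh] g; have [U [oU Ug _ cf _]] := lh g.
by move: cf; rewrite continuous_open_subspace// => /(_ g); apply; rewrite inE.
Qed.

Lemma local_homeo_openmap (T : topologicalType) (Y : set T) (f : T -> T) :
  open Y -> local_homeo_onto Y f -> forall W, open W -> open (f @` W).
Proof.
move=> oY [_ lh] W oW.
rewrite openE => _ [g Wg <-]; have [U [oU Ug _ _ /(_ (W `&` U))]] := lh g.
move=> [|x []//|V oV WV]; first exact: openI.
rewrite /interior/= nbhsE; exists (f @` (W `&` U)); last by apply: image_subset => x [].
split; last by exists g.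
by rewrite WV; exact: openI.
Qed.

Definition co_bisection {G : topGroupoidType} (U : set G) := bisection U /\ compact_and_open U.

(** The inverse of [rng] on the bisection [U]; its value at [x] is [x] itself
    if [x] is not in the range of [U]. *)
Definition rng_section {G : topGroupoidType} (U : set G) (x : G) : G :=
  xget x [set a | U a /\ rng a = x].

(** Division by [U] on the left: [ldiv U c] is the arrow [b] with [c = gmul a b]
    and [a] in [U].  It is meaningful if [rng c] is in the range of [U]. *)
Definition ldiv {G : topGroupoidType} (U : set G) (c : G) : G :=
  gmul (ginv (rng_section U (rng c))) c.

Definition bmul {G : topGroupoidType} (U V : set G) : set G :=
  [set c | exists a b, [/\ U a, V b, src a = rng b & c = gmul a b]].

Definition binv {G : topGroupoidType} (U : set G) : set G := ginv @^-1` U.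

Section GroupoidTopology.
Context {G : topGroupoidType}.
Hypothesis hample : ample G.
Hypothesis hcompact : compact (unit_space G).
Implicit Types (U V W K Z O : set G) (a b c g x : G).

Lemma ample_hausdorff : hausdorff_space G. Proof. by case: hample. Qed.

Lemma rng_cont : continuous (@rng G).
Proof. by case: hample => _ _ [/local_homeo_continuous]. Qed.

Lemma src_cont : continuous (@src G).
Proof. by case: hample => _ _ [_ /local_homeo_continuous]. Qed.

Lemma unit_open : open (unit_space G).
Proof.
rewrite openE => x ux; have rx := (unitP x).1 ux.
case: hample => _ _ [[_ lh] _] _; have [U [oU Ux inj _ _]] := lh x.
rewrite /interior/= nbhsE; exists (U `&` rng @^-1` U).
  split; last by split => //=; rewrite rx.
  by apply: openI => //; apply: open_comp => // y _; exact: rng_cont.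
move=> y [Uy Ury]; apply/unitP; apply: inj; rewrite ?inE//; exact: rng_rng.
Qed.

Lemma unit_co : compact_and_open (unit_space G).
Proof. by split => //; exact: unit_open. Qed.

Lemma rng_open W : open W -> open (rng @` W).
Proof. by apply: (local_homeo_openmap unit_open); case: hample => _ _ []. Qed.

Lemma src_open W : open W -> open (src @` W).
Proof. by apply: (local_homeo_openmap unit_open); case: hample => _ _ []. Qed.

Lemma rng_co K : compact_and_open K -> compact_and_open (rng @` K).
Proof.
move=> [cK oK]; split; last exact: rng_open.
by apply: continuous_compact => //; apply: continuous_subspaceT; exact: rng_cont.
Qed.

Lemma src_co K : compact_and_open K -> compact_and_open (src @` K).
Proof.
move=> [cK oK]; split; last exact: src_open.
by apply: continuous_compact => //; apply: continuous_subspaceT; exact: src_cont.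
Qed.

Lemma rng_sectionK U a : bisection U -> U a -> rng_section U (rng a) = a.
Proof.
move=> [inj _] Ua; rewrite /rng_section; case: xgetP => [y _ [Uy ra]|/(_ a)[]//].
by apply: inj; rewrite ?inE.
Qed.

Lemma rng_section_near U a O : bisection U -> open U -> U a -> open O -> O a ->
  \forall x \near rng a, (exists b, [/\ U b, O b, rng b = x & rng_section U x = b]).
Proof.
move=> bU oU Ua oO Oa; rewrite /prop_near1 nbhsE.
exists (rng @` (U `&` O)); first by split; [apply: rng_open; exact: openI|exists a].
by move=> _ [b [Ub Ob] <-]; exists b; split => //; exact: rng_sectionK.
Qed.

Lemma co_bisection_basis g O : open O -> O g -> exists V, [/\ co_bisection V, V g & V `<=` O].
Proof.
move=> oO Og; case: (hample) => _ _ [[_ lhr] [_ lhs]] td.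
have [U1 [oU1 U1g inj1 _ _]] := lhr g; have [U2 [oU2 U2g inj2 _ _]] := lhs g.
pose U := O `&` (U1 `&` U2).
have oU : open U by do 2 apply: openI => //.
have bU : bisection U.
  split=> x y /[!inE] -[_ [x1 x2]] [_ [y1 y2]]; [apply: inj1|apply: inj2];
    by rewrite inE.
have Ug : U g by [].
have [|C [cC Cg Cu CrU]] := compact_open_basis ample_hausdorff unit_co td (rng_open oU) (unit_rngP g).
  by exists g.
have secrC x : C x -> U (rng_section U x) /\ rng (rng_section U x) = x.
  by move=> /CrU [a Ua <-]; rewrite rng_sectionK.
exists (U `&` rng @^-1` C); split; last by move=> x [[]].
  split; first by split => x y /[!inE] -[Ux _] [Uy _]; apply bU; rewrite inE.
  split; last by apply: openI => //; apply: open_comp; [move=> *; exact: rng_cont|case: cC].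
  have -> : U `&` rng @^-1` C = rng_section U @` C.
    apply/seteqP; split=> [x [Ux Cx]|_ [x Cx <-]].
      by exists (rng x) => //; rewrite rng_sectionK.
    by have [? e] := secrC _ Cx; split => //=; rewrite e.
  case: cC => cptC oC; apply: continuous_compact => //.
  rewrite continuous_open_subspace // => x /[!inE] Cx.
  have [Ux rx] := secrC _ Cx.
  move=> N /=; rewrite nbhsE => -[N' [oN' N'x] N'N].
  have := rng_section_near bU oU Ux oN' N'x; rewrite rx; apply: filterS => y.
  by move=> [b [_ N'b _ e]]; apply: N'N; rewrite e.
by [].
Qed.

(** As [rng] is an open map, the arrow of [U] over [rng c'] is close to the one
    over [rng c] if [c'] is close to [c]. *)
Lemma ldiv_near U c O : co_bisection U -> (rng @` U) (rng c) -> open O -> O (ldiv U c) ->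
  \forall c' \near c, (rng @` U) (rng c') /\ O (ldiv U c').
Proof.
move=> [bU [_ oU]] [a Ua ra] oO Oc.
have sec : rng_section U (rng c) = a by rewrite -ra rng_sectionK.
have comp : composable (ginv a, c) by rewrite /composable /= src_ginv.
have := @gmul_continuous G; rewrite subspace_continuousP => /(_ _ comp) cont.
have : \forall p \near within composable (nbhs (ginv a, c)), O (gmul p.1 p.2).
  apply: (cont O); apply: open_nbhs_nbhs; split => //.
  by move: Oc; rewrite /ldiv sec.
rewrite near_withinE => -[[A B] /= [nA nB] AB].
have nA' : \forall b \near a, A (ginv b) by exact: ginv_continuous.
move: nA'; rewrite /prop_near1 nbhsE => -[A' [oA' A'a] A'A].
have := rng_section_near bU oU Ua oA' A'a; rewrite ra => near1.
have near2 : \forall c' \near c, exists b,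
    [/\ U b, A' b, rng b = rng c' & rng_section U (rng c') = b] by exact: (@rng_cont c _ near1).
near=> c'.
have [b [Ub A'b rb sb]] : exists b,
    [/\ U b, A' b, rng b = rng c' & rng_section U (rng c') = b] by near: c'.
split; first by exists b.
rewrite /ldiv sb; apply: (AB (ginv b, c')); last by rewrite /composable /= src_ginv.
by split => /=; [exact: A'A|near: c'].
Unshelve. all: by end_near. Qed.

Lemma ldiv_cont U c : co_bisection U -> (rng @` U) (rng c) ->
  {for c, continuous (ldiv U)}.
Proof.
move=> cU rc N /=; rewrite nbhsE => -[N' [oN' N'x] N'N].
by apply: filterS (ldiv_near cU rc oN' N'x) => c' [_ /N'N].
Qed.

Lemma ldivK U a b : bisection U -> U a -> src a = rng b -> ldiv U (gmul a b) = b.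
Proof. by move=> bU Ua ab; rewrite /ldiv rng_gmul// rng_sectionK// gmulKV. Qed.

Lemma ldivE U a c : bisection U -> U a -> rng a = rng c -> ldiv U c = gmul (ginv a) c.
Proof. by move=> bU Ua ac; rewrite /ldiv -ac rng_sectionK. Qed.

Lemma bmulP U V c : bisection U ->
  bmul U V c <-> (rng @` U) (rng c) /\ V (ldiv U c).
Proof.
move=> bU; split.
  move=> [a [b [Ua Vb ab ->]]]; rewrite ldivK//; split => //.
  by exists a => //; rewrite rng_gmul.
move=> [[a Ua ac]]; rewrite (ldivE bU Ua ac) => Vc.
exists a, (gmul (ginv a) c); split => //; last by rewrite gmulVK.
by rewrite rng_gmul ?src_ginv// rng_ginv.
Qed.

Lemma binvK U : binv (binv U) = U.
Proof. by apply/seteqP; split => x; rewrite /binv /preimage/= ginvK. Qed.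

Lemma binv_co K : compact_and_open K -> compact_and_open (binv K).
Proof.
move=> [cK oK]; split; last by apply: open_comp => // x _; exact: ginv_continuous.
have -> : binv K = ginv @` K.
  apply/seteqP; split=> [x Kx|_ [x Kx <-]]; last by rewrite /binv/= ginvK.
  by exists (ginv x) => //; rewrite ginvK.
by apply: continuous_compact => //; apply: continuous_subspaceT; exact: ginv_continuous.
Qed.

Lemma ginv_inj : injective (@ginv G).
Proof. exact: can_inj ginvK. Qed.

Lemma binv_bisection U : bisection U -> bisection (binv U).
Proof.
move=> [ir is_]; split => x y /[!inE] /= Ux Uy e; apply: ginv_inj.
  by apply: is_; rewrite ?inE// !src_ginv.
by apply: ir; rewrite ?inE// !rng_ginv.
Qed.

Lemma binv_cob U : co_bisection U -> co_bisection (binv U).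
Proof. by move=> [bU cU]; split; [exact: binv_bisection|exact: binv_co]. Qed.

(** [bmul U K] is open as a preimage under [ldiv U], and compact as an image
    under [ldiv (binv U)]. *)
Lemma bmul_co U K : co_bisection U -> compact_and_open K -> compact_and_open (bmul U K).
Proof.
move=> cU [cK oK]; have [bU coU'] := cU; have ciU := binv_cob cU; split; last first.
  rewrite openE => c /(bmulP _ _ bU)[rc Kc].
  have := ldiv_near cU rc oK Kc; rewrite /interior /prop_near1; apply: filterS => x.
  by move=> /(bmulP _ _ bU).
have -> : bmul U K = ldiv (binv U) @` (K `&` rng @^-1` (src @` U)).
  apply/seteqP; split.
    move=> _ [a [b [Ua Kb ab ->]]]; exists b; first by split => //; exists a.
    rewrite (@ldivE _ (ginv a)) ?ginvK//; first by case: ciU.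
      by rewrite /binv /= ginvK.
    by rewrite rng_ginv.
  move=> _ [b [Kb [a Ua ab]] <-]; exists a, b; split => //.
  rewrite (@ldivE _ (ginv a)) ?ginvK//; first by case: ciU.
    by rewrite /binv /= ginvK.
  by rewrite rng_ginv.
have clU : clopen (rng @^-1` (src @` U)).
  by apply: preimage_clopen; [apply: (co_clopen ample_hausdorff); exact: src_co|exact: rng_cont].
have [cKU oKU] := coIclopen ample_hausdorff (conj cK oK) clU.
apply: continuous_compact => //; rewrite continuous_open_subspace //.
move=> b /[!inE] -[Kb [a Ua ab]]; apply: ldiv_cont => //.
by exists (ginv a); rewrite ?rng_ginv// /binv/= ginvK.
Qed.

Lemma bmul_bisection U V : bisection U -> bisection V -> bisection (bmul U V).
Proof.
move=> [rU sU] [rV sV]; split => _ _ /[!inE] -[a [b [Ua Vb ab ->]]] [a' [b' [Ua' Vb' ab' ->]]].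
  rewrite !rng_gmul// => e; have aa : a = a' by apply: rU; rewrite ?inE.
  by subst; congr gmul; apply: rV; rewrite ?inE// -ab.
rewrite !src_gmul// => e; have aa : b = b' by apply: sV; rewrite ?inE.
by subst; congr gmul; apply: sU; rewrite ?inE// ab.
Qed.

Lemma bmul_cob U V : co_bisection U -> co_bisection V -> co_bisection (bmul U V).
Proof.
by move=> cU [bV cV]; split; [apply: bmul_bisection => //; case: cU|exact: bmul_co].
Qed.

Lemma co_bisection_sub U V : co_bisection U -> compact_and_open V -> V `<=` U -> co_bisection V.
Proof.
move=> [[ir is_] _] cV VU; split => //.
by split=> x y /[!inE] /VU Ux /VU Uy; [apply: ir|apply: is_]; rewrite inE.
Qed.

Lemma unit_bisection : bisection (unit_space G).
Proof.
split=> x y /[!inE] ux uy; last by rewrite !unit_src.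
by rewrite ((unitP _).1 ux) ((unitP _).1 uy).
Qed.

Lemma unit_cob Z : compact_and_open Z -> Z `<=` unit_space G -> co_bisection Z.
Proof. by apply: co_bisection_sub; split; [exact: unit_bisection|exact: unit_co]. Qed.

Lemma src_preim Z : compact_and_open Z -> clopen (src @^-1` Z).
Proof. by move=> /(co_clopen ample_hausdorff) cZ; apply: preimage_clopen => //; exact: src_cont. Qed.

Lemma full_groupP U : full_group G U <->
  [/\ co_bisection U, rng @` U = unit_space G & src @` U = unit_space G].
Proof.
split; first by case=> bU cU oU rU sU; split.
by case=> [[bU [cU oU]]] rU sU; split.
Qed.

Lemma full_group_bmul U V : full_group G U -> full_group G V ->
  full_group G (bmul U V).
Proof.
move=> /full_groupP[cU rU sU] /full_groupP[cV rV sV]; apply/full_groupP; split.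
- exact: bmul_cob.
- apply/seteqP; split=> [_ [x _ <-]|x]; first exact: unit_rngP.
  rewrite -{1}rU => -[a Ua <-].
  have [_ /(_ (src a) (unit_srcP a))[b Vb ba]] := (seteqP _ _).1 rV.
  by exists (gmul a b); [exists a, b|rewrite rng_gmul].
- apply/seteqP; split=> [_ [x _ <-]|x]; first exact: unit_srcP.
  rewrite -{1}sV => -[b Vb <-].
  have [_ /(_ (rng b) (unit_rngP b))[a Ua ba]] := (seteqP _ _).1 sU.
  by exists (gmul a b); [exists a, b|rewrite src_gmul].
Qed.

Lemma full_group_binv U : full_group G U -> full_group G (binv U).
Proof.
move=> /full_groupP[cU rU sU]; apply/full_groupP; split; first exact: binv_cob.
- rewrite -sU; apply/seteqP; split=> [_ [x Ux <-]|_ [x Ux <-]].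
    by exists (ginv x); rewrite ?src_ginv.
  by exists (ginv x); rewrite ?rng_ginv// /binv/= ginvK.
- rewrite -rU; apply/seteqP; split=> [_ [x Ux <-]|_ [x Ux <-]].
    by exists (ginv x); rewrite ?rng_ginv.
  by exists (ginv x); rewrite ?src_ginv// /binv/= ginvK.
Qed.

Lemma full_group_unit : full_group G (unit_space G).
Proof.
apply/full_groupP; split; first by apply: unit_cob => //; exact: unit_co.
  by apply/seteqP; split=> [_ [x _ <-]|x ux]; [exact: unit_rngP|exists x => //; exact/unitP].
by apply/seteqP; split=> [_ [x _ <-]|x ux]; [exact: unit_srcP|exists x => //; exact/unit_src].
Qed.

(** The involution in the full group which exchanges the range and the source
    of [V] along [V] and fixes all other units. *)
Definition transposition (V : set G) : set G :=
  V `|` binv V `|` (unit_space G `\` (rng @` V `|` src @` V)).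

Lemma transposition_full V : co_bisection V -> (rng @` V) `&` (src @` V) = set0 ->
  full_group G (transposition V).
Proof.
move=> cV dis; have [[ir is_] coV] := cV.
have D a b : V a -> V b -> rng a = src b -> False.
  move=> Va Vb e; have : (rng @` V `&` src @` V) (rng a).
    by split; [exists a|rewrite e; exists b].
  by rewrite dis.
have N a x : V a -> (unit_space G `\` (rng @` V `|` src @` V)) x ->
    rng a <> x /\ src a <> x.
  by move=> Va [_ nx]; split => e; apply: nx; [left|right]; exists a.
have coR := rng_co coV; have coS := src_co coV.
apply/full_groupP; split.
- split; last first.
    apply: coU; first by apply: coU => //; exact: binv_co.
    apply: (coD ample_hausdorff unit_co); apply: (co_clopen ample_hausdorff); exact: coU.
  split=> x y /[!inE].
    move=> [[Vx|Vx]|ux] [[Vy|Vy]|uy] => e.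
    + by apply: ir; rewrite ?inE.
    + by case: (D x (ginv y)); rewrite ?src_ginv.
    + by case: (N x y Vx uy); rewrite e; case: uy => /unitP ->.
    + by case: (D y (ginv x)); rewrite ?src_ginv.
    + by apply: ginv_inj; apply: is_; rewrite ?inE// !src_ginv.
    + by case: (N _ _ Vx uy); rewrite rng_ginv src_ginv e; case: uy => /unitP ->.
    + by case: (N y x Vy ux); rewrite -e; case: ux => /unitP ->.
    + by case: (N _ _ Vy ux); rewrite rng_ginv src_ginv -e; case: ux => /unitP ->.
    + by case: ux uy e => /unitP -> _ [/unitP -> _].
  move=> [[Vx|Vx]|ux] [[Vy|Vy]|uy] => e.
  + by apply: is_; rewrite ?inE.
  + by case: (D (ginv y) x); rewrite ?rng_ginv.
  + by case: (N x y Vx uy); rewrite e; case: uy => /unit_src ->.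
  + by case: (D (ginv x) y); rewrite ?rng_ginv.
  + by apply: ginv_inj; apply: ir; rewrite ?inE// !rng_ginv.
  + by case: (N _ _ Vx uy); rewrite rng_ginv src_ginv e; case: uy => /unit_src ->.
  + by case: (N y x Vy ux); rewrite -e; case: ux => /unit_src ->.
  + by case: (N _ _ Vy ux); rewrite rng_ginv src_ginv -e; case: ux => /unit_src ->.
  + by case: ux uy e => /unit_src -> _ [/unit_src -> _].
- apply/seteqP; split=> [_ [x _ <-]|x ux]; first exact: unit_rngP.
  have [[a Va <-]|nr] := pselect ((rng @` V) x); first by exists a => //; left; left.
  have [[a Va <-]|ns] := pselect ((src @` V) x).
    by exists (ginv a); rewrite ?rng_ginv//; left; right; rewrite /binv/= ginvK.
  by exists x; [right; split => // -[]|exact/unitP].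
- apply/seteqP; split=> [_ [x _ <-]|x ux]; first exact: unit_srcP.
  have [[a Va <-]|nr] := pselect ((src @` V) x); first by exists a => //; left; left.
  have [[a Va <-]|ns] := pselect ((rng @` V) x).
    by exists (ginv a); rewrite ?src_ginv//; left; right; rewrite /binv/= ginvK.
  by exists x; [right; split => // -[]|exact/unit_src].
Qed.

Lemma disjoint_cob_basis g : rng g <> src g ->
  exists V, [/\ co_bisection V, V g & (rng @` V) `&` (src @` V) = set0].
Proof.
move=> rs; have := ample_hausdorff; rewrite open_hausdorff => /(_ (rng g) (src g)).
move=> [|[A B] [/= gA gB] [oA oB AB]]; first exact/eqP.
move: gA gB; rewrite !inE => gA gB.
have [|//|V [cV Vg VO]] := @co_bisection_basis g (rng @^-1` A `&` src @^-1` B).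
  by apply: openI; apply: open_comp => // x _; [exact: rng_cont|exact: src_cont].
exists V; split => //; apply/seteqP; split=> // x [[a Va ax] [b Vb bx]].
have : (A `&` B) x.
  by split; [rewrite -ax; case: (VO _ Va)|rewrite -bx; case: (VO _ Vb)].
by rewrite (eqP AB).
Qed.

Hypothesis horbit :
  forall x : G, unit_space G x -> `I_3 #<= groupoid_orbit x.

Lemma third_point x y : unit_space G x ->
  exists c, [/\ src c = x, rng c <> x & rng c <> y].
Proof.
move=> ux; have /card_leP[f0] := horbit ux.
pose f i := if pselect (`I_3 i) is left h then val (f0 (SigSub (mem_set h))) else x.
have H (i : nat) : (i < 3)%N -> exists c, src c = x /\ rng c = f i.
  move=> i3; rewrite /f; case: pselect => // h.
  by have /set_mem[c /= sc rc] := valP (f0 (SigSub (mem_set h))); exists c.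
have inj (i j : nat) : (i < 3)%N -> (j < 3)%N -> f i = f j -> i = j.
  move=> i3 j3; rewrite /f; case: pselect => // hi; case: pselect => // hj.
  by move=> /val_inj /(@inj _ _ _ f0) => /(_ (mem_set I) (mem_set I)) [].
have [//|c0 [s0 r0]] := H 0%N; have [//|c1 [s1 r1]] := H 1%N.
have [//|c2 [s2 r2]] := H 2%N.
have n01 : f 0%N <> f 1%N by move=> /inj; move=> /(_ isT isT).
have n02 : f 0%N <> f 2%N by move=> /inj; move=> /(_ isT isT).
have n12 : f 1%N <> f 2%N by move=> /inj; move=> /(_ isT isT).
have [e0|x0] := eqVneq (f 0%N) x.
  have [e1|y1] := eqVneq (f 1%N) y.
    by exists c2; split => //; rewrite r2 -?e0 -?e1; exact/nesym.
  by exists c1; split => //; rewrite r1; [rewrite -e0; exact/nesym|exact/eqP].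
have [e0|y0] := eqVneq (f 0%N) y.
  have [e1|x1] := eqVneq (f 1%N) x.
    by exists c2; split => //; rewrite r2 -?e0 -?e1; exact/nesym.
  by exists c1; split => //; rewrite r1; [exact/eqP|rewrite -e0; exact/nesym].
by exists c0; split => //; rewrite r0; exact/eqP.
Qed.

(** An arrow between distinct units lies in a transposition; an isotropy arrow
    is a product of two arrows between distinct units. *)
Lemma in_full_group g : exists U, full_group G U /\ U g.
Proof.
have [rs|rs] := pselect (rng g = src g); last first.
  have [V [cV Vg dis]] := disjoint_cob_basis rs.
  by exists (transposition V); split; [exact: transposition_full|left; left].
have [c [sc nc _]] := third_point (rng g) (unit_rngP g).
have [|V [cV Vg dis]] := @disjoint_cob_basis c; first by rewrite sc.
have [|W [cW Wg dis']] := @disjoint_cob_basis (gmul c g).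
  by rewrite rng_gmul// src_gmul// -rs.
exists (bmul (transposition V) (transposition W)); split.
  by apply: full_group_bmul; exact: transposition_full.
exists (ginv c), (gmul c g); split.
- by left; right; rewrite /binv/= ginvK.
- by left; left.
- by rewrite src_ginv rng_gmul.
- by rewrite gmulKV.
Qed.

End GroupoidTopology.

(** * The convolution algebra *)

Section ComplexContinuity.
Context {R : realType} {T : topologicalType}.
Local Notation C := R[i].
Implicit Types f g : T -> C.

(** Continuity as in the definition of [Cc]. *)
Definition cont f := continuous (f : T -> C^o).

Definition cont_at f x := {for x, continuous (f : T -> C^o)}.

Lemma cont_atP f x : cont_at f x <->
  forall e : C, 0 < e -> \forall y \near x, `|f x - f y| < e.
Proof.
split=> [/cvgrPdist_lt H e e0|H]; first exact: (H e e0).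
by apply/cvgrPdist_lt => e e0; exact: H.
Qed.

Lemma contD f g : cont f -> cont g -> cont (fun c => f c + g c).
Proof. move=> cf cg x; exact: (continuousD (cf x) (cg x)). Qed.

Lemma contM f g : cont f -> cont g -> cont (fun c => f c * g c).
Proof. move=> cf cg x; exact: (continuousM (cf x) (cg x)). Qed.

Lemma cont_cst (k : C) : cont (fun=> k).
Proof. by move=> x; exact: cst_continuous. Qed.

Lemma cont_conj f : cont f -> cont (fun c => (f c)^*).
Proof.
move=> cf x; apply/cont_atP => e e0; have /cont_atP/(_ e e0) := cf x.
by apply: filterS => y; rewrite -rmorphB norm_conjC.
Qed.

Lemma cont_sqrt f : (forall x, 0 <= f x) -> cont f -> cont (fun c => sqrtC (f c)).
Proof.
move=> f0 cf x; apply/cont_atP => e e0.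
have /cont_atP/(_ (e ^+ 2) (exprn_gt0 _ e0)) := cf x.
apply: filterS => y; set a := f x; set b := f y => ab.
have a0 : 0 <= sqrtC a by rewrite sqrtC_ge0; exact: f0.
have b0 : 0 <= sqrtC b by rewrite sqrtC_ge0; exact: f0.
suff : `|sqrtC a - sqrtC b| ^+ 2 < e ^+ 2.
  by rewrite ltr_pXn2r// nnegrE// ltW.
apply: le_lt_trans ab.
rewrite -{2}(sqrtCK a) -{2}(sqrtCK b) subr_sqr normrM expr2.
apply: ler_wpM2l => //; rewrite [X in _ <= X]ger0_norm ?addr_ge0//.
by rewrite (le_trans (ler_normB _ _))// !ger0_norm.
Qed.

Lemma cont_patch f (Z : set T) : clopen Z -> (forall x, Z x -> cont_at f x) ->
  cont (fun c => if `[< Z c >] then f c else 0).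
Proof.
move=> [oZ cZ] cf x; apply/cont_atP => e e0.
have [Zx|nZx] := pselect (Z x).
  have /cont_atP/(_ e e0) H := cf x Zx.
  have HZ : \forall y \near x, Z y by exact: open_nbhs_nbhs.
  near=> y; have Zy : Z y by near: y.
  by rewrite (asboolT Zx) (asboolT Zy); near: y.
have HZ : \forall y \near x, ~ Z y.
  by apply: open_nbhs_nbhs; split => //; exact: closed_openC.
near=> y; have Zy : ~ Z y by near: y.
by rewrite (asboolF nZx) (asboolF Zy) subrr normr0.
Unshelve. all: by end_near. Qed.

Lemma cont_indic (Z : set T) : clopen Z -> cont (\1_Z : T -> C).
Proof.
move=> cZ; have H x : Z x -> cont_at (fun=> 1) x by move=> _; exact: cont_cst.
suff -> : \1_Z = (fun c => if `[< Z c >] then 1 else 0) :> (T -> C).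
  exact: cont_patch.
apply/funext => x.
by rewrite indicE; case: asboolP => h; [rewrite mem_set|rewrite memNset].
Qed.

Lemma cont_comp (T' : topologicalType) f (k : T' -> T) (x : T') :
  cont f -> {for x, continuous k} ->
  {for x, continuous ((fun y => f (k y)) : T' -> C^o)}.
Proof.
move=> cf ck; exact: (@continuous_comp _ _ (C^o) k f x ck (cf (k x))).
Qed.

End ComplexContinuity.

Definition supported {R : realType} {T : Type} (f : T -> R[i]) (Z : set T) :=
  forall c, ~ Z c -> f c = 0.

Section CcAlgebra.
Context {R : realType} {G : topGroupoidType}.
Local Notation C := R[i].
Hypothesis hample : ample G.
Hypothesis hcompact : compact (unit_space G).
Hypothesis horbit :
  forall x : G, unit_space G x -> `I_3 #<= groupoid_orbit x.
Implicit Types (U V W K Z O : set G) (a b c x : G).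
Implicit Types f g h : G -> C.
Local Notation Cc := (@Cc R G).
Local Notation G0 := (unit_space G).
Local Notation haus := (ample_hausdorff hample).

Lemma supp_mono f Z K : Z `<=` K -> supported f Z -> supported f K.
Proof. by move=> ZK fZ c nK; apply: fZ => /ZK. Qed.

Lemma supp_indic Z : supported (\1_Z : G -> C) Z.
Proof. by move=> c nZ; rewrite indicE memNset. Qed.

Lemma CcP f : Cc f <-> cont f /\ exists2 K, compact_and_open K & supported f K.
Proof.
split=> [[cf csupp]|[cf [K coK fK]]]; split => //.
  suff [K [coK SK]] : exists K, compact_and_open K /\ (closure [set c | f c != 0] `<=` K).
    exists K => // c nK; apply/eqP; apply: contrapT => /negP fc.
    by apply/nK/SK/subset_closure.
  pose P A := exists K, compact_and_open K /\ (A `<=` K).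
  suff : P (closure [set c | f c != 0]) by [].
  apply: compact_ind => //.
  - by exists set0; split => //; exact: co0.
  - by move=> A B AB [K [coK BK]]; exists K; split => //; exact: subset_trans BK.
  - move=> A B [K [coK AK]] [L [coL BL]]; exists (K `|` L); split; first exact: coU.
    exact: setUSS.
  - move=> x _; have [V [[_ cV] Vx _]] := co_bisection_basis hample hcompact openT (I : setT x).
    exists V; first by apply: open_nbhs_nbhs; split => //; case: cV.
    by exists V; split.
have cS : closure [set c | f c != 0] `<=` K.
  rewrite [K in _ `<=` K](closure_id _).1; last exact: (co_closed haus).
  apply: closure_subset => c /= fc; apply: contrapT => /fK fc0.
  by rewrite fc0 eqxx in fc.
by apply: subclosed_compact cS; [exact: closed_closure|case: coK].
Qed.

Lemma Cc_cont f : Cc f -> cont f. Proof. by case. Qed.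

Lemma CcD f g : Cc f -> Cc g -> Cc (fun c => f c + g c).
Proof.
move=> /CcP[cf [K cK fK]] /CcP[cg [L cL gL]]; apply/CcP; split; first exact: contD.
exists (K `|` L); first exact: coU.
by move=> c /not_orP[nK nL]; rewrite fK// gL// addr0.
Qed.

Lemma CcZ (k : C) f : Cc f -> Cc (fun c => k * f c).
Proof.
move=> /CcP[cf [K cK fK]]; apply/CcP; split.
  exact: (contM (@cont_cst _ _ k) cf).
by exists K => // c nK; rewrite fK// mulr0.
Qed.

Lemma CcMl f g : cont f -> Cc g -> Cc (fun c => f c * g c).
Proof.
move=> cf /CcP[cg [K cK gK]]; apply/CcP; split; first exact: contM.
by exists K => // c nK; rewrite gK// mulr0.
Qed.

Lemma Cc0 : Cc (fun=> 0).
Proof.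
apply/CcP; split; first exact: cont_cst.
by exists set0 => //; exact: co0.
Qed.

Lemma Cc_indic Z : compact_and_open Z -> Cc \1_Z.
Proof.
move=> cZ; apply/CcP; split; first by apply: cont_indic; exact: (co_clopen haus).
by exists Z => //; exact: supp_indic.
Qed.

Lemma Cc_star f : Cc f -> Cc (fstar f).
Proof.
move=> /CcP[cf [K cK fK]]; apply/CcP; split.
  have ci : cont (fun c => f (ginv c)).
    by move=> x; apply: (cont_comp cf); exact: ginv_continuous.
  exact: (cont_conj ci).
by exists (binv K); [exact: binv_co|move=> c nK; rewrite /fstar fK// conjC0].
Qed.

(** Each arrow lies in an element of the full group, so compactness splits a
    function in [Cc] into finitely many functions supported in such elements. *)
Lemma Cc_ind (P : (G -> C) -> Prop) :
  (forall U f, full_group G U -> Cc f -> supported f U -> P f) ->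
  (forall f g, Cc f -> Cc g -> P f -> P g -> P (fun c => f c + g c)) ->
  forall f, Cc f -> P f.
Proof.
move=> P1 PD f Cf; have [cf [K coK fK]] := (CcP f).1 Cf.
pose Q Z := forall g, Cc g -> supported g Z -> P g.
suff : Q K by apply.
apply: (compact_open_ind haus coK).
- move=> g Cg g0; apply: (P1 G0) => //; first exact: full_group_unit.
  by apply: supp_mono g0.
- move=> Z L coZ coL ZL QZ QL g Cg gZL.
  have cZ : cont (\1_Z : G -> C) by apply: cont_indic; exact: (co_clopen haus).
  have cL : cont (\1_L : G -> C) by apply: cont_indic; exact: (co_clopen haus).
  have -> : g = (fun c => \1_Z c * g c + \1_L c * g c).
    apply/funext => c; rewrite !indicE.
    have [Zc|nZ] := pselect (Z c).
      rewrite mem_set// memNset ?mul1r ?mul0r ?addr0// => Lc.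
      by have : (Z `&` L) c by []; rewrite ZL.
    rewrite (memNset nZ) mul0r add0r; have [Lc|nL] := pselect (L c).
      by rewrite mem_set// mul1r.
    by rewrite memNset// mul0r gZL// => -[].
  apply: PD; try exact: CcMl.
    by apply: QZ; [exact: CcMl|move=> c nZ; rewrite supp_indic// mul0r].
  by apply: QL; [exact: CcMl|move=> c nZ; rewrite supp_indic// mul0r].
- move=> x _; have [U [fU Ux]] := in_full_group hample hcompact horbit x.
  have [[_ cU] _ _] := (full_groupP U).1 fU.
  exists U; split => // Z coZ ZU g Cg gZ; apply: (P1 U) => //.
  exact: supp_mono gZ.
Qed.

Lemma Cc_bounded f : Cc f -> exists2 M : C, 0 <= M & forall c, `|f c| <= M.
Proof.
move=> /CcP[cf [K coK fK]].
pose P A := exists2 M : C, 0 <= M & forall c, A c -> `|f c| <= M.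
have [M M0 fM] : P K; last first.
  exists M => // c; have [Kc|nK] := pselect (K c); first exact: fM.
  by rewrite fK// normr0.
apply: compact_ind => //.
- by exists 0.
- by move=> A B AB [M M0 BM]; exists M => // c /AB; exact: BM.
- move=> A B [M M0 AM] [N N0 BN]; exists (M + N); first exact: addr_ge0.
  move=> c [/AM|/BN] h; apply: le_trans h _; first by rewrite lerDl.
  by rewrite lerDr.
- by case: coK.
- move=> x _; have /cont_atP/(_ 1 ltr01) h := cf x.
  exists [set y | `|f x - f y| < 1] => //; exists (`|f x| + 1).
    by rewrite addr_ge0.
  move=> c /= xc; rewrite -[f c](subKr (f x)).
  by rewrite (le_trans (ler_normB _ _))// lerD2l ltW.
Qed.

Lemma fsum_single (I : choiceType) (P : set I) (F : I -> C) i :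
  P i -> (forall j, P j -> j <> i -> F j = 0) -> \sum_(j \in P) F j = F i.
Proof.
move=> Pi F0; rewrite -(fsbig_widen [set i] P) ?fsbig_set1//.
  by move=> j ->.
by move=> j [Pj /= /F0]; exact.
Qed.

Lemma convol_single f g a b c : src a = rng b -> gmul a b = c ->
  (forall a' b', src a' = rng b' -> gmul a' b' = c -> a' <> a -> f a' * g b' = 0) ->
  convolution f g c = f a * g b.
Proof.
move=> ab abc H; rewrite /convolution (@fsum_single _ _ _ (a, b))//.
move=> [a' b'] [/= a'b' e] n; apply: H => //.
  move=> aa; apply: n; subst a'; congr (_, _).
  by apply: (@gmul_injl _ a) => //; rewrite e.
Qed.

Lemma convol_none f g c :
  (forall a b, src a = rng b -> gmul a b = c -> f a * g b = 0) ->
  convolution f g c = 0.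
Proof. by move=> H; apply: fsbig1 => -[a b] [/= ? ?]; exact: H. Qed.

Lemma convolE f g c : convolution f g c =
  \sum_(a \in [set a | rng a = rng c]) f a * g (gmul (ginv a) c).
Proof.
rewrite /convolution (@reindex_fsbig _ _ _ _ _ (fun a => (a, gmul (ginv a) c))
  [set a | rng a = rng c])//.
split.
- move=> a /= ac; split; rewrite /composable/=.
    by rewrite rng_gmul ?src_ginv// rng_ginv.
  by rewrite gmulVK.
- by move=> a b _ _ [].
- move=> [a b] [/= ab abc]; exists a; first by rewrite /= -abc rng_gmul.
  by rewrite -abc gmulKV.
Qed.

Lemma full_rng U x : full_group G U -> exists2 a, U a & rng a = rng x.
Proof.
move=> [_ _ _ rU _]; have [_ /(_ (rng x) (unit_rngP x))[a Ua ax]] := (seteqP _ _).1 rU.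
by exists a.
Qed.

Lemma full_src U x : full_group G U -> exists2 a, U a & src a = src x.
Proof.
move=> [_ _ _ _ rU]; have [_ /(_ (src x) (unit_srcP x))[a Ua ax]] := (seteqP _ _).1 rU.
by exists a.
Qed.

(** Only one term of the convolution survives if the left factor lives on a
    bisection. *)
Lemma convol1 U f g a c : bisection U -> supported f U -> U a -> rng a = rng c ->
  convolution f g c = f a * g (gmul (ginv a) c).
Proof.
move=> bU fU Ua ac; apply: convol_single.
- by rewrite rng_gmul ?src_ginv// rng_ginv.
- exact: gmulVK.
- move=> a' b' ab' abc na; rewrite fU ?mul0r// => Ua'; apply: na.
  by case: bU => inj _; apply: inj; rewrite ?inE// ac -abc rng_gmul.
Qed.

Lemma convol2 U f g b c : bisection U -> supported g U -> U b -> src b = src c ->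
  convolution f g c = f (gmul c (ginv b)) * g b.
Proof.
move=> bU gU Ub bc; apply: convol_single.
- by rewrite src_gmul ?src_ginv// rng_ginv.
- by rewrite -gmulA ?rng_ginv ?src_ginv// gmulVg bc gmul_src.
- move=> a' b' ab' abc na; rewrite gU ?mulr0// => Ub'; apply: na.
  have -> : b = b' by case: bU => _ inj; apply: inj; rewrite ?inE// bc -abc src_gmul.
  by rewrite -abc gmulIK.
Qed.

(** A bisection meets each range fibre at most once.  The finiteness makes the
    convolution additive on the left. *)
Lemma fin_fib f x : Cc f -> finite_set [set a | rng a = x /\ f a != 0].
Proof.
move: f; apply: Cc_ind => [U f fU Cf sf|f g _ _ Ff Fg].
  apply: (sub_finite_set _ (finite_set1 (rng_section U x))) => a [ra fa].
  have Ua : U a by apply: contrapT => /sf e; rewrite e eqxx in fa.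
  by rewrite -ra rng_sectionK//; case: fU.
apply: sub_finite_set (_ : finite_set (_ `|` _)) => [a [ra fa]|]; last first.
  rewrite finite_setU; split; [exact: Ff|exact: Fg].
have [f0|f0] := eqVneq (f a) 0; last by left.
by right; split => //; rewrite f0 add0r in fa.
Qed.

Lemma fsum_fibD f g (F : G -> C) (x : G) : Cc f -> Cc g ->
  \sum_(a \in [set a | rng a = x]) (f a + g a) * F a =
  \sum_(a \in [set a | rng a = x]) f a * F a +
  \sum_(a \in [set a | rng a = x]) g a * F a.
Proof.
move=> Cf Cg.
set S := [set a | rng a = x /\ f a != 0] `|` [set a | rng a = x /\ g a != 0].
have finS : finite_set S by rewrite finite_setU; split; exact: fin_fib.
have SP : S `<=` [set a | rng a = x] by move=> a [[]|[]].
have S0 a : ([set a | rng a = x] `\` S) a -> f a = 0 /\ g a = 0.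
  move=> [ra /not_orP[nf ng]]; split; apply/eqP; apply: contrapT => /negP h.
    exact: nf.
  exact: ng.
rewrite -!(fsbig_widen S [set a | rng a = x])//.
- under eq_fsbigr do rewrite mulrDl.
  exact: fsbig_split.
- by move=> a /S0[_ /= ->]; rewrite mul0r.
- by move=> a /S0[/= -> _]; rewrite mul0r.
- by move=> a /S0[/= -> ->]; rewrite addr0 mul0r.
Qed.

Lemma convolDl f f' g : Cc f -> Cc f' -> convolution (fun c => f c + f' c) g =
  (fun c => convolution f g c + convolution f' g c).
Proof. by move=> Cf Cf'; apply/funext => c; rewrite !convolE fsum_fibD. Qed.

Lemma convolZl (k : C) f g : convolution (fun c => k * f c) g =
  (fun c => k * convolution f g c).
Proof.
by apply/funext => c; rewrite /convolution mulr_fsumr; under eq_fsbigr do rewrite -mulrA.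
Qed.

Lemma convolZr (k : C) f g : convolution f (fun c => k * g c) =
  (fun c => k * convolution f g c).
Proof.
by apply/funext => c; rewrite /convolution mulr_fsumr; under eq_fsbigr do rewrite mulrCA.
Qed.

Lemma convolDr f g g' : Cc f -> convolution f (fun c => g c + g' c) =
  (fun c => convolution f g c + convolution f g' c).
Proof.
move: f; apply: Cc_ind => [U f fU Cf sf|f f' Cf Cf' Hf Hf'].
  apply/funext => c; have [a Ua ac] := full_rng c fU; have bU : bisection U by case: fU.
  by rewrite !(convol1 _ bU sf Ua ac) mulrDr.
rewrite !convolDl// Hf Hf'; apply/funext => c; exact: addrACA.
Qed.

(** By additivity the left factor lives on an element [U] of the full group;
    then the convolution is a product of functions composed with continuous maps. *)
Lemma Cc_conv f g : Cc f -> Cc g -> Cc (convolution f g).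
Proof.
move=> + Cg; move: f; apply: Cc_ind => [U f fU Cf sf|f f' Cf Cf' Hf Hf']; last first.
  by rewrite convolDl//; exact: CcD.
have [cU rU sU] := (full_groupP U).1 fU; have [bU coU] := cU.
have E c : convolution f g c = f (rng_section U (rng c)) * g (ldiv U c).
  have [a Ua ac] := full_rng c fU.
  by rewrite (convol1 _ bU sf Ua ac) -(ldivE bU Ua ac) -ac rng_sectionK.
have [cg [K coK gK]] := (CcP g).1 Cg; have cf := Cc_cont Cf.
have rc c : (rng @` U) (rng c) by rewrite rU; exact: unit_rngP.
apply/CcP; split; last first.
  exists (bmul U K); first exact: bmul_co.
  move=> c nc; rewrite E [g _]gK ?mulr0// => Kc; apply: nc.
  by apply/bmulP.
have -> : convolution f g = (fun c => f (rng_section U (rng c)) * g (ldiv U c)).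
  by apply/funext => c; exact: E.
apply: contM => x.
  apply/cont_atP => e e0; have [a Ua ax] := full_rng x fU.
  have /cont_atP/(_ e e0) := cf a; rewrite /prop_near1 nbhsE => -[N [oN Na] NE].
  have oU : open U by case: coU.
  have := rng_section_near hample bU oU Ua oN Na; rewrite ax => near1.
  have near2 : \forall y \near x, exists b,
      [/\ U b, N b, rng b = rng y & rng_section U (rng y) = b].
    exact: (@rng_cont _ hample x _ near1).
  apply: filterS near2 => y /= [b [_ Nb _ eb]].
  by rewrite eb -ax rng_sectionK//; exact: NE.
have lc : {for x, continuous (ldiv U)} by exact: ldiv_cont.
exact: (cont_comp cg lc).
Qed.

(** Once the left factor lives on one bisection, both sides are single sums over
    a range fibre, related by a translation. *)
Lemma convolA f g h : Cc f -> Cc g ->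
  convolution f (convolution g h) = convolution (convolution f g) h.
Proof.
move=> + Cg; move: f; apply: Cc_ind => [U f fU Cf sf|f f' Cf Cf' Hf Hf']; last first.
  by rewrite !convolDl// ?Hf ?Hf'//; exact: Cc_conv.
have bU : bisection U by case: fU.
apply/funext => c; have [a Ua ac] := full_rng c fU.
rewrite (convol1 _ bU sf Ua ac) !convolE mulr_fsumr.
have sac : src (ginv a) = rng c by rewrite src_ginv.
rewrite rng_gmul// rng_ginv.
rewrite (@reindex_fsbig _ _ _ _ _ (gmul a) [set b | rng b = src a]
   [set d | rng d = rng c]).
  apply: eq_fsbigr => b /[!inE] /= ba.
  rewrite (@convol1 U f g a (gmul a b))// ?rng_gmul//.
  rewrite gmulKV// mulrA; congr (_ * h _).
  rewrite ginv_gmul// -gmulA ?src_ginv ?rng_ginv//.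
split.
- by move=> b /= ba; rewrite rng_gmul.
- by move=> b b' /[!inE] /= ba ba'; exact: gmul_injl.
- move=> d /= dc; exists (gmul (ginv a) d).
    by rewrite /= rng_gmul ?src_ginv ?rng_ginv// dc.
  by rewrite gmulVK// dc.
Qed.

Lemma fstarK f : fstar (fstar f) = f.
Proof. by apply/funext => c; rewrite /fstar ginvK conjCK. Qed.

Lemma fstarD f g : fstar (fun c => f c + g c) = (fun c => fstar f c + fstar g c).
Proof. by apply/funext => c; rewrite /fstar rmorphD. Qed.

Lemma fstarZ (k : C) f : fstar (fun c => k * f c) = (fun c => k^* * fstar f c).
Proof. by apply/funext => c; rewrite /fstar rmorphM. Qed.

Lemma supp_star f U : supported f U -> supported (fstar f) (binv U).
Proof. by move=> fU c nU; rewrite /fstar fU// conjC0. Qed.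

Lemma fstarM f g : Cc f -> Cc g ->
  fstar (convolution f g) = convolution (fstar g) (fstar f).
Proof.
move=> + Cg; move: f; apply: Cc_ind => [U f fU Cf sf|f f' Cf Cf' Hf Hf']; last first.
  by rewrite !convolDl// !fstarD Hf Hf' convolDr//; exact: Cc_star.
have bU : bisection U by case: fU.
apply/funext => c; have [a Ua ac] := full_rng (ginv c) fU.
have Uai : binv U (ginv a) by rewrite /binv/= ginvK.
have sac : src (ginv a) = src c by rewrite src_ginv ac rng_ginv.
rewrite (convol2 _ (binv_bisection bU) (supp_star sf) Uai sac).
rewrite /fstar (convol1 _ bU sf Ua ac) rmorphM mulrC !ginvK.
congr ((g _)^* * _); rewrite ginv_gmul ?ginvK//.
by rewrite ac rng_ginv.
Qed.

Lemma supp_unit : supported (\1_G0 : G -> C) G0. Proof. exact: supp_indic. Qed.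

Lemma indic_in Z c : Z c -> (\1_Z c : C) = 1.
Proof. by move=> Zc; rewrite indicE mem_set. Qed.

Lemma indic_out Z c : ~ Z c -> (\1_Z c : C) = 0.
Proof. by move=> Zc; rewrite indicE memNset. Qed.

Lemma convol1f f : convolution \1_G0 f = f.
Proof.
apply/funext => c.
have rr : rng (rng c) = rng c by exact: rng_rng.
rewrite (convol1 _ unit_bisection supp_unit (unit_rngP c) rr).
by rewrite indic_in ?mul1r ?ginv_unit ?gmul_rng//; exact: unit_rngP.
Qed.

Lemma convolf1 f : convolution f \1_G0 = f.
Proof.
apply/funext => c.
rewrite (convol2 _ unit_bisection supp_unit (unit_srcP c) (src_src c)).
by rewrite indic_in ?mulr1 ?ginv_unit ?gmul_src//; exact: unit_srcP.
Qed.

Lemma convol_unitl f g c : supported f G0 -> convolution f g c = f (rng c) * g c.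
Proof.
move=> sf; rewrite (convol1 _ unit_bisection sf (unit_rngP c) (rng_rng c)).
by rewrite ginv_unit ?gmul_rng//; exact: unit_rngP.
Qed.

Lemma convol_unit f g : supported f G0 -> supported g G0 ->
  convolution f g = (fun c => f c * g c).
Proof.
move=> sf sg; apply/funext => c; rewrite convol_unitl//.
have [/unitP ->//|nc] := pselect (G0 c).
by rewrite [g c]sg// !mulr0.
Qed.

Lemma fstar_unit f : supported f G0 -> fstar f = (fun c => (f c)^*).
Proof.
move=> sf; apply/funext => c; rewrite /fstar.
have [uc|nc] := pselect (G0 c); first by rewrite ginv_unit.
rewrite !sf// => ug; apply: nc; rewrite -(ginvK c) (ginv_unit ug)//.
Qed.

Lemma convol_indic U V : bisection U -> convolution \1_U \1_V = \1_(bmul U V) :> (G -> C).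
Proof.
move=> bU; apply/funext => c.
have [[a Ua ac]|n] := pselect ((rng @` U) (rng c)); last first.
  rewrite indic_out; last by move=> /(bmulP _ _ bU)[].
  apply: convol_none => a b ab abc; rewrite indic_out ?mul0r// => Ua; apply: n.
  by exists a => //; rewrite -abc rng_gmul.
rewrite (convol1 _ bU (@supp_indic U) Ua ac) indic_in// mul1r -(ldivE bU Ua ac).
have [Vc|nVc] := pselect (V (ldiv U c)).
  by rewrite !indic_in//; apply/bmulP => //; split => //; exists a.
by rewrite !indic_out// => /(bmulP _ _ bU)[].
Qed.

Lemma fstar_indic U : fstar \1_U = \1_(binv U) :> (G -> C).
Proof.
apply/funext => c; rewrite /fstar !indicE conjC_nat; congr (_%:R).
Qed.

(** Nonnegative functions on the unit space are of the form [fstar h] times [h].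
    This replaces functional calculus in the whole proof. *)
Lemma unit_sqrt f : Cc f -> supported f G0 -> (forall c, 0 <= f c) ->
  exists h, [/\ Cc h, supported h G0, fstar h = h & convolution h h = f].
Proof.
move=> Cf sf f0; have cf := Cc_cont Cf.
pose h c := sqrtC (f c).
have sh : supported h G0 by move=> c nc; rewrite /h sf// sqrtC0.
have Ch : Cc h.
  apply/CcP; split; first exact: cont_sqrt.
  by exists G0 => //; exact: unit_co.
exists h; split => //.
  rewrite fstar_unit//; apply/funext => c; apply: geC0_conj.
  by rewrite sqrtC_ge0.
by rewrite convol_unit//; apply/funext => c; rewrite -expr2 sqrtCK.
Qed.

End CcAlgebra.

(** * Real-valued norms and C*-algebra identities *)

(** The norm of the library takes its values in [R[i]]; inequalities are
    handled in [R]. *)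
Definition nrm {R : realType} {V : normedModType R[i]} (a : V) : R := complex.Re `|a|.

Definition cabs {R : realType} (z : R[i]) : R := complex.Re `|z|.

Section Norms.
Context {R : realType}.
Implicit Types z w : R[i].

Lemma ReD z w : complex.Re (z + w) = complex.Re z + complex.Re w.
Proof. by case: z; case: w. Qed.

Lemma ReN z : complex.Re (- z) = - complex.Re z.
Proof. by case: z. Qed.

Lemma ReZ (k : R) z : complex.Re (k%:C * z) = k * complex.Re z.
Proof. by case: z => a b /=; rewrite mul0r subr0. Qed.

Lemma ge0_ReE z : 0 <= z -> z = (complex.Re z)%:C.
Proof. by case: z => a b; rewrite lecE /= => /andP[/eqP -> _]. Qed.

Lemma cRe_conj z : complex.Re z^*%R = complex.Re z.
Proof. by case: z. Qed.

Lemma ge0_Re z : 0 <= z -> 0 <= complex.Re z.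
Proof. by rewrite lecE => /andP[]. Qed.

Lemma rcD (x y : R) : (x + y)%:C = x%:C + y%:C. Proof. exact: rmorphD. Qed.
Lemma rcM (x y : R) : (x * y)%:C = x%:C * y%:C. Proof. exact: rmorphM. Qed.
Lemma rcN (x : R) : (- x)%:C = - x%:C. Proof. exact: rmorphN. Qed.
Lemma rcX (x : R) n : (x ^+ n)%:C = x%:C ^+ n. Proof. exact: rmorphXn. Qed.

Lemma cabsE z : `|z| = (cabs z)%:C.
Proof. by apply: ge0_ReE. Qed.

Lemma cabs_ge0 z : 0 <= cabs z. Proof. exact: ge0_Re. Qed.

Lemma cabsD z w : cabs (z + w) <= cabs z + cabs w.
Proof. by rewrite -lecR rcD -!cabsE ler_normD. Qed.

Lemma cabsM z w : cabs (z * w) = cabs z * cabs w.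
Proof. by apply: complexI; rewrite rcM -!cabsE normrM. Qed.

Lemma cabsN z : cabs (- z) = cabs z.
Proof. by rewrite /cabs normrN. Qed.

Lemma cabs_real (x : R) : cabs x%:C = `|x|.
Proof.
rewrite /cabs; have [x0|x0] := leP 0 x; first by rewrite !ger0_norm// lecR.
by rewrite !ltr0_norm ?ltcR//.
Qed.

Lemma cabs_conj z : cabs z^*%R = cabs z.
Proof. by rewrite /cabs norm_conjC. Qed.

Lemma Re_le_cabs z : complex.Re z <= cabs z.
Proof.
rewrite -lecR -cabsE; apply: le_trans (normc_ge_Re z).
by rewrite lecR ler_norm.
Qed.

Lemma cabs0_eq0 z : cabs z = 0 -> z = 0.
Proof. by move=> z0; apply/eqP; rewrite -normr_eq0 cabsE z0. Qed.

Lemma cabs_sqr z : ((cabs z) ^+ 2)%:C = z^*%R * z.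
Proof. by rewrite rcX -cabsE normCKC. Qed.

Context {V : normedModType R[i]}.
Implicit Types a b c : V.

Lemma nrmE a : `|a| = (nrm a)%:C.
Proof. by apply: ge0_ReE. Qed.

Lemma nrm_ge0 a : 0 <= nrm a. Proof. exact: ge0_Re. Qed.

Lemma nrmD a b : nrm (a + b) <= nrm a + nrm b.
Proof. by rewrite -lecR rcD -!nrmE ler_normD. Qed.

Lemma nrmN a : nrm (- a) = nrm a.
Proof. by rewrite /nrm normrN. Qed.

Lemma nrmB a b : nrm (a - b) <= nrm a + nrm b.
Proof. by rewrite (le_trans (nrmD _ _))// nrmN. Qed.

Lemma nrmZ (k : R[i]) a : nrm (k *: a) = cabs k * nrm a.
Proof.
by apply: complexI; rewrite [RHS]rcM -(nrmE (k *: a)) -(nrmE a) -cabsE normrZ.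
Qed.

Lemma nrm0 : nrm (0 : V) = 0. Proof. by rewrite /nrm normr0. Qed.

Lemma nrm0_eq0 a : nrm a = 0 -> a = 0.
Proof. by move=> a0; apply/eqP; rewrite -normr_eq0 nrmE a0. Qed.

Lemma closureP (S : set V) a :
  closure S a <-> forall e : R, 0 < e -> exists2 b, S b & nrm (a - b) < e.
Proof.
split=> [cl e e0|H].
  have /cl[b [Sb ab]] : nbhs a (ball a e%:C) by apply: nbhsx_ballx; rewrite ltcR.
  by exists b => //; rewrite -ltcR -nrmE; move: ab; rewrite -ball_normE.
move=> N /nbhs_ballP[e /= e0 eN].
have eE := ge0_ReE (ltW e0).
have [|b Sb ab] := H (complex.Re e); first by rewrite -ltcR -eE.
by exists b; split => //; apply: eN; rewrite -ball_normE /= nrmE eE ltcR.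
Qed.

Lemma closed_nrm (S : set V) a : closed S ->
  (forall e : R, 0 < e -> exists2 b, S b & nrm (a - b) < e) -> S a.
Proof. by move=> cS H; apply: cS; apply/closureP. Qed.

End Norms.

Section CstarBasics.
Context {R : realType} {A : cstarAlgType R}.
Implicit Types a b c d : A.
Local Infix "**" := cmul (at level 40, left associativity).

Lemma cmul0l a : 0 ** a = 0.
Proof. by rewrite -[0 in LHS](scale0r (0 : A)) cmulZl scale0r. Qed.

Lemma cmul0r a : a ** 0 = 0.
Proof. by rewrite -[0 in LHS](scale0r (0 : A)) cmulZr scale0r. Qed.

Lemma cmulNl a b : (- a) ** b = - (a ** b).
Proof. by rewrite -scaleN1r cmulZl scaleN1r. Qed.

Lemma cmulNr a b : a ** (- b) = - (a ** b).
Proof. by rewrite -scaleN1r cmulZr scaleN1r. Qed.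

Lemma cmulBl a b c : (a - b) ** c = a ** c - b ** c.
Proof. by rewrite cmulDl cmulNl. Qed.

Lemma cmulBr a b c : a ** (b - c) = a ** b - a ** c.
Proof. by rewrite cmulDr cmulNr. Qed.

Lemma star0 : star (0 : A) = 0.
Proof. by rewrite -[0 in LHS](scale0r (0 : A)) starZ conjC0 scale0r. Qed.

Lemma starN a : star (- a) = - star a.
Proof. by rewrite -scaleN1r starZ rmorphN1 scaleN1r. Qed.

Lemma starB a b : star (a - b) = star a - star b.
Proof. by rewrite starD starN. Qed.

Lemma star1 : star (cone : A) = cone.
Proof. by rewrite -[RHS]starK -[X in _ = star X]cmulr1 starM starK cmulr1. Qed.

Lemma nrmM a b : nrm (a ** b) <= nrm a * nrm b.
Proof. by rewrite -lecR rcM -!nrmE ler_norm_cmul. Qed.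

Lemma nrm_cstar a : nrm (star a ** a) = nrm a ^+ 2.
Proof. by apply: complexI; rewrite rcX -!nrmE norm_star_cmul. Qed.

Lemma nrm_star a : nrm (star a) = nrm a.
Proof.
have H b : nrm b <= nrm (star b).
  have [->|b0] := eqVneq b 0; first by rewrite star0.
  have nb : 0 < nrm b.
    rewrite lt_def nrm_ge0 andbT; apply: contra_neq b0; exact: nrm0_eq0.
  by rewrite -(ler_pM2r nb) -expr2 -nrm_cstar nrmM.
by apply/eqP; rewrite eq_le H -{2}(starK a) H.
Qed.

Lemma nrm1_le1 : nrm (cone : A) <= 1.
Proof.
have := nrm_cstar cone; rewrite star1 cmul1r => e.
have [->|n0] := eqVneq (nrm (cone : A)) 0; first exact: ler01.
by rewrite -[leLHS](mulfK n0) -expr2 -e divff.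
Qed.

End CstarBasics.

(** * The theorem of Hahn and Banach *)

Section HahnBanach.
Context {R : realType} {V : normedModType R[i]}.
Implicit Types (X : set (V * R)) (a b : V).

Let good X := [/\ X (0, 0),
  forall p q, X p -> X q -> X (p.1 + q.1, p.2 + q.2),
  forall (k : R) p, X p -> X (k%:C *: p.1, k * p.2) &
  forall p, X p -> p.2 <= nrm p.1].

Let good_fun X a r s : good X -> X (a, r) -> X (a, s) -> r = s.
Proof.
move=> [X0 XD XZ Xn].
have H p q : X (a, p) -> X (a, q) -> p <= q.
  move=> Xp Xq; have := XD _ _ Xp (XZ (-1) _ Xq) => /Xn /=.
  rewrite rcN scaleN1r subrr nrm0 mulN1r subr_le0//.
by move=> Xr Xs; apply/eqP; rewrite eq_le !H.
Qed.

(** The classical one-dimensional step: the value [c] at the new vector has to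
    lie between all [r - nrm (b - a)] and all [nrm (b + a) - r] with [(b, r)]
    in the graph. *)
Let good_extend X a : good X -> exists Y, [/\ good Y, X `<=` Y & exists r, Y (a, r)].
Proof.
move=> gX; have [X0 XD XZ Xn] := gX.
pose S := [set p.2 - nrm (p.1 - a) | p in X].
have bnd p q : X p -> X q -> p.2 - nrm (p.1 - a) <= nrm (q.1 + a) - q.2.
  move=> Xp Xq; have /Xn /= h := XD _ _ Xp Xq.
  have := nrmD (p.1 - a) (q.1 + a); rewrite addrACA addNr addr0 => h'.
  have := le_trans h h'; lra.
have supS : has_sup S.
  split; first by exists (0 - nrm (0 - a)), (0, 0).
  exists (nrm (0 + a) - 0) => _ [p Xp <-]; exact: (bnd _ _ Xp X0).
pose c := sup S.
have c1 p : X p -> p.2 - nrm (p.1 - a) <= c.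
  by move=> Xp; apply: (ub_le_sup (proj2 supS)); exists p.
have c2 q : X q -> c <= nrm (q.1 + a) - q.2.
  move=> Xq; apply: (ge_sup (proj1 supS)) => _ [p Xp <-]; exact: bnd.
pose Y : set (V * R) := [set y | exists p (t : R), X p /\
  y = (p.1 + t%:C *: a, p.2 + t * c)].
exists Y; split.
- split.
  + by exists (0, 0), 0; split => //=; rewrite scale0r mul0r !addr0.
  + move=> _ _ [p [t [Xp ->]]] [q [s [Xq ->]]] /=.
    exists (p.1 + q.1, p.2 + q.2), (t + s); split; first exact: XD.
    by rewrite /= rcD scalerDl mulrDl; congr (_, _); exact: addrACA.
  + move=> k _ [p [t [Xp ->]]] /=.
    exists (k%:C *: p.1, k * p.2), (k * t); split; first exact: XZ.
    by rewrite /= rcM scalerDr scalerA mulrDr mulrA.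
  + move=> _ [p [t [Xp ->]]] /=.
    have [t0|t0|->] := ltgtP t 0; last first.
    * by rewrite scale0r mul0r !addr0; exact: Xn.
    * have := c2 _ (XZ t^-1 _ Xp) => /=.
      rewrite -(ler_pM2l t0) mulrBr mulrA divff ?gt_eqF// mul1r.
      have -> : t * nrm (t^-1%:C *: p.1 + a) = nrm (p.1 + t%:C *: a).
        rewrite -[X in X * _](gtr0_norm t0) -cabs_real -nrmZ scalerDr scalerA.
        by rewrite -rcM divff ?gt_eqF// scale1r.
      lra.
    * have nt0 : 0 < - t by rewrite oppr_gt0.
      have := c1 _ (XZ (- t)^-1 _ Xp) => /=.
      rewrite -(ler_pM2l nt0) mulrBr mulrA divff ?gt_eqF// mul1r.
      have -> : - t * nrm ((- t)^-1%:C *: p.1 - a) = nrm (p.1 + t%:C *: a).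
        rewrite -[X in X * _](gtr0_norm nt0) -cabs_real -nrmZ scalerDr scalerA.
        by rewrite -rcM divff ?gt_eqF// scale1r rcN scaleNr scalerN opprK.
      lra.
- by move=> p Xp; exists p, 0; split => //; rewrite scale0r mul0r !addr0; case: p Xp.
- by exists c, (0, 0), 1; split => //=; rewrite scale1r mul1r !add0r.
Qed.

Lemma real_hahn_banach X : good X -> exists f : V -> R,
  [/\ forall a b, f (a + b) = f a + f b,
      forall (k : R) a, f (k%:C *: a) = k * f a,
      forall a, f a <= nrm a & forall p, X p -> f p.1 = p.2].
Proof.
move=> gX; pose P Y := good (X `|` Y).
have [F FP totF|Y [PY maxY]] := @Zorn_bigcup _ P.
  have [X0 XD XZ Xn] := gX.
  split; first by left.
  - move=> p q [Xp|[Z FZ Zp]].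
      move=> [Xq|[W FW Wq]]; first by left; exact: XD.
      have [_ h _ _] := FP _ FW; case: (h p q); [by left|by right|by left|].
      by right; exists W.
    move=> [Xq|[W FW Wq]].
      have [_ h _ _] := FP _ FZ; case: (h p q); [by right|by left|by left|].
      by right; exists Z.
    have [ZW|WZ] := totF _ _ FZ FW.
      have [_ h _ _] := FP _ FW; case: (h p q); [right; exact: ZW|by right|by left|].
      by right; exists W.
    have [_ h _ _] := FP _ FZ; case: (h p q); [by right|right; exact: WZ|by left|].
    by right; exists Z.
  - move=> k p [Xp|[Z FZ Zp]]; first by left; exact: XZ.
    have [_ _ h _] := FP _ FZ; case: (h k p); [by right|by left|].
    by right; exists Z.
  - move=> p [Xp|[Z FZ Zp]]; first exact: Xn.
    by have [_ _ _ h] := FP _ FZ; apply: h; right.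
have dom a : exists r, (X `|` Y) (a, r).
  have [Z [gZ XYZ [r Zr]]] := good_extend a PY; exists r.
  apply: contrapT => nXY; apply: (maxY Z).
    split; first by move=> p Yp; apply: XYZ; right.
    by move=> ZY; apply: nXY; right; exact: ZY.
  rewrite /P (_ : X `|` Z = Z)//; apply/seteqP; split=> p; last by right.
  by move=> [Xp|//]; apply: XYZ; left.
pose f a := projT1 (cid (dom a)).
have fP a : (X `|` Y) (a, f a) by exact: projT2 (cid (dom a)).
have [Y0 YD YZ Yn] := PY.
exists f; split.
- by move=> a b; apply: (good_fun PY (fP _)); exact: YD (fP a) (fP b).
- by move=> k a; apply: (good_fun PY (fP _)); exact: YZ k _ (fP a).
- by move=> a; exact: Yn (fP a).
- by move=> [a r] Xp /=; apply: (good_fun PY (fP _)); left.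
Qed.

(** The functional to be extended is given by its graph [X], so that no linear
    map has to be constructed on a subspace beforehand.  The complex functional is
    [u a - 'i * u ('i *: a)] for a real extension [u] of the real part. *)
Lemma hahn_banach (X : set (V * R[i])) :
  X (0, 0) ->
  (forall p q, X p -> X q -> X (p.1 + q.1, p.2 + q.2)) ->
  (forall (k : R[i]) p, X p -> X (k *: p.1, k * p.2)) ->
  (forall p, X p -> cabs p.2 <= nrm p.1) ->
  exists f : {scalar V}, (forall p, X p -> f p.1 = p.2) /\
    forall a, cabs (f a) <= nrm a.
Proof.
move=> X0 XD XZ Xn.
pose X' : set (V * R) := [set (p.1, complex.Re p.2) | p in X].
have [|u [uD uZ un uX]] := @real_hahn_banach X'.
  split.
  - by exists (0, 0).
  - move=> _ _ [p Xp <-] [q Xq <-] /=; exists (p.1 + q.1, p.2 + q.2); first exact: XD.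
    by rewrite ReD.
  - move=> k _ [p Xp <-] /=; exists (k%:C *: p.1, k%:C * p.2); first exact: XZ.
    by rewrite ReZ.
  - move=> _ [p Xp <-] /=; exact: le_trans (Re_le_cabs _) (Xn _ Xp).
have uN a : u (- a) = - u a by rewrite -scaleN1r -(rmorphN1 (real_complex R)) uZ mulN1r.
pose f (a : V) : R[i] := (u a) +i* (- u ('i *: a)).
have fD a b : f (a + b) = f a + f b.
  rewrite /f scalerDr !uD opprD; reflexivity.
have fZr (k : R) a : f (k%:C *: a) = k%:C * f a.
  rewrite /f scalerA [_ * k%:C]mulrC -scalerA !uZ.
  by apply/eqP; rewrite eq_complex /= !mul0r subr0 addr0 mulrN !eqxx.
have fZi a : f ('i *: a) = 'i * f a.
  rewrite /f scalerA -expr2 sqr_i scaleN1r uN opprK.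
  by apply/eqP; rewrite eq_complex /= !mul0r !mul1r sub0r opprK add0r !eqxx.
have fZ (k : R[i]) a : f (k *: a) = k * f a.
  rewrite {1}(complexE k) scalerDl fD fZr -scalerA fZi fZr mulrA -mulrDl.
  by rewrite -complexE.
have fl : linear_for *%R f by move=> k a b; rewrite fD fZ.
pose F : {scalar V} := HB.pack f (GRing.isLinear.Build _ _ _ _ f fl).
exists F; split.
- move=> [a z] Xp /=; rewrite /f (uX (a, complex.Re z)); last by exists (a, z).
  rewrite (uX ('i *: a, complex.Re ('i * z))); last by exists ('i *: a, 'i * z) => //; exact: (XZ _ (a, z)).
  by case: z {Xp} => x y /=; rewrite mul0r mul1r sub0r opprK.
- move=> a /=.
  have [->|fa0] := eqVneq (f a) 0; first by rewrite /cabs normr0 nrm_ge0.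
  pose k := (f a)^*%R / `|f a|.
  have kf : k * f a = `|f a|.
    by rewrite mulrAC -normCKC expr2 mulfK// normr_eq0.
  have ck : cabs k = 1.
    have cf0 : `|f a| != 0 by rewrite normr_eq0.
    by rewrite /cabs normrM normfV normr_id norm_conjC divff.
  have := un (k *: a); rewrite nrmZ ck mul1r; apply: le_trans.
  by rewrite /cabs -kf -fZ.
Qed.

End HahnBanach.

(** * The image of the convolution algebra *)

Section Iota.
Context {R : realType} {G : topGroupoidType}.
Local Notation C := R[i].
Hypothesis hample : ample G.
Hypothesis hcompact : compact (unit_space G).
Hypothesis horbit :
  forall x : G, unit_space G x -> `I_3 #<= groupoid_orbit x.
Context (A : cstarAlgType R) (iota : (G -> C) -> A).
Hypothesis hA : groupoid_cstar iota.
Implicit Types (U V W K Z O : set G) (x y : G).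
Implicit Types f g h : G -> C.
Implicit Types a b : A.
Local Notation Cc := (@Cc R G).
Local Notation G0 := (unit_space G).
Local Notation haus := (ample_hausdorff hample).
Local Infix "**" := cmul (at level 40, left associativity).
Local Notation e U := (iota \1_U).

Let iotaD f g : Cc f -> Cc g -> iota (fun c => f c + g c) = iota f + iota g.
Proof. exact: (groupoid_cstarD hA). Qed.
Let iotaZ k f : Cc f -> iota (fun c => k * f c) = k *: iota f.
Proof. exact: (groupoid_cstarZ hA). Qed.
Let iotaM f g : Cc f -> Cc g -> iota (convolution f g) = iota f ** iota g.
Proof. exact: (groupoid_cstarM hA). Qed.
Let iota_star f : Cc f -> iota (fstar f) = star (iota f).
Proof. exact: (groupoid_cstar_star hA). Qed.

Lemma iota0 : iota (fun=> 0) = 0.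
Proof.
rewrite -[RHS](scale0r (iota (fun=> 0))) -iotaZ; last exact: Cc0.
by congr iota; apply/funext => c; rewrite mulr0.
Qed.

Lemma iotaB f g : Cc f -> Cc g -> iota (fun c => f c - g c) = iota f - iota g.
Proof.
move=> Cf Cg; rewrite -scaleN1r -iotaZ// -iotaD//; last exact: CcZ.
by congr iota; apply/funext => c; rewrite mulN1r.
Qed.

Lemma Cc_sub f g : Cc f -> Cc g -> Cc (fun c => f c - g c).
Proof.
move=> Cf Cg; have := CcD hample hcompact Cf (CcZ hample hcompact (-1) Cg).
by congr (Cc _); apply/funext => c; rewrite mulN1r.
Qed.

Lemma iota_dense a (eps : R) : 0 < eps ->
  exists2 f, Cc f & nrm (a - iota f) < eps.
Proof.
move=> e0; have : closure (iota @` Cc) a by rewrite (groupoid_cstar_dense hA).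
by move=> /closureP/(_ _ e0)[_ [f Cf <-] h]; exists f.
Qed.

Lemma Cc_unit : Cc \1_G0.
Proof. by apply: Cc_indic => //; exact: unit_co. Qed.

(** The indicator function of the unit space is a unit for a dense subset. *)
Lemma iota_unit : iota \1_G0 = cone.
Proof.
set u := iota _.
suff H a : a ** u = a by rewrite -[LHS]cmul1r H.
apply/eqP; rewrite -subr_eq0; apply/eqP/nrm0_eq0/eqP.
rewrite eq_le nrm_ge0 andbT; apply/ler_addgt0Pr => eps e0; rewrite add0r.
have k0 : 0 < nrm u + 1 by rewrite ltr_wpDl// nrm_ge0.
have [f Cf fa] := iota_dense a (divr_gt0 e0 k0).
have fu : iota f ** u = iota f by rewrite -iotaM ?convolf1//; exact: Cc_unit.
have -> : a ** u - a = (a - iota f) ** u - (a - iota f).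
  by rewrite cmulBl fu opprB addrA subrK.
apply: (le_trans (nrmB _ _)); apply: (le_trans (lerD (nrmM _ _) (lexx _))).
rewrite -{2}[nrm (a - iota f)]mulr1 -mulrDr.
by move: fa; rewrite ltr_pdivlMr// => /ltW.
Qed.

Lemma e_mul U V : co_bisection U -> co_bisection V -> e U ** e V = e (bmul U V).
Proof.
move=> [bU cU] [bV cV]; rewrite -iotaM; [|exact: Cc_indic|exact: Cc_indic].
by congr iota; exact: convol_indic.
Qed.

Lemma e_star U : compact_and_open U -> star (e U) = e (binv U).
Proof. by move=> cU; rewrite -iota_star ?fstar_indic//; exact: Cc_indic. Qed.

Lemma e_disj Z K : compact_and_open Z -> compact_and_open K -> Z `&` K = set0 ->
  e (Z `|` K) = e Z + e K.
Proof.
move=> cZ cK ZK; rewrite -iotaD; [|exact: Cc_indic|exact: Cc_indic].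
congr iota; apply/funext => c.
have [Zc|nZ] := pselect (Z c).
  have nK : ~ K c by move=> Kc; have : (Z `&` K) c by []; rewrite ZK.
  by rewrite (indic_in Zc) (indic_out nK) indic_in ?addr0//; left.
have [Kc|nK] := pselect (K c).
  by rewrite (indic_out nZ) (indic_in Kc) add0r indic_in//; right.
by rewrite !indic_out ?addr0// => -[].
Qed.

Lemma e_set0 : e set0 = 0.
Proof. by rewrite -iota0; congr iota; apply/funext => c; rewrite indic_out. Qed.

Lemma bmul_invl U : co_bisection U -> bmul (binv U) U = src @` U.
Proof.
move=> [[ir is_] _]; apply/seteqP; split.
  move=> _ [a [b [Ua Ub ab ->]]].
  have -> : a = ginv b.
    by apply: ginv_inj; rewrite ginvK; apply: ir; rewrite ?inE// rng_ginv.
  by rewrite gmulVg; exists b.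
move=> _ [a Ua <-]; exists (ginv a), a; split => //.
- by rewrite /binv/= ginvK.
- by rewrite src_ginv.
- by rewrite gmulVg.
Qed.

Lemma bmul_invr U : co_bisection U -> bmul U (binv U) = rng @` U.
Proof.
move=> cU; have := bmul_invl (binv_cob cU); rewrite binvK => ->.
apply/seteqP; split=> [_ [x Ux <-]|_ [x Ux <-]].
  by exists (ginv x); rewrite ?rng_ginv.
by exists (ginv x); rewrite ?src_ginv// /binv/= ginvK.
Qed.

Lemma full_cob U : full_group G U -> co_bisection U.
Proof. by case/full_groupP. Qed.

Lemma e_full_starl U : full_group G U -> star (e U) ** e U = cone.
Proof.
move=> fU; have cU := full_cob fU; rewrite e_star; last by case: cU.
rewrite e_mul//; last exact: binv_cob.
by rewrite bmul_invl//; case: fU => _ _ _ _ ->; exact: iota_unit.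
Qed.

Lemma e_full_starr U : full_group G U -> e U ** star (e U) = cone.
Proof.
move=> fU; have cU := full_cob fU; rewrite e_star; last by case: cU.
rewrite e_mul//; last exact: binv_cob.
by rewrite bmul_invr//; case: fU => _ _ _ -> _; exact: iota_unit.
Qed.

Lemma nrm_isom a : star a ** a = cone -> nrm a <= 1.
Proof.
move=> aa; rewrite -(@ler_pXn2r _ 2) ?nnegrE ?nrm_ge0 ?ler01//.
by rewrite -nrm_cstar aa expr1n nrm1_le1.
Qed.

Lemma nrm_full U : full_group G U -> nrm (e U) <= 1.
Proof. by move=> /e_full_starl/nrm_isom. Qed.

Lemma supp_convU f g : supported f G0 -> supported g G0 -> supported (convolution f g) G0.
Proof. by move=> sf sg c nc; rewrite convol_unit// sf// mul0r. Qed.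

(** With [h] a square root of [1 - f * f], the element [iota f + 'i *: iota h] is
    unitary, and [iota f] is its real part. *)
Let nrm_real f : Cc f -> supported f G0 -> fstar f = f ->
  (forall c, f c * f c <= 1) -> nrm (iota f) <= 1.
Proof.
move=> Cf sf ff f1.
have Cff : Cc (convolution f f) by exact: Cc_conv.
have eff := convol_unit sf sf.
(* The function [1 - f * f], whose square root completes [f] to a unitary. *)
pose k c := \1_G0 c - convolution f f c.
have Ck : Cc k by apply: Cc_sub => //; exact: Cc_unit.
have sk : supported k G0.
  by move=> c nc; rewrite /k indic_out// eff sf// mul0r subr0.
have k0 c : 0 <= k c.
  have [uc|nc] := pselect (G0 c); last by rewrite sk.
  by rewrite /k indic_in// eff subr_ge0.
have [h [Ch sh hh hk]] := unit_sqrt hample hcompact Ck sk k0.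
pose x := iota f + 'i *: iota h.
have sx : star x = iota f - 'i *: iota h.
  rewrite /x starD starZ -iota_star// -iota_star// ff hh.
  have -> : (('i : C)^*)%R = - 'i.
    by apply/eqP; rewrite eq_complex /= oppr0 !eqxx.
  by rewrite scaleNr.
have cm : iota f ** iota h = iota h ** iota f.
  rewrite -!iotaM//; congr iota; rewrite !convol_unit//; apply/funext => c.
  exact: mulrC.
have xx : star x ** x = cone.
  rewrite sx /x cmulBl !cmulDr !cmulZl !cmulZr cm scalerA -expr2 sqr_i scaleN1r.
  rewrite opprD opprK -addrA (addrA ('i *: _)) subrr add0r -!iotaM// -iotaD//; last exact: Cc_conv.
  rewrite hk -iota_unit; congr iota; apply/funext => c.
  by rewrite /k addrC subrK.
have nx := nrm_isom xx.
have -> : iota f = (2^-1)%:C *: (x + star x).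
  rewrite sx /x addrACA subrr addr0 scalerDr -scalerDl -rcD.
  by rewrite (_ : 2^-1 + 2^-1 = 1 :> R) ?scale1r//; lra.
rewrite nrmZ cabs_real ger0_norm ?invr_ge0//.
have := nrmD x (star x); rewrite nrm_star; lra.
Qed.

(** By the C*-identity it suffices to treat the square of the absolute value
    of [f], to which the real case applies after rescaling. *)
Lemma nrm_unit_le f (M : R) : Cc f -> supported f G0 -> 0 <= M ->
  (forall c, cabs (f c) <= M) -> nrm (iota f) <= M.
Proof.
move=> Cf sf M0 fM.
have [e0|M0'] := eqVneq M 0.
  have -> : f = (fun=> 0).
    apply/funext => c; apply: cabs0_eq0; apply/eqP; rewrite eq_le cabs_ge0 andbT.
    by rewrite -e0.
  by rewrite iota0 nrm0.
have Mp : 0 < M by rewrite lt_def M0' M0.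
have Cff : Cc (convolution (fstar f) f) by apply: Cc_conv => //; exact: Cc_star.
have ssf : supported (fstar f) G0.
  by move=> c nc; rewrite fstar_unit// sf// conjC0.
have Eff c : convolution (fstar f) f c = ((cabs (f c)) ^+ 2)%:C.
  by rewrite convol_unit// fstar_unit// cabs_sqr.
pose g c := ((M ^+ 2)^-1)%:C * convolution (fstar f) f c.
have Eg c : g c = ((M ^+ 2)^-1 * (cabs (f c)) ^+ 2)%:C by rewrite /g Eff -rcM.
have M20 : M ^+ 2 != 0 by rewrite expf_neq0.
have Cg : Cc g by exact: CcZ.
have sg : supported g G0 by move=> c nc; rewrite /g supp_convU// mulr0.
have : nrm (iota g) <= 1.
  apply: nrm_real => // [|c].
    by rewrite fstar_unit//; apply/funext => c; rewrite Eg; exact: conjc_real.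
  rewrite Eg -rcM lecR.
  have h : 0 <= (M ^+ 2)^-1 * (cabs (f c)) ^+ 2 <= 1.
    apply/andP; split; first by rewrite mulr_ge0// ?invr_ge0 exprn_ge0// cabs_ge0.
    rewrite mulrC ler_pdivrMr ?exprn_gt0// mul1r ler_pXn2r// nnegrE//.
    exact: cabs_ge0.
  by case/andP: h => h0 h1; apply: mulr_ile1.
rewrite iotaZ// nrmZ cabs_real ger0_norm ?invr_ge0 ?exprn_ge0//.
rewrite iotaM//; last exact: Cc_star.
rewrite iota_star// nrm_cstar mulrC ler_pdivrMr ?exprn_gt0// mul1r.
by rewrite ler_pXn2r// nnegrE// nrm_ge0.
Qed.

(** The products [e U ** e Z], with [U] in the full group and [Z] a clopen set of
    units, span a dense subspace: a function on [U] is the product of [\1_U] with a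
    function on the unit space, and the latter is a uniform limit of step functions. *)
Lemma span_dense (S : set A) : S 0 -> (forall a b, S a -> S b -> S (a + b)) ->
  (forall k a, S a -> S (k *: a)) -> closed S ->
  (forall U Z, full_group G U -> compact_and_open Z -> Z `<=` G0 -> S (e U ** e Z)) ->
  forall a, S a.
Proof.
move=> S0 SD SZ cS SU a; apply: closed_nrm => // eps e0.
have [f Cf fa] := iota_dense a e0; exists (iota f) => // {a fa eps e0}.
move: f Cf; apply: (Cc_ind hample hcompact horbit) => [U f fU Cf sf|f g Cf Cg Sf Sg];
  last by rewrite iotaD//; exact: SD.
have cU := full_cob fU; have [bU coU] := cU.
have C1U : Cc \1_U by exact: Cc_indic.
have C1Us := Cc_star hample hcompact C1U.
pose phi := convolution (fstar \1_U) f.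
have Cphi : Cc phi by exact: Cc_conv.
have sphi : supported phi G0.
  move=> c nc; rewrite /phi fstar_indic.
  apply: convol_none => a b ab abc.
  have [Ua|nU] := pselect (binv U a); last by rewrite indic_out// mul0r.
  rewrite sf ?mulr0// => Ub; apply: nc; rewrite -abc.
  have -> : a = ginv b.
    apply: ginv_inj; rewrite ginvK; case: bU => ir _.
    by apply: ir; rewrite ?inE// rng_ginv.
  by rewrite gmulVg; exact: unit_srcP.
have fE : iota f = e U ** iota phi.
  by rewrite /phi iotaM// iota_star// cmulA e_full_starr// cmul1r.
rewrite fE; apply: closed_nrm => // eps e0.
pose Q Z := exists psi, [/\ Cc psi, supported psi Z, S (e U ** iota psi) &
  forall c, Z c -> cabs (phi c - psi c) <= eps / 2].
have : Q G0.
  apply: (compact_open_ind haus (unit_co hample hcompact)).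
  - exists (fun=> 0); split => //; first exact: Cc0.
    by rewrite iota0 cmul0r.
  - move=> Z L cZ cL ZL [p1 [C1 s1 S1 h1]] [p2 [C2 s2 S2 h2]].
    exists (fun c => p1 c + p2 c); split.
    + exact: CcD.
    + by move=> c /not_orP[nZ nL]; rewrite s1// s2// addr0.
    + by rewrite iotaD// cmulDr; exact: SD.
    + move=> c [Zc|Lc].
        rewrite [p2 c]s2 ?addr0; first exact: h1.
        by move=> Lc; have : (Z `&` L) c by []; rewrite ZL.
      rewrite [p1 c]s1 ?add0r; first exact: h2.
      by move=> Zc; have : (Z `&` L) c by []; rewrite ZL.
  - move=> x ux.
    have e2 : 0 < (eps / 2)%:C by rewrite ltcR divr_gt0.
    have /cont_atP/(_ _ e2) := Cc_cont Cphi (x:=x).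
    rewrite /prop_near1 nbhsE => -[N [oN Nx] NP].
    have oN' : open (N `&` G0) by apply: openI => //; exact: unit_open.
    have [V [[bV cV] Vx VN]] := co_bisection_basis hample hcompact oN' (conj Nx ux).
    exists V; split => // Z cZ ZV.
    have ZG : Z `<=` G0 by move=> c /ZV/VN[].
    exists (fun c => phi x * \1_Z c); split.
    + by apply: CcZ => //; exact: Cc_indic.
    + by move=> c nc; rewrite indic_out// mulr0.
    + by rewrite iotaZ ?cmulZr; [apply: SZ; exact: SU|exact: Cc_indic].
    + move=> c Zc; rewrite indic_in// mulr1 -cabsN opprB -lecR -cabsE ltW//.
      by apply: NP; have [] := VN c (ZV c Zc).
move=> [psi [Cpsi spsi Spsi hpsi]]; exists (e U ** iota psi) => //.
rewrite -cmulBr -iotaB//; apply: (le_lt_trans (nrmM _ _)).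
apply: (@le_lt_trans _ _ (1 * (eps / 2))); last by rewrite mul1r ltr_pdivrMr// ltr_pMr// ltr1n.
apply: ler_pM; rewrite ?nrm_ge0// ?nrm_full//.
apply: nrm_unit_le => [|||c].
- exact: Cc_sub.
- by move=> c nc; rewrite sphi// spsi// subr0.
- by rewrite divr_ge0// ltW.
- have [uc|nc] := pselect (G0 c); first exact: hpsi.
  by rewrite sphi// spsi// subr0 /cabs normr0 divr_ge0// ltW.
Qed.

End Iota.

(** * Positive functionals and the universal norm *)

Section GNS.
Context {R : realType} {G : topGroupoidType}.
Local Notation C := R[i].
Hypothesis hample : ample G.
Hypothesis hcompact : compact (unit_space G).
Hypothesis horbit :
  forall x : G, unit_space G x -> `I_3 #<= groupoid_orbit x.
Implicit Types f g h : G -> C.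
Local Notation Cc := (@Cc R G).
Local Notation G0 := (unit_space G).
Local Notation haus := (ample_hausdorff hample).
Local Notation CcD := (CcD hample hcompact).
Local Notation CcZ := (CcZ hample hcompact).
Local Notation Cstar := (Cc_star hample hcompact).
Local Notation Cconv := (Cc_conv hample hcompact horbit).

Context (phi : (G -> C) -> C).
Hypothesis phiD : forall f g, Cc f -> Cc g ->
  phi (fun c => f c + g c) = phi f + phi g.
Hypothesis phiZ : forall k f, Cc f -> phi (fun c => k * f c) = k * phi f.
Hypothesis phi_ge0 : forall f, Cc f -> 0 <= phi (convolution (fstar f) f).
Hypothesis phi1 : phi \1_G0 = 1.

(** The inner product of the GNS construction, linear in the second variable. *)
Let P f g := phi (convolution (fstar f) g).
Let N f := complex.Re (P f f).
Let n f := Num.sqrt (N f).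

Let Cunit : Cc \1_G0.
Proof. by apply: Cc_indic => //; exact: unit_co. Qed.

Let PDr f g h : Cc f -> Cc g -> Cc h -> P f (fun c => g c + h c) = P f g + P f h.
Proof.
move=> Cf Cg Ch; have Cs := Cstar Cf; rewrite /P convolDr// phiD//; exact: Cconv.
Qed.

Let PZr k f g : Cc f -> Cc g -> P f (fun c => k * g c) = k * P f g.
Proof.
by move=> Cf Cg; have Cs := Cstar Cf; rewrite /P convolZr phiZ//; exact: Cconv.
Qed.

Let PDl f g h : Cc f -> Cc g -> Cc h -> P (fun c => f c + g c) h = P f h + P g h.
Proof.
move=> Cf Cg Ch; have Cs := Cstar Cf; have Cs' := Cstar Cg.
by rewrite /P fstarD convolDl// phiD//; exact: Cconv.
Qed.

Let PZl k f g : Cc f -> Cc g -> P (fun c => k * f c) g = (k^*)%R * P f g.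
Proof.
by move=> Cf Cg; have Cs := Cstar Cf; rewrite /P fstarZ convolZl phiZ//; exact: Cconv.
Qed.

Let PN f : Cc f -> P f f = (N f)%:C.
Proof. by move=> Cf; exact: ge0_ReE (phi_ge0 Cf). Qed.

Let N0 f : Cc f -> 0 <= N f.
Proof. by move=> Cf; exact: ge0_Re (phi_ge0 Cf). Qed.

Let Pexp k f g : Cc f -> Cc g ->
  P (fun c => f c + k * g c) (fun c => f c + k * g c) =
  P f f + k * P f g + (k^*)%R * P g f + ((k^*)%R * k) * P g g.
Proof.
move=> Cf Cg; have Ck := CcZ k Cg; have Ca := CcD Cf Ck.
by rewrite PDr// !PDl// !PZr// !PZl//; ring.
Qed.

Let Psym f g : Cc f -> Cc g -> P g f = ((P f g)^*)%R.
Proof.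
move=> Cf Cg.
have H k : complex.Im (k * P f g + (k^*)%R * P g f) = 0.
  have Ck := CcD Cf (CcZ k Cg).
  have := Pexp k Cf Cg; rewrite PN// (PN Cf) (PN Cg).
  have -> : ((k^*)%R * k : C) = ((cabs k) ^+ 2)%:C by rewrite cabs_sqr.
  rewrite -rcM => e; have := congr1 (@complex.Im R) e => /=.
  rewrite -addrA [X in _ = X]/=.
  by case: (k * P f g) => a b; case: (_ * P g f) => c d /=; rewrite add0r addr0 => <-.
have := H 1; have := H 'i.
have -> : (('i : C)^*)%R = - 'i by apply/eqP; rewrite eq_complex /= oppr0 !eqxx.
rewrite conjC1 !mul1r.
case: (P f g) => a b; case: (P g f) => c d /=.
rewrite !mul0r !mul1r !add0r !oppr0 !mulN1r !mul0r !add0r => ac bd.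
by apply/eqP; rewrite eq_complex /=; apply/andP; split; apply/eqP; lra.
Qed.

Let Nexp k f g : Cc f -> Cc g -> N (fun c => f c + k * g c) =
  N f + 2 * complex.Re (k * P f g) + (cabs k) ^+ 2 * N g.
Proof.
move=> Cf Cg; rewrite {1}/N Pexp// (Psym Cf Cg) -cabs_sqr PN// (PN Cg) -rcM.
rewrite -rmorphM !ReD /=; congr (_ + _); rewrite -addrA; congr (_ + _).
by rewrite cRe_conj; lra.
Qed.

(** The Cauchy-Schwarz inequality: with [s = P f g], positivity at [f - t * s^* * g]
    for all real [t]. *)
Let CS f g : Cc f -> Cc g -> cabs (P f g) ^+ 2 <= N f * N g.
Proof.
move=> Cf Cg; set s := P f g; have Nf := N0 Cf; have Ng := N0 Cg.
have H (t : R) : 0 <= N f - 2 * t * cabs s ^+ 2 + t ^+ 2 * cabs s ^+ 2 * N g.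
  have := N0 (CcD Cf (CcZ ((- t)%:C * (s^*)%R) Cg)).
  have ks : (- t)%:C * (s^*)%R * s = (- t * cabs s ^+ 2)%:C.
    by rewrite rcM cabs_sqr mulrA.
  rewrite Nexp// -/s ks cabsM cabs_conj cabs_real exprMn real_normK ?num_real// sqrrN /=.
  by rewrite mulNr mulrN -mulrA.
(* The quadratic polynomial in [t] is minimal at the inverse of [N g]; if [N g = 0],
   it is affine and forces [s = 0]. *)
have [Ng0|Ngn] := eqVneq (N g) 0.
  have [s0|sn] := eqVneq (cabs s) 0; first by rewrite s0 expr0n /= mulr_ge0.
  have sp : 0 < cabs s ^+ 2 by rewrite exprn_gt0// lt_def sn cabs_ge0.
  have := H ((N f + 1) / cabs s ^+ 2); rewrite Ng0 mulr0 addr0 -!mulrA mulVf ?gt_eqF//.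
  move=> h; exfalso; move: h; rewrite mulr1; lra.
have Np : 0 < N g by rewrite lt_def Ngn.
have := H ((N g)^-1) => h.
rewrite -ler_pdivrMr//; move: h.
have -> : (N g)^-1 ^+ 2 * cabs s ^+ 2 * N g = cabs s ^+ 2 / N g.
  by field.
by rewrite [2 * _]mulrC -mulrA [2 * _]mulrC mulrA [_^-1 * _]mulrC; lra.
Qed.

Let n0 f : 0 <= n f. Proof. exact: sqrtr_ge0. Qed.

Let nN f : Cc f -> n f ^+ 2 = N f.
Proof. by move=> Cf; rewrite sqr_sqrtr// N0. Qed.

Let CSn f g : Cc f -> Cc g -> cabs (P f g) <= n f * n g.
Proof.
move=> Cf Cg; rewrite -(@ler_pXn2r _ 2) ?nnegrE ?mulr_ge0 ?cabs_ge0//.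
by rewrite exprMn !nN// CS.
Qed.

Let nD f g : Cc f -> Cc g -> n (fun c => f c + g c) <= n f + n g.
Proof.
move=> Cf Cg; rewrite -(@ler_pXn2r _ 2) ?nnegrE ?addr_ge0//.
have Cfg := CcD Cf Cg; rewrite nN// sqrrD !nN//.
have -> : (fun c => f c + g c) = (fun c => f c + 1 * g c).
  by apply/funext => c; rewrite mul1r.
rewrite Nexp// mul1r /cabs normr1 /= expr1n mul1r.
have := le_trans (Re_le_cabs _) (CSn Cf Cg); rewrite mulr2n; lra.
Qed.

Let nZ k f : Cc f -> n (fun c => k * f c) = cabs k * n f.
Proof.
move=> Cf; have Ck := CcZ k Cf.
rewrite /n /N PZr// PZl// mulrA -normCK cabsE -rcX PN// -rcM /=.
by rewrite sqrtrM ?exprn_ge0 ?cabs_ge0// sqrtr_sqr ger0_norm ?cabs_ge0.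
Qed.

Let n_zero : n (fun=> 0) = 0.
Proof.
have := @nZ 0 \1_G0 Cunit; rewrite /cabs normr0 /= mul0r => <-.
by congr n; apply/funext => c; rewrite mul0r.
Qed.

Let adj a f g : Cc a -> Cc f -> Cc g ->
  P (convolution a f) g = P f (convolution (fstar a) g).
Proof.
move=> Ca Cf Cg; rewrite /P (fstarM hample hcompact horbit Ca Cf).
by rewrite (convolA hample hcompact horbit)//; exact: Cstar.
Qed.

(** Left multiplication by [a] is bounded: if [a] lives on a bisection, then
    [fstar a] times [a] is a function on the unit space, and [M ^+ 2] minus this
    function has a square root [h], so that [M ^+ 2 * N f - N (a f) = N (h f)]. *)
Let bounded a : Cc a -> exists2 M : R, 0 <= M &
  forall f, Cc f -> n (convolution a f) <= M * n f.
Proof.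
move: a; apply: (Cc_ind hample hcompact horbit) => [U a fU Ca sa|a b Ca Cb [M M0 HM] [K K0 HK]].
  have [M M0 aM] := Cc_bounded hample hcompact Ca.
  have Cs := Cstar Ca; have bU : bisection U by case: fU.
  pose k c := M ^+ 2 * \1_G0 c - convolution (fstar a) a c.
  have Ck : Cc k.
    have := CcD (CcZ (M ^+ 2) Cunit) (CcZ (-1) (Cconv Cs Ca)).
    by congr (Cc _); apply/funext => c; rewrite mulN1r.
  have sk : supported k G0.
    move=> c nc; rewrite /k indic_out// mulr0 sub0r convol_none ?oppr0// => p q pq pqc.
    have [Up|nU] := pselect (binv U p); last by rewrite (supp_star sa nU) mul0r.
    rewrite [a q]sa ?mulr0// => Uq; apply: nc; rewrite -pqc.
    have -> : p = ginv q.
      apply: ginv_inj; rewrite ginvK; case: bU => ir _.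
      by apply: ir; rewrite ?inE// rng_ginv.
    by rewrite gmulVg; exact: unit_srcP.
  have k0 c : 0 <= k c.
    have [uc|nc] := pselect (G0 c); last by rewrite sk.
    have [b Ub bc] := full_src c fU; rewrite (unit_src uc) in bc.
    rewrite /k indic_in// mulr1 subr_ge0.
    have -> : convolution (fstar a) a c = `|a b| ^+ 2.
      rewrite (convol2 _ bU sa Ub) ?(unit_src uc)// /fstar.
      by rewrite -bc -{1}(rng_ginv b) gmul_rng ginvK normCKC.
    by rewrite ler_pXn2r// nnegrE.
  have [h [Ch sh hh hk]] := unit_sqrt hample hcompact Ck sk k0.
  have MN : M \is Num.real by exact: ger0_real.
  have ME := ge0_ReE M0.
  exists (complex.Re M); first exact: ge0_Re.
  move=> f Cf; have Caf := Cconv Ca Cf; have Chf := Cconv Ch Cf.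
  rewrite -(@ler_pXn2r _ 2) ?nnegrE ?mulr_ge0 ?(ge0_Re M0)//.
  rewrite exprMn !nN// -subr_ge0.
  suff -> : complex.Re M ^+ 2 * N f - N (convolution a f) = N (convolution h f).
    exact: N0.
  apply: complexI; rewrite rmorphB /= rcM rcX -ME -!PN//.
  rewrite !adj// hh !(convolA hample hcompact horbit)// hk.
  have -> : convolution k f = (fun c => M ^+ 2 * f c + (-1) * convolution (convolution (fstar a) a) f c).
    have Cas := Cconv Cs Ca.
    have -> : k = (fun c => M ^+ 2 * \1_G0 c + (-1) * convolution (fstar a) a c).
      by apply/funext => c; rewrite mulN1r.
    rewrite convolDl//; [|exact: CcZ|exact: CcZ].
    by rewrite !convolZl convol1f.
  have Cas := Cconv Cs Ca; have Casf := Cconv Cas Cf.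
  by rewrite PDr// ?PZr// ?mulN1r//; exact: CcZ.
exists (M + K); first exact: addr_ge0.
move=> f Cf; rewrite convolDl//; apply: le_trans (nD _ _) _; try exact: Cconv.
by rewrite mulrDl; apply: lerD; [exact: HM|exact: HK].
Qed.

(** The operator norm of [a] in the GNS representation. *)
Definition gns_norm (a : G -> C) : R :=
  sup [set n (convolution a f) | f in [set f | Cc f /\ n f <= 1]].

Local Notation p := gns_norm.

Let nconv0 a : Cc a -> n (convolution a (fun=> 0)) = 0.
Proof.
move=> Ca; rewrite (_ : convolution a _ = fun=> 0)//.
by apply/funext => c; apply: convol_none => *; rewrite mulr0.
Qed.

Let p_has a : Cc a ->
  has_sup [set n (convolution a f) | f in [set f | Cc f /\ n f <= 1]].
Proof.
move=> Ca; split.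
  exists (n (convolution a (fun=> 0))), (fun=> 0) => //; split; first exact: Cc0.
  by rewrite n_zero ler01.
have [M M0 HM] := bounded Ca; exists M => _ [f [Cf f1] <-].
by apply: le_trans (HM f Cf) _; rewrite -[leRHS]mulr1 ler_wpM2l.
Qed.

Let p_ge0 a : Cc a -> 0 <= p a.
Proof.
move=> Ca; rewrite -(nconv0 Ca); apply: (ub_le_sup (proj2 (p_has Ca))).
by exists (fun=> 0) => //; split; [exact: Cc0|rewrite n_zero ler01].
Qed.

Let p_ub a f : Cc a -> Cc f -> n (convolution a f) <= p a * n f.
Proof.
move=> Ca Cf; have [nf0|nf0] := eqVneq (n f) 0.
  have [M M0 HM] := bounded Ca; apply: le_trans (HM f Cf) _.
  by rewrite nf0 !mulr0.
have nfp : 0 < n f by rewrite lt_def nf0 n0.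
rewrite -ler_pdivrMr// mulrC.
have -> : (n f)^-1 * n (convolution a f) =
    n (convolution a (fun c => ((n f)^-1)%:C * f c)).
  rewrite convolZr nZ; last exact: Cconv.
  by rewrite cabs_real ger0_norm// invr_ge0.
apply: (ub_le_sup (proj2 (p_has Ca))).
exists (fun c => ((n f)^-1)%:C * f c) => //; split; first exact: CcZ.
by rewrite nZ// cabs_real ger0_norm ?invr_ge0// mulVf.
Qed.

Let p_le a M : Cc a -> (forall f, Cc f -> n f <= 1 -> n (convolution a f) <= M) ->
  p a <= M.
Proof.
move=> Ca H; apply: (ge_sup (proj1 (p_has Ca))) => _ [f [Cf f1] <-].
exact: H.
Qed.

Let p_M a b : Cc a -> Cc b -> p (convolution a b) <= p a * p b.
Proof.
move=> Ca Cb; have Cab := Cconv Ca Cb; apply: p_le => // f Cf f1.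
have Cbf := Cconv Cb Cf.
rewrite -(convolA hample hcompact horbit)//; apply: le_trans (p_ub Ca Cbf) _.
rewrite ler_wpM2l ?p_ge0//; apply: le_trans (p_ub Cb Cf) _.
by rewrite -[leRHS]mulr1 ler_wpM2l ?p_ge0.
Qed.

Let p_sq a : Cc a -> p a ^+ 2 <= p (convolution (fstar a) a).
Proof.
move=> Ca; have Cs := Cstar Ca; have Csa := Cconv Cs Ca.
rewrite -(sqr_sqrtr (p_ge0 Csa)) ler_pXn2r ?nnegrE ?p_ge0//.
apply: p_le => // f Cf f1; have Caf := Cconv Ca Cf.
rewrite ler_wsqrtr// /N adj// (convolA hample hcompact horbit)//.
have Csaf := Cconv Csa Cf.
apply: le_trans (Re_le_cabs _) _; apply: le_trans (CSn Cf Csaf) _.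
rewrite -[leRHS]mul1r; apply: ler_pM => //.
by apply: le_trans (p_ub Csa Cf) _; rewrite -[leRHS]mulr1 ler_wpM2l ?p_ge0.
Qed.

Let p_star a : Cc a -> p a <= p (fstar a).
Proof.
move=> Ca; have Cs := Cstar Ca.
have [p0|p0] := eqVneq (p a) 0; first by rewrite p0 p_ge0.
have pp : 0 < p a by rewrite lt_def p0 p_ge0.
by rewrite -(ler_pM2r pp) -expr2; apply: le_trans (p_sq Ca) (p_M Cs Ca).
Qed.

Lemma gns_cstar_seminorm : cstar_seminorm p.
Proof.
split.
- exact: p_ge0.
- move=> f g Cf Cg; have Cfg := CcD Cf Cg; apply: p_le => // h Ch h1.
  have Cfh := Cconv Cf Ch; have Cgh := Cconv Cg Ch.
  rewrite convolDl//; apply: le_trans (nD Cfh Cgh) _.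
  by apply: lerD; apply: (le_trans (p_ub _ Ch)) => //; rewrite -[leRHS]mulr1 ler_wpM2l ?p_ge0.
- have H k f : Cc f -> p (fun c => k * f c) <= cabs k * p f.
    move=> Cf; have Ck := CcZ k Cf; apply: p_le => // h Ch h1.
    have Cfh := Cconv Cf Ch.
    rewrite convolZl nZ// ler_wpM2l ?cabs_ge0//; apply: (le_trans (p_ub _ Ch)) => //.
    by rewrite -[leRHS]mulr1 ler_wpM2l ?p_ge0.
  move=> k f Cf; rewrite -/(cabs k); apply/eqP; rewrite eq_le H// andTb.
  have Ckf := CcZ k Cf.
  have [->|k0] := eqVneq k 0; first by rewrite /cabs normr0 mul0r p_ge0//; exact: CcZ.
  have cp : 0 < cabs k.
    by rewrite lt_def cabs_ge0 andbT; apply: contra_neq k0; exact: cabs0_eq0.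
  have := H k^-1 _ Ckf.
  have -> : (fun c => k^-1 * (k * f c)) = f.
    by apply/funext => c; rewrite mulrA mulVf// mul1r.
  move=> h; rewrite -(ler_pM2l (_ : 0 < cabs k^-1)).
    by rewrite mulrA -cabsM mulVf// /cabs normr1 mul1r.
  rewrite lt_def cabs_ge0 andbT; apply/eqP => /cabs0_eq0 /eqP.
  by rewrite invr_eq0 (negbTE k0).
- exact: p_M.
- move=> f Cf; have Cs := Cstar Cf; apply/eqP; rewrite eq_le p_sq// andbT.
  apply: le_trans (p_M Cs Cf) _; rewrite expr2 ler_wpM2r ?p_ge0//.
  by have := p_star Cs; rewrite fstarK.
Qed.

Lemma positive_le_gns_norm f : Cc f -> cabs (phi f) <= p f.
Proof.
move=> Cf.
have s1 : fstar \1_G0 = \1_G0 :> (G -> C).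
  rewrite fstar_unit; last exact: supp_unit.
  by apply/funext => c; rewrite indicE conjC_nat.
have N1 : n \1_G0 = 1.
  by rewrite /n /N /P s1 convol1f phi1 sqrtr1.
have -> : phi f = P \1_G0 f by rewrite /P s1 convol1f.
apply: (le_trans (CSn Cunit Cf)); rewrite N1 mul1r.
by have := p_ub Cf Cunit; rewrite N1 mulr1 convolf1.
Qed.

(** The GNS seminorm is one of the seminorms whose supremum is the universal
    norm. *)
Lemma positive_le_universal (A : cstarAlgType R) (iota : (G -> C) -> A)
    (hA : groupoid_cstar iota) f : Cc f -> cabs (phi f) <= nrm (iota f).
Proof.
move=> Cf; apply: (le_trans (positive_le_gns_norm Cf)).
rewrite -lee_fin (groupoid_cstar_norm hA Cf).
by apply: ereal_sup_ubound; exists p => //; exact: gns_cstar_seminorm.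
Qed.

End GNS.

(** * Invariant functionals on the unit space *)

Lemma lim_ge0 (R : realType) (z : R[i]) :
  (forall eps : R, 0 < eps -> exists2 w, 0 <= w & cabs (z - w) <= eps) -> 0 <= z.
Proof.
move=> H; have HI : complex.Im z = 0.
  apply/eqP; rewrite -normr_le0; apply/ler_addgt0Pr => eps e0; rewrite add0r.
  have [w w0 zw] := H _ e0; apply: le_trans zw.
  have := Re_le_cabs ('i * (z - w)); have := Re_le_cabs (- 'i * (z - w)).
  rewrite !cabsM cabsN.
  have -> : cabs ('i : R[i]) = 1.
    by rewrite /cabs normc_def /= expr0n add0r expr1n sqrtr1.
  rewrite !mul1r; move: w0; case: z {H} => a b; case: w => c d.
  rewrite lecE /= => /andP[/eqP -> _] h1 h2.
  by rewrite ler_norml; apply/andP; split; lra.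
have HR : 0 <= complex.Re z.
  apply/ler_addgt0Pr => eps e0.
  have [w w0 zw] := H _ e0; have := ge0_Re w0.
  have := Re_le_cabs (- (z - w)); rewrite cabsN ReN ReD ReN => h1 h2; lra.
by rewrite lecE HI eqxx.
Qed.

Lemma nrm_cmulB (R : realType) (A : cstarAlgType R) (a b a' b' : A) :
  nrm (cmul a b - cmul a' b') <= nrm (a - a') * nrm b + nrm a' * nrm (b - b').
Proof.
have -> : cmul a b - cmul a' b' = cmul (a - a') b + cmul a' (b - b').
  by rewrite cmulBl cmulBr addrA subrK.
by apply: (le_trans (nrmD _ _)); apply: lerD; exact: nrmM.
Qed.

Section Invariant.
Context {R : realType} {G : topGroupoidType}.
Local Notation C := R[i].
Hypothesis hample : ample G.
Hypothesis hcompact : compact (unit_space G).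
Hypothesis horbit :
  forall x : G, unit_space G x -> `I_3 #<= groupoid_orbit x.
Context (A : cstarAlgType R) (iota : (G -> C) -> A).
Hypothesis hA : groupoid_cstar iota.
Implicit Types (U V W K Z O : set G) (x y : G).
Implicit Types f g h : G -> C.
Implicit Types a b : A.
Local Notation Cc := (@Cc R G).
Local Notation G0 := (unit_space G).
Local Notation haus := (ample_hausdorff hample).
Local Notation CcD := (CcD hample hcompact).
Local Notation CcZ := (CcZ hample hcompact).
Local Notation Cstar := (Cc_star hample hcompact).
Local Notation Cconv := (Cc_conv hample hcompact horbit).
Local Notation Cc_ind := (Cc_ind hample hcompact horbit).
Local Notation convA := (convolA hample hcompact horbit).
Local Infix "**" := cmul (at level 40, left associativity).
Local Notation e U := (iota \1_U).

Let iotaD f g : Cc f -> Cc g -> iota (fun c => f c + g c) = iota f + iota g.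
Proof. exact: (groupoid_cstarD hA). Qed.
Let iotaZ k f : Cc f -> iota (fun c => k * f c) = k *: iota f.
Proof. exact: (groupoid_cstarZ hA). Qed.
Let iotaM f g : Cc f -> Cc g -> iota (convolution f g) = iota f ** iota g.
Proof. exact: (groupoid_cstarM hA). Qed.
Let iota_star f : Cc f -> iota (fstar f) = star (iota f).
Proof. exact: (groupoid_cstar_star hA). Qed.

Context (L : A -> C).
Hypothesis LD : forall a b, L (a + b) = L a + L b.
Hypothesis LZ : forall k a, L (k *: a) = k * L a.
Hypothesis L1 : L cone = 1.
Hypothesis Lpos : forall f, Cc f -> supported f G0 -> (forall c, 0 <= f c) ->
  0 <= L (iota f).
Hypothesis Linv : forall U a, full_group G U -> L (e U ** a) = L (a ** e U).

Let cont_unit : cont (\1_G0 : G -> C).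
Proof. by apply: cont_indic; apply: (co_clopen haus); exact: unit_co. Qed.

(** On [Cc] this is the conditional expectation onto the functions on the
    unit space. *)
Definition unit_restr f : G -> C := fun c => \1_G0 c * f c.

Let Cc_unit_restr f : Cc f -> Cc (unit_restr f).
Proof. exact: CcMl. Qed.

Let supp_unit_restr f : supported (unit_restr f) G0.
Proof. by move=> c nc; rewrite /unit_restr indic_out// mul0r. Qed.

Let Cc_full U : full_group G U -> Cc \1_U.
Proof. by move=> /full_cob[_ cU]; exact: Cc_indic. Qed.

Let unit_of (c d : G) : src c = rng d -> gmul c d = d -> G0 c.
Proof.
move=> cd e0; have := gmulIK cd; rewrite e0 gmulgV => <-; exact: unit_rngP.
Qed.

Let unit_of' (c d : G) : src d = rng c -> gmul d c = d -> G0 c.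
Proof.
move=> cd e0; have := gmulKV cd; rewrite e0 gmulVg => <-; exact: unit_srcP.
Qed.

(** With the next lemma, the two restricted products of [f] and [g] become
    [h * u^*] and [u^* * h] for the same [h], with [u] the indicator function
    of [U]; an invariant functional identifies them. *)
Let unit_restr_convoll U f g : full_group G U -> supported f U ->
  unit_restr (convolution f g) =
  convolution (fun x => f x * g (ginv x)) \1_(binv U).
Proof.
move=> fU sf; have bU : bisection U by case: fU.
have fV := full_group_binv fU; have bV : bisection (binv U) by case: fV.
have sV : supported (\1_(binv U) : G -> C) (binv U) by exact: supp_indic.
apply/funext => c; rewrite /unit_restr; have [uc|nc] := pselect (G0 c).
  have [a Ua ac] := full_rng c fU; have rc := (unitP c).1 uc.
  have Va : binv U (ginv a) by rewrite /binv/= ginvK.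
  rewrite (indic_in uc) mul1r (convol1 _ bU sf Ua ac).
  rewrite (convol2 _ bV sV Va); last by rewrite src_ginv ac rc (unit_src uc).
  rewrite ginvK (indic_in Va) mulr1; have ca : rng a = c by rewrite ac rc.
  have -> : gmul (ginv a) c = ginv a by rewrite -ca -src_ginv gmul_src.
  by have -> : gmul c a = a by rewrite -ca gmul_rng.
rewrite (indic_out nc) mul0r; have [b Vb bc] := full_src c fV.
rewrite (convol2 _ bV sV Vb bc) sf ?mul0r// => Uc; apply: nc.
apply: (@unit_of _ (ginv b)); first by rewrite rng_ginv.
case: bU => _ is_; apply: is_; rewrite ?inE//.
by rewrite src_gmul// rng_ginv.
Qed.

Let unit_restr_convolr U f g : full_group G U -> supported f U ->
  unit_restr (convolution g f) =
  convolution \1_(binv U) (fun x => f x * g (ginv x)).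
Proof.
move=> fU sf; have bU : bisection U by case: fU.
have fV := full_group_binv fU; have bV : bisection (binv U) by case: fV.
have sV : supported (\1_(binv U) : G -> C) (binv U) by exact: supp_indic.
apply/funext => c; rewrite /unit_restr; have [uc|nc] := pselect (G0 c).
  have [b Ub bc] := full_src c fU; have rc := (unitP c).1 uc; have sc := unit_src uc.
  have Vb : binv U (ginv b) by rewrite /binv/= ginvK.
  rewrite (indic_in uc) mul1r (convol2 _ bU sf Ub bc).
  rewrite (convol1 _ bV sV Vb); last by rewrite rng_ginv bc rc sc.
  rewrite ginvK (indic_in Vb) mul1r.
  have -> : gmul b c = b by rewrite -sc -bc gmul_src.
  have -> : gmul c (ginv b) = ginv b by rewrite -sc -bc -rng_ginv gmul_rng.
  exact: mulrC.
rewrite (indic_out nc) mul0r; have [a Va ac] := full_rng c fV.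
rewrite (convol1 _ bV sV Va ac) sf ?mul0r ?mulr0// => Uc; apply: nc.
apply: (@unit_of' _ (ginv a)); first by rewrite src_ginv.
case: bU => ir _; apply: ir; rewrite ?inE//.
by rewrite rng_gmul// src_ginv.
Qed.

Definition unit_trace f : C := L (iota (unit_restr f)).

Let unit_traceD f g : Cc f -> Cc g -> unit_trace (fun c => f c + g c) = unit_trace f + unit_trace g.
Proof.
move=> Cf Cg; rewrite /unit_trace -LD -iotaD; [|exact: Cc_unit_restr|exact: Cc_unit_restr].
by congr (L (iota _)); apply/funext => c; rewrite /unit_restr mulrDr.
Qed.

Let unit_traceZ k f : Cc f -> unit_trace (fun c => k * f c) = k * unit_trace f.
Proof.
move=> Cf; rewrite /unit_trace -LZ -iotaZ; last exact: Cc_unit_restr.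
by congr (L (iota _)); apply/funext => c; rewrite /unit_restr mulrCA.
Qed.

Let unit_trace1 : unit_trace \1_G0 = 1.
Proof.
rewrite /unit_trace -L1 -(iota_unit hample hcompact hA); congr (L (iota _)).
by apply/funext => c; rewrite /unit_restr !indicE -natrM mulnbl; case: (_ \in _).
Qed.

(** At a unit, the convolution of [fstar f] with [f] is a sum of squares. *)
Let unit_trace_ge0 f : Cc f -> 0 <= unit_trace (convolution (fstar f) f).
Proof.
move=> Cf; have Cs := Cstar Cf; apply: Lpos => [||c].
- by apply: Cc_unit_restr; exact: Cconv.
- exact: supp_unit_restr.
have [uc|nc] := pselect (G0 c); last by rewrite supp_unit_restr.
rewrite /unit_restr indic_in// mul1r /convolution; apply: fsumr_ge0 => -[a b] [].
rewrite /composable /= => ab abc.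
have -> : b = ginv a.
  have sa : src (ginv a) = src c.
    by rewrite src_ginv -(rng_gmul _ _ ab) abc (unit_src uc); exact/unitP.
  have := gmulKV ab; rewrite abc => <-.
  by rewrite -{1}(unit_src uc) -sa gmul_src.
by rewrite /fstar -normCKC exprn_ge0.
Qed.

Let Cinv g : Cc g -> Cc (fun x => g (ginv x)).
Proof.
move=> /Cstar Cs; have := CcZ 1 Cs.
have [cs [K cK sK]] := (CcP hample hcompact _).1 Cs => _.
apply/(CcP hample hcompact); split.
  have := cont_conj cs; congr (cont _); apply/funext => a.
  by rewrite /fstar conjCK.
exists K => // c nK; have := sK c nK; rewrite /fstar => /eqP.
by rewrite conjC_eq0 => /eqP.
Qed.

Let unit_trace_comm f g : Cc f -> Cc g ->
  unit_trace (convolution f g) = unit_trace (convolution g f).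
Proof.
move=> + Cg; move: f; apply: Cc_ind => [U f fU Cf sf|f f' Cf Cf' Hf Hf']; last first.
  have Cfg := Cconv Cf Cg; have Cfg' := Cconv Cf' Cg.
  have Cgf := Cconv Cg Cf; have Cgf' := Cconv Cg Cf'.
  by rewrite convolDl// convolDr// !unit_traceD// Hf Hf'.
rewrite /unit_trace (unit_restr_convoll _ fU sf) (unit_restr_convolr _ fU sf).
have fV := full_group_binv fU.
have Ch : Cc (fun x => f x * g (ginv x)).
  exact: (CcMl hample hcompact (Cc_cont Cf) (Cinv Cg)).
have CV := Cc_full fV; rewrite (iotaM Ch CV) (iotaM CV Ch); apply/esym; exact: Linv.
Qed.

(** The functional [unit_trace] is bounded by the norm of [A], so it extends
    to [A]; by density the extension is again a tracial state. *)
Lemma trace_exists : exists tau : {scalar A}, tracial_state tau.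
Proof.
pose X : set (A * C) := [set p | exists2 f, Cc f & p = (iota f, unit_trace f)].
have [||||tau [tauX taun]] := @hahn_banach R A X.
- exists (fun=> 0); first exact: Cc0.
  rewrite (iota0 hample hcompact hA); congr pair.
  rewrite -[LHS](mul0r (unit_trace (fun=> 0))) -unit_traceZ; last exact: Cc0.
  by congr unit_trace; apply/funext => c; rewrite mul0r.
- move=> _ _ [f Cf ->] [g Cg ->] /=; exists (fun c => f c + g c); first exact: CcD.
  by rewrite iotaD// unit_traceD.
- move=> k _ [f Cf ->] /=; exists (fun c => k * f c); first exact: CcZ.
  by rewrite iotaZ// unit_traceZ.
- move=> _ [f Cf ->] /=.
  exact: (positive_le_universal hample hcompact horbit unit_traceD unit_traceZ unit_trace_ge0 unit_trace1 hA Cf).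
have tauE f : Cc f -> tau (iota f) = unit_trace f.
  by move=> Cf; apply: (tauX (iota f, unit_trace f)); exists f.
have tauB a b : cabs (tau a - tau b) <= nrm (a - b) by rewrite -linearB taun.
exists tau; split.
- by rewrite -(iota_unit hample hcompact hA) tauE// ; apply: Cc_indic => //; exact: unit_co.
- move=> a; apply: lim_ge0 => eps e0.
  pose k := 2 * nrm a + 1.
  have k0 : 0 < k by rewrite /k ltr_wpDl// mulr_ge0 ?nrm_ge0.
  have d0 : 0 < Num.min 1 (eps / k) by rewrite lt_min ltr01 divr_gt0.
  have [f Cf] := iota_dense hA a d0; rewrite lt_min => /andP[f1 f2].
  exists (tau (star (iota f) ** iota f)).
    have Cs := Cstar Cf; have Csf := Cconv Cs Cf.
    rewrite -(iota_star Cf) -(iotaM Cs Cf) (tauE _ Csf); exact: unit_trace_ge0.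
  apply: (le_trans (tauB _ _)); apply: (le_trans (nrm_cmulB _ _ _ _)).
  rewrite -starB !nrm_star.
  have nf : nrm (iota f) <= nrm a + 1.
    have := nrmB a (a - iota f); rewrite opprB addrC subrK; lra.
  rewrite mulrC -mulrDl mulrC; move: f2; rewrite ltr_pdivlMr// => f2.
  apply: le_trans (ltW f2); rewrite ler_wpM2l ?nrm_ge0// /k; lra.
- move=> a b; apply/eqP; rewrite -subr_eq0; apply/eqP/cabs0_eq0/eqP.
  rewrite eq_le cabs_ge0 andbT; apply/ler_addgt0Pr => eps e0; rewrite add0r.
  pose k := 2 * (nrm a + nrm b + 1).
  have k0 : 0 < k by rewrite /k mulr_gt0// ltr_wpDl// addr_ge0 ?nrm_ge0.
  have d0 : 0 < Num.min 1 (eps / k) by rewrite lt_min ltr01 divr_gt0.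
  have [f Cf] := iota_dense hA a d0; rewrite lt_min => /andP[f1 f2].
  have [g Cg] := iota_dense hA b d0; rewrite lt_min => /andP[g1 g2].
  have tr : tau (iota f ** iota g) = tau (iota g ** iota f).
    by rewrite -!iotaM// !tauE; [exact: unit_trace_comm|exact: Cconv|exact: Cconv].
  have -> : tau (a ** b) - tau (b ** a) =
     (tau (a ** b) - tau (iota f ** iota g)) - (tau (b ** a) - tau (iota g ** iota f)).
    by rewrite tr opprB addrA subrK.
  apply: (le_trans (cabsD _ _)); rewrite cabsN.
  apply: (le_trans (lerD (tauB _ _) (tauB _ _))).
  apply: (le_trans (lerD (nrm_cmulB _ _ _ _) (nrm_cmulB _ _ _ _))).
  have nf : nrm (iota f) <= nrm a + 1.
    have := nrmB a (a - iota f); rewrite opprB addrC subrK; lra.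
  have ng : nrm (iota g) <= nrm b + 1.
    have := nrmB b (b - iota g); rewrite opprB addrC subrK; lra.
  move: f2 g2; rewrite !ltr_pdivlMr//; move: nf ng f1 g1 (nrm_ge0 a) (nrm_ge0 b).
  move: (nrm_ge0 (a - iota f)) (nrm_ge0 (b - iota g)) (nrm_ge0 (iota f)) (nrm_ge0 (iota g)).
  rewrite /k.
  set da := nrm (a - _); set db := nrm (b - _); set na := nrm a; set nb := nrm b.
  set nf := nrm _; set ng := nrm _ => da0 db0 nf0 ng0 nfa ngb da1 db1 na0 nb0 h1 h2.
  have b1 : da * nb + nf * db <= da * nb + (na + 1) * db by rewrite lerD2l ler_wpM2r.
  have b2 : db * na + ng * da <= db * na + (nb + 1) * da by rewrite lerD2l ler_wpM2r.
  nra.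
Qed.

(** The sum over the range fibre of a unit: the action of [f] on the constant
    function [1] in the trivial representation.  The factor [1] gives the sum the form
    required by [fsum_fibD]. *)
Definition fibre_sum f : G -> C := fun x =>
  \1_G0 x * \sum_(a \in [set a | rng a = x]) f a * 1.

Let fibre_sumD f g : Cc f -> Cc g ->
  fibre_sum (fun c => f c + g c) = (fun c => fibre_sum f c + fibre_sum g c).
Proof.
move=> Cf Cg; apply/funext => c.
by rewrite /fibre_sum (fsum_fibD hample hcompact horbit)// mulrDr.
Qed.

Let fibre_sumZ k f : fibre_sum (fun c => k * f c) = (fun c => k * fibre_sum f c).
Proof.
apply/funext => c; rewrite /fibre_sum mulrCA; congr (_ * _).
by rewrite mulr_fsumr; apply: eq_fsbigr => x _; rewrite mulrA.
Qed.

Let fibre_sum_full U f : full_group G U -> supported f U ->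
  fibre_sum f = convolution f \1_(binv U).
Proof.
move=> fU sf; have bU : bisection U by case: fU.
have fV := full_group_binv fU; have bV : bisection (binv U) by case: fV.
have sV : supported (\1_(binv U) : G -> C) (binv U) by exact: supp_indic.
apply/funext => c; rewrite /fibre_sum; have [uc|nc] := pselect (G0 c).
  have [x Ux xc] := full_rng c fU; have rc := (unitP c).1 uc.
  have Vx : binv U (ginv x) by rewrite /binv/= ginvK.
  have cx : rng x = c by rewrite xc rc.
  rewrite (indic_in uc) mul1r (@fsum_single _ _ _ _ x)//; last first.
    move=> y /= yc nyx; rewrite sf ?mul0r// => Uy; apply: nyx.
    by case: bU => ir _; apply: ir; rewrite ?inE// yc.
  rewrite (convol1 _ bU sf Ux xc).
  have -> : gmul (ginv x) c = ginv x by rewrite -cx -src_ginv gmul_src.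
  by rewrite (indic_in Vx).
rewrite (indic_out nc) mul0r; have [b Vb bc] := full_src c fV.
rewrite (convol2 _ bV sV Vb bc) sf ?mul0r// => Uc; apply: nc.
apply: (@unit_of _ (ginv b)); first by rewrite rng_ginv.
case: bU => _ is_; apply: is_; rewrite ?inE//.
by rewrite src_gmul// rng_ginv.
Qed.

Let Cc_fibre_sum f : Cc f -> Cc (fibre_sum f).
Proof.
move: f; apply: Cc_ind => [U f fU Cf sf|f g Cf Cg Hf Hg].
  have CV := Cc_full (full_group_binv fU).
  rewrite (fibre_sum_full fU sf); exact: Cconv.
rewrite (fibre_sumD Cf Cg); exact: (CcD Hf Hg).
Qed.

Let supp_fibre_sum f : supported (fibre_sum f) G0.
Proof. by move=> c nc; rewrite /fibre_sum indic_out// mul0r. Qed.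

Let supp_conv U V f g : supported f U -> supported g V ->
  supported (convolution f g) (bmul U V).
Proof.
move=> sf sg c nc; apply: convol_none => x y xy xyc.
have [Ux|nU] := pselect (U x); last by rewrite sf// mul0r.
rewrite [g y]sg ?mulr0// => Vy; apply: nc.
by exists x, y.
Qed.

Let e_binv U : full_group G U -> e (binv U) = star (e U).
Proof. by move=> fU; rewrite (e_star hample hcompact hA)//; case: (full_cob fU). Qed.

Definition trivial_state f : C := L (iota (fibre_sum f)).

(** Both sides are sesquilinear, so [f] and [g] may be supported in elements
    [U] and [W] of the full group.  Then both sides are values of [L] at elements of
    [A] which differ by the order of the factors coming from [U]. *)
Let trivial_state_star f g : Cc f -> Cc g ->
  trivial_state (convolution (fstar f) g) =
  L (iota (convolution (fstar (fibre_sum f)) (fibre_sum g))).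
Proof.
move=> + Cg; move: f; apply: Cc_ind => [U f fU Cf sf|f f' Cf Cf' Hf Hf']; last first.
  have Cs := Cstar Cf; have Cs' := Cstar Cf'.
  have Cp := Cc_fibre_sum Cf; have Cp' := Cc_fibre_sum Cf'; have Cpg := Cc_fibre_sum Cg.
  have Csg := Cconv Cs Cg; have Csg' := Cconv Cs' Cg.
  have Csp := Cstar Cp; have Csp' := Cstar Cp'.
  have C1 := Cconv Csp Cpg; have C2 := Cconv Csp' Cpg.
  rewrite fstarD (convolDl hample hcompact horbit _ Cs Cs').
  rewrite (fibre_sumD Cf Cf') fstarD (convolDl hample hcompact horbit _ Csp Csp').
  rewrite (iotaD C1 C2) LD -Hf -Hf' /trivial_state (fibre_sumD Csg Csg') -LD.
  by rewrite -(iotaD (Cc_fibre_sum Csg) (Cc_fibre_sum Csg')).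
have Cs := Cstar Cf; have Cp := Cc_fibre_sum Cf.
move: g Cg; apply: Cc_ind => [W g fW Cg sg|g g' Cg Cg' Hg Hg']; last first.
  have Cpg := Cc_fibre_sum Cg; have Cpg' := Cc_fibre_sum Cg'; have Csp := Cstar Cp.
  have Csg := Cconv Cs Cg; have Csg' := Cconv Cs Cg'.
  have C1 := Cconv Csp Cpg; have C2 := Cconv Csp Cpg'.
  rewrite (convolDr hample hcompact horbit _ _ Cs).
  rewrite (fibre_sumD Cg Cg') (convolDr hample hcompact horbit _ _ Csp).
  rewrite (iotaD C1 C2) LD -Hg -Hg' /trivial_state (fibre_sumD Csg Csg') -LD.
  by rewrite -(iotaD (Cc_fibre_sum Csg) (Cc_fibre_sum Csg')).
have fV := full_group_binv fU; have fW' := full_group_binv fW.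
have fVW := full_group_bmul hample fV fW.
have CfW := Cc_full fW'; have CfV := Cc_full fV; have Csg := Cconv Cs Cg.
have CfVW := Cc_full (full_group_binv fVW).
rewrite /trivial_state (fibre_sum_full fVW (supp_conv (supp_star sf) sg)).
rewrite (fibre_sum_full fU sf) (fibre_sum_full fW sg) (iotaM Csg CfVW) (iotaM Cs Cg).
have CfU := Cconv Cf CfV; have CgW := Cconv Cg CfW.
rewrite (iotaM (Cstar CfU) CgW) (iota_star CfU) (iotaM Cf CfV) (iotaM Cg CfW) (iota_star Cf).
rewrite (e_binv fVW) -(e_mul hample hcompact hA (full_cob fV) (full_cob fW)).
rewrite starM (e_binv fU) (e_binv fW) starK starM starK.
by rewrite !cmulA -Linv// !cmulA.
Qed.

Let trivial_stateD f g : Cc f -> Cc g -> trivial_state (fun c => f c + g c) = trivial_state f + trivial_state g.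
Proof.
by move=> Cf Cg; rewrite /trivial_state (fibre_sumD Cf Cg) (iotaD (Cc_fibre_sum Cf) (Cc_fibre_sum Cg)) LD.
Qed.

Let trivial_stateZ k f : Cc f -> trivial_state (fun c => k * f c) = k * trivial_state f.
Proof. by move=> Cf; rewrite /trivial_state fibre_sumZ (iotaZ _ (Cc_fibre_sum Cf)) LZ. Qed.

Let trivial_state_full U : full_group G U -> trivial_state \1_U = 1.
Proof.
move=> fU; have sU : supported (\1_U : G -> C) U by exact: supp_indic.
rewrite /trivial_state (fibre_sum_full fU sU) (iotaM (Cc_full fU) (Cc_full (full_group_binv fU))).
by rewrite (e_binv fU) (e_full_starr hample hcompact hA).
Qed.

Let trivial_state_ge0 f : Cc f -> 0 <= trivial_state (convolution (fstar f) f).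
Proof.
move=> Cf; rewrite trivial_state_star//; have Cp := Cc_fibre_sum Cf; have Csp := Cstar Cp.
have ssp : supported (fstar (fibre_sum f)) G0.
  by move=> c nc; rewrite fstar_unit// supp_fibre_sum// conjC0.
apply: Lpos => [||c]; first exact: Cconv.
  by apply: supp_convU.
by rewrite convol_unit// fstar_unit// -normCKC exprn_ge0.
Qed.

Lemma weakly_contains_trivial :
  weakly_contains (full_group_rep iota) (@trivial_rep R (full_group G)).
Proof.
move=> x; rewrite [X in X <= _]nrmE [X in _ <= X]nrmE lecR.
pose f (s : seq (C * full_group G)) : G -> C :=
  fun c => \sum_(p <- s) p.1 * \1_(val p.2) c.
have H s : [/\ Cc (f s), iota (f s) = \sum_(p <- s) p.1 *: full_group_rep iota p.2
    & trivial_state (f s) = \sum_(p <- s) p.1 *: trivial_rep R p.2].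
  elim: s => [|p s [Cf If Of]].
    have -> : f [::] = fun=> 0 by apply/funext => c; rewrite /f big_nil.
    rewrite !big_nil; split; [exact: Cc0|exact: iota0|].
    rewrite -[RHS](mul0r (trivial_state (fun=> 0))) -trivial_stateZ; last exact: Cc0.
    by congr trivial_state; apply/funext => c; rewrite mul0r.
  have fU : full_group G (val p.2) by exact: set_mem (valP p.2).
  have Cp := Cc_full fU; have Cpp := CcZ p.1 Cp.
  have -> : f (p :: s) = fun c => p.1 * \1_(val p.2) c + f s c.
    by apply/funext => c; rewrite /f big_cons.
  rewrite !big_cons; split; first exact: CcD.
    by rewrite (iotaD Cpp Cf) (iotaZ _ Cp) If.
  by rewrite (trivial_stateD Cpp Cf) (trivial_stateZ _ Cp) (trivial_state_full fU) Of.
have [Cf <- <-] := H x.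
have o1 : trivial_state \1_G0 = 1 by exact/trivial_state_full/full_group_unit.
exact: (positive_le_universal hample hcompact horbit trivial_stateD trivial_stateZ trivial_state_ge0 o1 hA Cf).
Qed.

End Invariant.

(** * Weak containment of the trivial representation *)

Section Absorption.
Context {R : realType} {A : cstarAlgType R}.
Implicit Types a b v : A.
Local Infix "**" := cmul (at level 40, left associativity).

Definition cmul_exp v k : A := iter k (cmul v) cone.

Lemma cmul_exp_comm v k : v ** cmul_exp v k = cmul_exp v k ** v.
Proof.
elim: k => [|k IH]; first by rewrite /cmul_exp/= cmul1r cmulr1.
by rewrite (_ : cmul_exp v k.+1 = v ** cmul_exp v k)// -cmulA -IH.
Qed.

Lemma nrm_cmul_exp v k : nrm (cmul_exp v k) <= nrm v ^+ k.
Proof.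
elim: k => [|k IH]; first exact: nrm1_le1.
by rewrite exprS; apply: le_trans (nrmM _ _) _; rewrite ler_wpM2l ?nrm_ge0.
Qed.

Lemma geometric_suml v n : (\sum_(k < n) cmul_exp v k) ** (cone - v) = cone - cmul_exp v n.
Proof.
elim: n => [|n IH]; first by rewrite big_ord0 cmul0l subrr.
by rewrite big_ord_recr cmulDl IH cmulBr cmulr1 -cmul_exp_comm addrA subrK.
Qed.

Lemma geometric_sumr v n : (cone - v) ** (\sum_(k < n) cmul_exp v k) = cone - cmul_exp v n.
Proof.
elim: n => [|n IH]; first by rewrite big_ord0 cmul0r subrr.
by rewrite big_ord_recr cmulDr IH cmulBl cmul1r addrA subrK.
Qed.

Lemma nrm_sum_le (n : nat) (F : 'I_n -> A) :
  (forall i, nrm (F i) <= 1) -> nrm (\sum_(i < n) F i) <= n%:R.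
Proof.
elim: n F => [|n IH] F F1; first by rewrite big_ord0 nrm0.
rewrite big_ord_recr /= -natr1; apply: le_trans (nrmD _ _) _.
by apply: lerD => //; exact: IH.
Qed.

Context (phi : A -> R[i]).
Hypothesis phiD : forall a b, phi (a + b) = phi a + phi b.
Hypothesis phiZ : forall k a, phi (k *: a) = k * phi a.
Hypothesis phi_nrm : forall a, cabs (phi a) <= nrm a.
Hypothesis phi_star : forall a, phi (star a) = ((phi a)^*)%R.

Let phi0 : phi 0 = 0.
Proof. by rewrite -(scale0r (0 : A)) phiZ mul0r. Qed.

Let phiB a b : phi (a - b) = phi a - phi b.
Proof. by rewrite phiD -scaleN1r phiZ mulN1r. Qed.

(** Let [S] be the sum of the first [n] powers of [v], and [b = a - v ** a].  Then
    [S ** b] is bounded independently of [n], so [star S + b] has a norm of at most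
    [sqrt (n ^+ 2 + const)], while [phi] takes the value [n + phi b] there.  For
    large [n] this forces the real part of [phi b] to be nonpositive; replacing [a] by
    a multiple shows that [phi b] is zero. *)
Lemma absorb v : star v ** v = cone -> (forall k, phi (cmul_exp v k) = 1) ->
  forall a, phi (v ** a) = phi a.
Proof.
move=> vv pv.
have nv : nrm v <= 1.
  rewrite -(@ler_pXn2r _ 2) ?nnegrE ?nrm_ge0 ?ler01//.
  by rewrite -nrm_cstar vv expr1n nrm1_le1.
have nvk k : nrm (cmul_exp v k) <= 1.
  by apply: le_trans (nrm_cmul_exp _ _) _; rewrite exprn_ile1// nrm_ge0.
have H a : complex.Re (phi (a - v ** a)) <= 0.
  rewrite leNgt; apply/negP; set d := complex.Re _ => d0.
  pose al := nrm a; have al0 : 0 <= al by exact: nrm_ge0.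
  pose b := (cone - v) ** a.
  have bE : b = a - v ** a by rewrite /b cmulBl cmul1r.
  have nb : nrm b <= 2 * al.
    rewrite bE; apply: le_trans (nrmB _ _) _.
    have : nrm (v ** a) <= 1 * al by apply: le_trans (nrmM _ _) _; rewrite ler_wpM2r.
    rewrite /al; lra.
  have bound n : 2 * n%:R * d <= 4 * al + 4 * al ^+ 2.
    pose S := \sum_(k < n) cmul_exp v k.
    have nS : nrm S <= n%:R by exact: nrm_sum_le.
    have pS : phi (star S) = n%:R.
      rewrite phi_star /S (big_morph phi phiD phi0).
      rewrite (eq_bigr (fun=> 1)); last by move=> i _; exact: pv.
      by rewrite sumr_const card_ord conjC_nat.
    have Sb : nrm (S ** b) <= 2 * al.
      rewrite /b cmulA geometric_suml; apply: le_trans (nrmM _ _) _.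
      rewrite ler_wpM2r//; apply: le_trans (nrmB _ _) _.
      have n1 : nrm (cone : A) <= 1 by exact: nrm1_le1.
      have := nvk n; lra.
    pose x := star S + b.
    have px : complex.Re (phi x) = n%:R + d.
      rewrite phiD pS bE ReD -/d; congr (_ + _).
      by rewrite -(rmorph_nat (real_complex R)).
    have nx : nrm x ^+ 2 <= n%:R ^+ 2 + 4 * al + 4 * al ^+ 2.
      rewrite -nrm_cstar /x starD starK cmulDl !cmulDr.
      apply: le_trans (nrmD _ _) _.
      have h1 : nrm (S ** star S) <= n%:R ^+ 2.
        apply: le_trans (nrmM _ _) _; rewrite nrm_star expr2.
        by apply: ler_pM; rewrite ?nrm_ge0.
      have h2 : nrm (star b ** star S) <= 2 * al by rewrite -starM nrm_star.
      have h3 : nrm (star b ** b) <= 4 * al ^+ 2.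
        rewrite nrm_cstar (_ : 4 * al ^+ 2 = (2 * al) ^+ 2); last by ring.
        by rewrite ler_pXn2r ?nnegrE ?nrm_ge0 ?mulr_ge0.
      have := nrmD (S ** star S) (S ** b); have := nrmD (star b ** star S) (star b ** b).
      lra.
    have nd : 0 <= n%:R + d :> R by rewrite addr_ge0// ltW.
    have : (n%:R + d) ^+ 2 <= nrm x ^+ 2.
      rewrite ler_pXn2r ?nnegrE ?nrm_ge0// -px.
      exact: le_trans (Re_le_cabs _) (phi_nrm _).
    have := sqr_ge0 d; rewrite sqrrD mulr2n; lra.
  (* The bound holds for all [n], contradicting the archimedean property. *)
  pose q := (4 * al + 4 * al ^+ 2) / (2 * d).
  have q0 : 0 <= q by apply: divr_ge0; [have := sqr_ge0 al; lra|lra].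
  have d2 : 0 < 2 * d by lra.
  have := archi_boundP q0; rewrite {1}/q ltr_pdivrMr//.
  have := bound (Num.bound q); lra.
move=> a; apply/eqP; rewrite eq_sym -subr_eq0 -phiB; apply/eqP/cabs0_eq0/eqP.
set d := phi (a - v ** a).
have := H ((d^*)%R *: a).
have -> : (d^*)%R *: a - v ** ((d^*)%R *: a) = (d^*)%R *: (a - v ** a).
  by rewrite cmulZr scalerBr.
rewrite phiZ -/d -cabs_sqr /= => h.
by rewrite -sqrf_eq0 eq_le h sqr_ge0.
Qed.

End Absorption.

Section Characters.
Context {R : realType} {G : topGroupoidType}.
Local Notation C := R[i].
Hypothesis hample : ample G.
Hypothesis hcompact : compact (unit_space G).
Hypothesis horbit :
  forall x : G, unit_space G x -> `I_3 #<= groupoid_orbit x.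
Context (A : cstarAlgType R) (iota : (G -> C) -> A).
Hypothesis hA : groupoid_cstar iota.
Implicit Types (U V W K Z O : set G) (x y : G).
Implicit Types f g h : G -> C.
Implicit Types a b : A.
Local Notation Cc := (@Cc R G).
Local Notation G0 := (unit_space G).
Local Notation haus := (ample_hausdorff hample).
Local Infix "**" := cmul (at level 40, left associativity).
Local Notation e U := (iota \1_U).
Local Notation B := (full_group_cstar iota).
Local Notation WC :=
  (weakly_contains (full_group_rep iota) (@trivial_rep R (full_group G))).

Lemma tracial_state_weakly_contains (tau : {scalar A}) : tracial_state tau -> WC.
Proof.
move=> [t1 tp tt]; apply: (@weakly_contains_trivial _ _ hample hcompact horbit _ _ hA tau).
- exact: linearD.
- by move=> k a; rewrite linearZ.
- exact: t1.
- move=> f Cf sf f0; have [h [Ch sh hh <-]] := unit_sqrt hample hcompact Cf sf f0.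
  rewrite (groupoid_cstarM hA)// -{1}hh (groupoid_cstar_star hA)//; exact: tp.
- by move=> U a _; exact: tt.
Qed.

Lemma cmul_exp_full U k : full_group G U ->
  exists V, full_group G V /\ cmul_exp (e U) k = e V.
Proof.
move=> fU; elim: k => [|k [V [fV IH]]].
  exists G0; split; first exact: full_group_unit.
  by rewrite (iota_unit hample hcompact hA).
exists (bmul U V); split; first exact: full_group_bmul.
by rewrite /= -/(cmul_exp _ _) IH (e_mul hample hcompact hA)//; exact: full_cob.
Qed.

(** Weak containment says that the trivial representation is contractive on the
    span of the full group in [A], so it extends to [A].  Averaging with the adjoint
    makes the extension hermitian. *)
Lemma weakly_contains_state : WC -> exists phi : A -> C,
  [/\ (forall a b, phi (a + b) = phi a + phi b),
      (forall k a, phi (k *: a) = k * phi a),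
      (forall a, cabs (phi a) <= nrm a),
      (forall a, phi (star a) = ((phi a)^*)%R) &
      (forall U, full_group G U -> phi (e U) = 1)].
Proof.
move=> wc.
pose X : set (A * C) := [set p | exists s : seq (C * full_group G),
  p = (\sum_(q <- s) q.1 *: full_group_rep iota q.2,
       \sum_(q <- s) q.1)].
have [||||F [FX Fn]] := @hahn_banach R A X.
- by exists [::]; rewrite !big_nil.
- by move=> _ _ [s ->] [t ->] /=; exists (s ++ t); rewrite !big_cat.
- move=> k _ [s ->] /=; exists [seq (k * q.1, q.2) | q <- s].
  rewrite !big_map /= scaler_sumr mulr_sumr; congr pair.
  by apply: eq_bigr => q _; rewrite scalerA.
- move=> _ [s ->] /=; have := wc s.
  rewrite [X in X <= _]nrmE [X in _ <= X]nrmE lecR; apply: le_trans.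
  rewrite le_eqVlt; apply/orP; left; apply/eqP.
  rewrite /nrm /cabs; congr (complex.Re `|_|); apply: eq_bigr => q _.
  by rewrite /trivial_rep; exact/esym/mulr1.
have F1 U : full_group G U -> F (e U) = 1.
  move=> fU; pose u : full_group G := SigSub (mem_set fU).
  have := FX (full_group_rep iota u, 1); apply; exists [:: (1, u)].
  by rewrite !big_seq1 /= scale1r.
have FZ k a : F (k *: a) = k * F a by exact: linearZ.
(* The hermitian part of [F]. *)
pose phi a : C := (F a + ((F (star a))^*)%R) / 2.
exists phi; split.
- by move=> a b; rewrite /phi starD !linearD rmorphD /=; ring.
- by move=> k a; rewrite /phi starZ !FZ (rmorphM Num.conj) /= conjCK; ring.
- move=> a; rewrite /phi mulrC cabsM.
  have -> : cabs (2^-1 : C) = 2^-1.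
    have -> : (2^-1 : C) = (2^-1)%:C by rewrite fmorphV rmorph_nat.
    by rewrite cabs_real ger0_norm.
  have := cabsD (F a) ((F (star a))^*)%R; have := Fn a; have := Fn (star a).
  rewrite nrm_star cabs_conj; lra.
- move=> a; rewrite /phi starK (rmorphM Num.conj) (rmorphD Num.conj) /= conjCK addrC; congr (_ * _).
  by rewrite (fmorphV Num.conj) /= conjC_nat.
- move=> U fU; rewrite /phi (e_star hample hcompact hA); last by case: (full_cob fU).
  by rewrite !F1//; [rewrite conjC1 divff// pnatr_eq0|exact: full_group_binv].
Qed.

Section WithPhi.
Context (phi : A -> C).
Hypothesis phiD : forall a b, phi (a + b) = phi a + phi b.
Hypothesis phiZ : forall k a, phi (k *: a) = k * phi a.
Hypothesis phi_nrm : forall a, cabs (phi a) <= nrm a.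
Hypothesis phi_star : forall a, phi (star a) = ((phi a)^*)%R.
Hypothesis phiU : forall U, full_group G U -> phi (e U) = 1.

Let phiB a b : phi (a - b) = phi a - phi b.
Proof. by rewrite phiD -scaleN1r phiZ mulN1r. Qed.

Let absl U a : full_group G U -> phi (e U ** a) = phi a.
Proof.
move=> fU; apply: (absorb phiD phiZ phi_nrm phi_star).
  exact: (e_full_starl hample hcompact hA fU).
by move=> k; have [V [fV ->]] := cmul_exp_full k fU; exact: phiU.
Qed.

Let absr U a : full_group G U -> phi (a ** e U) = phi a.
Proof.
move=> fU; rewrite -[RHS]conjCK -phi_star -(absl (star a) (full_group_binv fU)).
rewrite -(e_star hample hcompact hA); last by case: (full_cob fU).
by rewrite -starM phi_star conjCK.
Qed.

Let phi1 : phi cone = 1.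
Proof. by rewrite -(iota_unit hample hcompact hA) phiU//; exact: full_group_unit. Qed.

(** A contractive functional of value [1] at [1] is nonnegative at [f] if
    [M - f] has norm at most [M]. *)
Let phi_pos f : Cc f -> supported f G0 -> (forall c, 0 <= f c) -> 0 <= phi (iota f).
Proof.
move=> Cf sf f0.
have ff : fstar f = f.
  by rewrite fstar_unit//; apply/funext => c; exact: geC0_conj.
have [M' M0' fM'] := Cc_bounded hample hcompact Cf.
pose M := complex.Re M'; have M0 : 0 <= M by exact: ge0_Re.
have fM c : complex.Re (f c) <= M.
  by have := fM' c; rewrite ger0_norm// (ge0_ReE (f0 c)) (ge0_ReE M0') lecR.
have im0 : complex.Im (phi (iota f)) = 0.
  have := phi_star (iota f); rewrite -(groupoid_cstar_star hA)// ff.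
  case: (phi _) => p q /= [] h; lra.
rewrite lecE im0 eqxx /=.
have CM := CcZ hample hcompact M%:C (Cc_unit (R:=R) hample hcompact).
pose g c := M%:C * \1_G0 c - f c.
have Cg : Cc g by exact: Cc_sub.
have sg : supported g G0 by move=> c nc; rewrite /g indic_out// sf// mulr0 subr0.
have ng : nrm (iota g) <= M.
  apply: (nrm_unit_le hample hcompact horbit hA Cg sg M0) => c.
  have [uc|nc] := pselect (G0 c); last by rewrite sg// /cabs normr0.
  rewrite /g indic_in// mulr1 (ge0_ReE (f0 c)) -rcN -rcD cabs_real.
  rewrite ger0_norm ?subr_ge0// lerBlDr lerDl; exact: ge0_Re.
have := Re_le_cabs (phi (iota g)); have := phi_nrm (iota g).
rewrite (iotaB hample hcompact hA CM Cf) phiB (groupoid_cstarZ hA).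
  rewrite phiZ (iota_unit hample hcompact hA) phi1 mulr1 ReD ReN /=.
  move: ng; rewrite (iotaB hample hcompact hA CM Cf) (groupoid_cstarZ hA).
    by rewrite (iota_unit hample hcompact hA); lra.
  exact: Cc_unit.
exact: Cc_unit.
Qed.

Lemma state_trace : exists tau : {scalar A}, tracial_state tau.
Proof.
apply: (@trace_exists _ _ hample hcompact horbit _ _ hA phi) => //.
by move=> U a fU; rewrite absl// absr.
Qed.

(** The elements [b] such that [phi (b ** a) = phi b * phi a] for all [a], and
    their adjoints, form a C*-subalgebra containing the full group. *)
Lemma state_character : character B phi.
Proof.
pose T : set A := [set b | forall a, phi (b ** a) = phi b * phi a].
pose T' : set A := [set b | T b /\ T (star b)].
have clT : closed T.
  move=> b /closureP cb a; apply/eqP; rewrite -subr_eq0; apply/eqP/cabs0_eq0/eqP.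
  rewrite eq_le cabs_ge0 andbT; apply/ler_addgt0Pr => eps e0; rewrite add0r.
  have k0 : 0 < 2 * nrm a + 1 by rewrite ltr_wpDl// mulr_ge0// nrm_ge0.
  have [b' Tb' bb'] := cb _ (divr_gt0 e0 k0).
  have -> : phi (b ** a) - phi b * phi a =
      phi ((b - b') ** a) - phi (b - b') * phi a.
    by rewrite cmulBl !phiB (Tb' a); ring.
  apply: le_trans (cabsD _ _) _; rewrite cabsN cabsM.
  have h1 : cabs (phi ((b - b') ** a)) <= nrm (b - b') * nrm a.
    exact: le_trans (phi_nrm _) (nrmM _ _).
  have h2 : cabs (phi (b - b')) * cabs (phi a) <= nrm (b - b') * nrm a.
    by apply: ler_pM; rewrite ?cabs_ge0.
  move: bb'; rewrite ltr_pdivlMr// => h3.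
  have := nrm_ge0 (b - b'); lra.
have clT' : closed T'.
  move=> b /closureP cb; split.
    apply: (closed_nrm clT) => eps e0; have [b' [Tb' _] h] := cb _ e0.
    by exists b'.
  apply: (closed_nrm clT) => eps e0; have [b' [_ Tb'] h] := cb _ e0.
  by exists (star b') => //; rewrite -starB nrm_star.
have TD a b : T a -> T b -> T (a + b).
  by move=> Ta Tb c; rewrite cmulDl !phiD Ta Tb mulrDl.
have TZ k a : T a -> T (k *: a).
  by move=> Ta c; rewrite cmulZl !phiZ Ta mulrA.
have TM a b : T a -> T b -> T (a ** b).
  by move=> Ta Tb c; rewrite -cmulA !Ta Tb mulrA.
have T0 : T 0 by move=> c; rewrite cmul0l -(scale0r (0 : A)) !phiZ !mul0r.
have sub : cstar_subalgebra T'.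
  split.
  - by split; rewrite ?star0.
  - by move=> a b [? ?] [? ?]; split; rewrite ?starD; exact: TD.
  - by move=> k a [? ?]; split; rewrite ?starZ; exact: TZ.
  - by move=> a b [? ?] [? ?]; split; rewrite ?starM; exact: TM.
  - by move=> a [? ?]; split; rewrite ?starK.
  - exact: clT'.
have BT : B `<=` T'.
  apply: smallest_sub => // _ [U _ <-]; have fU := set_mem (valP U).
  have TU V : full_group G V -> T (e V) by move=> fV a; rewrite absl// phiU// mul1r.
  split; first exact: TU.
  rewrite /full_group_rep (e_star hample hcompact hA); last by case: (full_cob fU).
  by apply: TU; exact: full_group_binv.
split.
- exact: phi1.
- by move=> a b _ _; exact: phiD.
- by move=> k a _; exact: phiZ.
- by move=> a b /BT[Ta _] _; exact: Ta.
- by move=> a _; exact: phi_star.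
Qed.

End WithPhi.

(** A character on [A] kills the element [e W] if [W] has disjoint source and
    range, since [e W] squares to zero.  Sources of such [W] form a cover of the unit
    space. *)
Lemma no_character_eqT chi : B = [set: A] -> ~ character B chi.
Proof.
move=> BT [c1 cD cZ cM cS].
have chiM a b : chi (a ** b) = chi a * chi b by apply: cM; rewrite BT.
have chiD a b : chi (a + b) = chi a + chi b by apply: cD; rewrite BT.
have chi0 : chi 0 = 0 by rewrite -(scale0r (0 : A)) cZ ?mul0r// BT.
suff : chi (e G0) = 0.
  by rewrite (iota_unit hample hcompact hA) c1 => /eqP; rewrite oner_eq0.
pose Q Z := chi (e Z) = 0.
apply: (@compact_open_ind _ haus Q _ (unit_co hample hcompact)).
- by rewrite /Q (e_set0 hample hcompact hA).
- move=> Z L cZ' cL ZL QZ QL.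
  by rewrite /Q (e_disj hample hcompact hA)// chiD QZ QL addr0.
- move=> x ux; have [c [sc rc _]] := third_point horbit x ux.
  have [|V [cV Vc dis]] := @disjoint_cob_basis _ hample hcompact c; first by rewrite sc.
  have [bV coV] := cV.
  exists (src @` V); split; [exact: src_co|by exists c|].
  move=> Z coZ ZV; pose W := V `&` src @^-1` Z.
  have cW : co_bisection W.
    apply: (co_bisection_sub cV); last by move=> y [].
    apply: (coIclopen haus coV); exact: src_preim.
  have sW : src @` W = Z.
    apply/seteqP; split=> [_ [y [_ Zy] <-]//|z Zz].
    by have [y Vy yz] := ZV z Zz; exists y => //; split => //=; rewrite yz.
  have ww : e W ** e W = 0.
    rewrite (e_mul hample hcompact hA cW cW) -(e_set0 hample hcompact hA).
    congr (iota \1__); apply/seteqP; split => // z [p [q [[Vp _] [Vq _] pq _]]].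
    have : (rng @` V `&` src @` V) (src p) by split; [exists q|exists p].
    by rewrite dis.
  have w0 : chi (e W) = 0.
    by apply/eqP; rewrite -sqrf_eq0 expr2 -chiM ww chi0.
  rewrite /Q -sW -(bmul_invl cW) -(e_mul hample hcompact hA (binv_cob cW) cW).
  by rewrite chiM w0 mulr0.
Qed.

End Characters.

(** * The augmentation ideal is hereditary *)

Lemma cstar_generated_sub (R : realType) (A : cstarAlgType R) (S : set A) :
  cstar_subalgebra (cstar_generated S).
Proof.
split.
- by move=> M [[]].
- by move=> a b Ba Bb M HM; have [[_ h _ _ _ _] _] := HM; apply: h; [exact: Ba|exact: Bb].
- by move=> k a Ba M HM; have [[_ _ h _ _ _] _] := HM; apply: h; exact: Ba.
- by move=> a b Ba Bb M HM; have [[_ _ _ h _ _] _] := HM; apply: h; [exact: Ba|exact: Bb].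
- by move=> a Ba M HM; have [[_ _ _ _ h _] _] := HM; apply: h; exact: Ba.
- by apply: closed_bigI => M [[]].
Qed.

Section Rigidity.
Context {R : realType} {G : topGroupoidType}.
Local Notation C := R[i].
Hypothesis hample : ample G.
Hypothesis hcompact : compact (unit_space G).
Hypothesis horbit :
  forall x : G, unit_space G x -> `I_3 #<= groupoid_orbit x.
Context (A : cstarAlgType R) (iota : (G -> C) -> A).
Hypothesis hA : groupoid_cstar iota.
Implicit Types (U V W K Z O P Q : set G) (x y : G).
Implicit Types a b : A.
Local Notation G0 := (unit_space G).
Local Notation haus := (ample_hausdorff hample).
Local Infix "**" := cmul (at level 40, left associativity).
Local Notation e U := (iota \1_U).
Local Notation B := (full_group_cstar iota).
Local Notation e_mul := (e_mul hample hcompact hA).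
Local Notation e_star := (e_star hample hcompact hA).
Local Notation e_disj := (e_disj hample hcompact hA).

Let B_cstar_subalgebra := cstar_generated_sub (range (full_group_rep iota)).
Let BD a b : B a -> B b -> B (a + b). Proof. exact: (cstar_subalgebraD B_cstar_subalgebra). Qed.
Let BZ k a : B a -> B (k *: a). Proof. exact: (cstar_subalgebraZ B_cstar_subalgebra). Qed.
Let BM a b : B a -> B b -> B (a ** b). Proof. exact: (cstar_subalgebraM B_cstar_subalgebra). Qed.
Let BS a : B a -> B (star a). Proof. exact: (cstar_subalgebra_star B_cstar_subalgebra). Qed.
Let BN a b : B a -> B b -> B (a - b).
Proof. by move=> Ba Bb; apply: BD => //; rewrite -scaleN1r; exact: BZ. Qed.

Let Bfull U : full_group G U -> B (e U).
Proof.
move=> fU; apply: sub_gen_smallest.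
by exists (SigSub (mem_set fU)).
Qed.

Let B1 : B cone.
Proof. by rewrite -(iota_unit hample hcompact hA); apply: Bfull; exact: full_group_unit. Qed.

Let bmul0 P Q : (src @` P) `&` (rng @` Q) = set0 -> bmul P Q = set0.
Proof.
move=> PQ; apply/seteqP; split=> // c [p [q [Pp Qq pq _]]].
have : (src @` P `&` rng @` Q) (src p) by split; [exists p|exists q].
by rewrite PQ.
Qed.

Let unit_rs Z : Z `<=` G0 -> rng @` Z = Z /\ src @` Z = Z.
Proof.
move=> ZG; split; apply/seteqP; split.
- by move=> _ [z Zz <-]; have /unitP -> := ZG z Zz.
- by move=> z Zz; exists z => //; apply/unitP; exact: ZG.
- by move=> _ [z Zz <-]; have /unit_src -> := ZG z Zz.
- by move=> z Zz; exists z => //; apply/unit_src; exact: ZG.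
Qed.

Let e_src P : co_bisection P -> star (e P) ** e P = e (src @` P).
Proof.
move=> cP; have [_ coP] := cP.
by rewrite e_star// e_mul ?bmul_invl//; exact: binv_cob.
Qed.

Let e_rng P : co_bisection P -> e P ** star (e P) = e (rng @` P).
Proof.
move=> cP; have [_ coP] := cP.
by rewrite e_star// e_mul ?bmul_invr//; exact: binv_cob.
Qed.

Let bmul_src P : bmul P (src @` P) = P.
Proof.
apply/seteqP; split.
  move=> _ [p [_ [Pp [q Qq <-] pq ->]]]; rewrite rng_src in pq.
  by rewrite -pq gmul_src.
move=> p Pp; exists p, (src p); split.
- by [].
- by exists p.
- by rewrite rng_src.
- by rewrite gmul_src.
Qed.

Let src_cob P : co_bisection P -> co_bisection (src @` P).
Proof.
move=> [_ cP]; apply: unit_cob => //; first exact: src_co.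
by move=> _ [p _ <-]; exact: unit_srcP.
Qed.

Let e_Psrc P : co_bisection P -> e P ** e (src @` P) = e P.
Proof. by move=> cP; rewrite e_mul ?bmul_src//; exact: src_cob. Qed.

(** For a partial isometry [v] with orthogonal initial and final projections,
    [1] minus the transposition of [v] is [(z - v) ** (z - star v)], where [z] is
    the initial projection. *)
Let e_transposition V : co_bisection V -> rng @` V `&` src @` V = set0 ->
  cone - e (transposition V) =
  (e (src @` V) - e V) ** (e (src @` V) - star (e V)).
Proof.
move=> cV dis; have [bV coV] := cV; have ciV := binv_cob cV.
have coR := rng_co hample coV; have coS := src_co hample coV.
have coRS : compact_and_open (rng @` V `|` src @` V) by exact: coU.
have co3 : compact_and_open (G0 `\` (rng @` V `|` src @` V)).
  by apply: (coD haus (unit_co hample hcompact)); exact: (co_clopen haus).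
have D (a b : G) : V a -> V b -> rng a = src b -> False.
  move=> Va Vb h; have : (rng @` V `&` src @` V) (rng a).
    by split; [exists a|rewrite h; exists b].
  by rewrite dis.
have d1 : V `&` binv V = set0.
  apply/seteqP; split=> // a [Va Vai]; apply: (D a (ginv a) Va Vai).
  by rewrite src_ginv.
have d2 : (V `|` binv V) `&` (G0 `\` (rng @` V `|` src @` V)) = set0.
  apply/seteqP; split=> // a [[Va|Va] [/unitP ua na]]; apply: na.
    by left; exists a.
  by right; exists (ginv a); rewrite ?src_ginv.
have eC : e (G0 `\` (rng @` V `|` src @` V)) = cone - (e (rng @` V) + e (src @` V)).
  rewrite -e_disj// -(iota_unit hample hcompact hA).
  apply/eqP; rewrite eq_sym subr_eq -e_disj//; last first.
    by apply/seteqP; split=> // a [[]].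
  have -> // : G0 `\` (rng @` V `|` src @` V) `|` (rng @` V `|` src @` V) = G0.
  apply/seteqP; split=> z; last by move=> uz; case: (pselect ((rng @` V `|` src @` V) z)); [right|left].
  by move=> [[]//|[[a _ <-]|[a _ <-]]]; [exact: unit_rngP|exact: unit_srcP].
have coVV : compact_and_open (V `|` binv V) by apply: coU => //; case: ciV.
rewrite /transposition e_disj// e_disj//; last by case: ciV.
rewrite eC -e_star// -e_rng// -e_src//.
set v := e V; set w := star v.
have vz : v ** (w ** v) = v by rewrite /w /v e_src// e_Psrc.
have zw : w ** v ** w = w by rewrite -[RHS]/(star v) -[X in _ = star X]vz !starM starK.
rewrite cmulBl !cmulBr zw vz.
have -> : w ** v ** (w ** v) = w ** v by rewrite cmulA zw.
rewrite opprD [- (cone - _)]opprB addrA addrC addrA subrK.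
by rewrite [- (v - _)]opprB opprD addrACA addrC.
Qed.

Let transposition_B V : co_bisection V -> rng @` V `&` src @` V = set0 ->
  B ((e (src @` V) - e V) ** (e (src @` V) - star (e V))).
Proof.
move=> cV dis; rewrite -e_transposition//; apply: BN => //; apply: Bfull.
exact: transposition_full.
Qed.

Let rng_bmul P Q : rng @` (bmul P Q) `<=` rng @` P.
Proof.
move=> _ [_ [p [q [Pp Qq pq ->]]] <-]; exists p => //.
by rewrite rng_gmul.
Qed.

(** With [p = e P], [q = e Q], [z = e Z] and the transposition [S] exchanging the
    ranges of [P] and [Q], we have [z - p = S ** (z - q)].  So the product is
    [S ** ((z - q) ** (z - star q))], and the second factor is [1] minus a
    transposition. *)
Let corner_moving P Q Z : co_bisection P -> co_bisection Q -> src @` P = Z -> src @` Q = Z ->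
  Z `&` rng @` P = set0 -> Z `&` rng @` Q = set0 -> rng @` P `&` rng @` Q = set0 ->
  B ((e Z - e P) ** (e Z - star (e Q))).
Proof.
move=> cP cQ sP sQ ZP ZQ PQ.
have [_ coP] := cP; have [_ coQ] := cQ.
have cZ : co_bisection Z by rewrite -sP; exact: src_cob.
have ZG : Z `<=` G0 by rewrite -sP => _ [p _ <-]; exact: unit_srcP.
have [rZ sZ] := unit_rs ZG.
have ciQ := binv_cob cQ; have ciP := binv_cob cP.
set p := e P; set q := e Q; set z := e Z; set q' := star q.
have qq : q' ** q = z by rewrite /q' /q e_src// sQ.
have qz : q ** z = q by rewrite /q /z -sQ e_Psrc.
have pz : p ** z = p by rewrite /p /z -sP e_Psrc.
have zq : z ** q = 0.
  by rewrite /z /q e_mul// bmul0 ?sZ// (e_set0 hample hcompact hA).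
have q'z : q' ** z = 0.
  have := congr1 (@star _ _) zq; rewrite starM star0 /z [in X in _ ** X]e_star//; last by case: cZ.
  have -> // : binv Z = Z.
  apply/seteqP; split=> x; rewrite /binv/= => Zx; last by rewrite ginv_unit//; exact: ZG.
  by rewrite -(ginvK x) (ginv_unit (ZG _ Zx)).
have p'q : star p ** q = 0.
  rewrite /p /q e_star// e_mul// bmul0 ?(e_set0 hample hcompact hA)//.
  apply/seteqP; split => // x [[a Pa ax] [b Qb bx]].
  have : (rng @` P `&` rng @` Q) x.
    split; last by exists b.
    by exists (ginv a) => //; rewrite rng_ginv.
  by rewrite PQ.
pose Rr := bmul P (binv Q).
have cR : co_bisection Rr by exact: bmul_cob.
have sbR : src @` Rr = rng @` Q.
  apply/seteqP; split.
    move=> _ [_ [a [b [Pa Qb ab ->]]] <-]; exists (ginv b) => //.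
    by rewrite src_gmul// rng_ginv.
  move=> _ [b Qb <-]; have : (src @` P) (src b) by rewrite sP -sQ; exists b.
  move=> [a Pa ab]; exists (gmul a (ginv b)).
    exists a, (ginv b); split => //; first by rewrite /binv/= ginvK.
    by rewrite rng_ginv.
  by rewrite src_gmul ?src_ginv// rng_ginv.
have disR : rng @` Rr `&` src @` Rr = set0.
  apply/seteqP; split => // x [/rng_bmul Px]; rewrite sbR => Qx.
  by have : (rng @` P `&` rng @` Q) x by []; rewrite PQ.
have rE : e Rr = p ** q' by rewrite /p /q' /q e_star// e_mul.
have BSw : B (e (transposition Rr)) by apply: Bfull; exact: transposition_full.
(* The transposition [S] along the bisection from the range of [Q] to that of [P]. *)
have SE : e (transposition Rr) = cone - (q ** q' - p ** q') ** (q ** q' - q ** star p).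
  have := e_transposition cR disR; rewrite sbR -e_rng// rE starM starK -/q -/q' => <-.
  by rewrite opprB addrC subrK.
suff -> : z - p = e (transposition Rr) ** (z - q).
  rewrite -cmulA; apply: BM => //; rewrite /z -sQ.
  by apply: transposition_B => //; rewrite sQ setIC.
have r'z : q ** star p ** z = 0.
  rewrite -cmulA.
  have zp : z ** p = 0.
    by rewrite /z /p e_mul// bmul0 ?sZ// (e_set0 hample hcompact hA).
  have -> : star p ** z = 0.
    have := congr1 (@star _ _) zp; rewrite starM star0 /z [in X in _ ** X]e_star//; last by case: cZ.
    have -> // : binv Z = Z.
    apply/seteqP; split=> x; rewrite /binv/= => Zx; last by rewrite ginv_unit//; exact: ZG.
    by rewrite -(ginvK x) (ginv_unit (ZG _ Zx)).
  exact: cmul0r.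
have E1 : (q ** q' - q ** star p) ** (z - q) = - q.
  rewrite cmulBl !cmulBr r'z -!cmulA q'z qq qz p'q !cmul0r.
  by rewrite !sub0r oppr0 subr0.
have E2 : (q ** q' - p ** q') ** (- q) = p - q.
  by rewrite cmulNr cmulBl -!cmulA qq qz pz opprB.
rewrite SE cmulBl cmul1r -cmulA E1 E2.
by rewrite opprB addrA subrK.
Qed.

Section Germs.
Context (x : G).
Hypothesis ux : G0 x.

Let near_co (Phi : set G -> Prop) := exists C, [/\ compact_and_open C, C x &
  forall Z, compact_and_open Z -> Z `<=` C -> Phi Z].

Let near_coI (Phi Psi : set G -> Prop) : near_co Phi -> near_co Psi ->
  near_co (fun Z => Phi Z /\ Psi Z).
Proof.
move=> [K [cK Kx HK]] [L [cL Lx HL]]; exists (K `&` L); split => //.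
  exact: (coI haus).
move=> Z cZ ZKL; split; [apply: HK|apply: HL] => //; by move=> y /ZKL[].
Qed.

Let near_co_mono (Phi Psi : set G -> Prop) : (forall Z, Phi Z -> Psi Z) ->
  near_co Phi -> near_co Psi.
Proof. by move=> H [K [cK Kx HK]]; exists K; split => // Z cZ /(HK _ cZ)/H. Qed.

Let near_src P u : co_bisection P -> P u -> src u = x ->
  near_co (fun Z => Z `<=` src @` P /\ compact_and_open Z).
Proof.
move=> cP Pu su; exists (src @` P); split => //; last by exists u.
by apply: src_co => //; case: cP.
Qed.

Let cut P Z := P `&` src @^-1` Z.

Let cut_cob P Z : co_bisection P -> compact_and_open Z -> co_bisection (cut P Z).
Proof.
move=> cP cZ; apply: (co_bisection_sub cP); last by move=> y [].
by apply: (coIclopen haus); [case: cP|exact: src_preim].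
Qed.

Let cut_src P Z : Z `<=` src @` P -> src @` (cut P Z) = Z.
Proof.
move=> ZP; apply/seteqP; split=> [_ [y [_ Zy] <-]//|z Zz].
by have [y Vy yz] := ZP z Zz; exists y => //; split => //=; rewrite yz.
Qed.

Let cut_bmul P Z : Z `<=` src @` P -> bmul P Z = cut P Z.
Proof.
move=> ZP; apply/seteqP; split.
  move=> _ [p [z [Pp Zz pz ->]]]; have [p' Pp' p'z] := ZP z Zz.
  have uz : G0 z by rewrite -p'z; exact: unit_srcP.
  have zz : src p = z by rewrite pz; exact/unitP.
  by rewrite -zz gmul_src; split => //=; rewrite zz.
move=> p [Pp /= Zp]; exists p, (src p); split => //.
  by rewrite rng_src.
by rewrite gmul_src.
Qed.

Let e_cut P Z : co_bisection P -> compact_and_open Z -> Z `<=` src @` P -> e P ** e Z = e (cut P Z).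
Proof.
move=> cP cZ ZP; have czZ : co_bisection Z.
  by apply: unit_cob => // z /ZP[p _ <-]; exact: unit_srcP.
by rewrite e_mul// cut_bmul.
Qed.

(** This allows a bisection to be replaced by another one with the same germ
    at [x]. *)
Let germ P Q v : co_bisection P -> co_bisection Q -> P v -> Q v -> src v = x ->
  near_co (fun Z => e P ** e Z = e Q ** e Z).
Proof.
move=> cP cQ Pv Qv sv.
have cI : co_bisection (P `&` Q).
  by apply: (co_bisection_sub cP); [apply: (coI haus); [case: cP|case: cQ]|move=> y []].
apply: near_co_mono (near_src cI (conj Pv Qv) sv) => Z [ZI cZ].
have ZP : Z `<=` src @` P by move=> z /ZI[y [? _] <-]; exists y.
have ZQ : Z `<=` src @` Q by move=> z /ZI[y [_ ?] <-]; exists y.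
rewrite !e_cut//; congr (iota \1__).
have [[_ isP] _] := cP; have [[_ isQ] _] := cQ.
apply/seteqP; split => y [Py Zy]; split => //; have [w [Pw Qw] wy] := ZI _ Zy.
  by have -> : y = w by apply: isP; rewrite ?inE.
by have -> : y = w by apply: isQ; rewrite ?inE.
Qed.

(** The corner [(1 - e P) ** e Z ** (1 - star (e Q))], in a form that depends on
    [P] and [Q] near [Z] only. *)
Let D P Q Z := (e Z - e P ** e Z) ** (e Z - e Z ** star (e Q)).

Let star_eZ Z : compact_and_open Z -> Z `<=` G0 -> star (e Z) = e Z.
Proof.
move=> cZ ZG; rewrite e_star//; congr (iota \1__).
apply/seteqP; split=> y; rewrite /binv/= => Zy; last by rewrite ginv_unit//; exact: ZG.
by rewrite -(ginvK y) (ginv_unit (ZG _ Zy)).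
Qed.

Let separate (y z : G) : y <> z -> exists O1 O2 : set G,
  [/\ open O1, open O2, O1 y, O2 z & O1 `&` O2 = set0].
Proof.
move=> yz; have := haus; rewrite open_hausdorff => /(_ y z).
move=> [|[N1 N2] [/= h1 h2] [ o1 o2 h]]; first exact/eqP.
exists N1, N2; move: h1 h2; rewrite !inE => h1 h2; split => //; exact/eqP.
Qed.

Let D_distinct P Q u v : co_bisection P -> co_bisection Q -> P u -> Q v -> src u = x -> src v = x ->
  rng u <> x -> rng v <> x -> rng u <> rng v ->
  near_co (fun Z => B (D P Q Z)).
Proof.
move=> cP cQ Pu Qv su sv rux rvx ruv.
have [ O1 [ O2 [ o1 o2 h1 h2 h12]]] := separate rux.
have [ O3 [ O4 [ o3 o4 h3 h4 h34]]] := separate rvx.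
have [ O5 [ O6 [ o5 o6 h5 h6 h56]]] := separate ruv.
have oP : open P by case: cP => _ [].
have oQ : open Q by case: cQ => _ [].
pose Ox := O2 `&` O4; pose Ou := O1 `&` O5; pose Ov := O3 `&` O6.
have pre (f : G -> G) N : continuous f -> open N -> open (f @^-1` N).
  by move=> cf oN; apply: open_comp => // y _; exact: cf.
have [| |P' [cP' P'u PP']] := @co_bisection_basis _ hample hcompact u
    (P `&` (rng @^-1` Ou `&` src @^-1` Ox)).
- apply: openI => //; apply: openI; apply: pre; try exact: openI.
    exact: rng_cont.
  exact: src_cont.
- by split => //; split => //=; rewrite su.
have [| |Q' [cQ' Q'v QQ']] := @co_bisection_basis _ hample hcompact v
    (Q `&` (rng @^-1` Ov `&` src @^-1` Ox)).
- apply: openI => //; apply: openI; apply: pre; try exact: openI.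
    exact: rng_cont.
  exact: src_cont.
- by split => //; split => //=; rewrite sv.
have g1 := germ cP cP' Pu P'u su; have g2 := germ cQ cQ' Qv Q'v sv.
have n1 := near_src cP' P'u su; have n2 := near_src cQ' Q'v sv.
apply: near_co_mono (near_coI (near_coI g1 g2) (near_coI n1 n2)).
move=> Z [[E1 E2] [[ZP cZ] [ZQ _]]].
have ZG : Z `<=` G0 by move=> z /ZP[y _ <-]; exact: unit_srcP.
have h : e Z ** star (e Q) = star (e Q ** e Z) by rewrite starM (star_eZ cZ ZG).
rewrite /D h E1 E2 !e_cut//.
have inP y : cut P' Z y -> O1 (rng y) /\ O5 (rng y).
  by move=> [/PP'[_ [[? ?] _]] _].
have inQ y : cut Q' Z y -> O3 (rng y) /\ O6 (rng y).
  by move=> [/QQ'[_ [[? ?] _]] _].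
have inZ z : Z z -> O2 z /\ O4 z by move=> /ZP[y /PP'[_ [_ [? ?]]] <-].
apply: corner_moving; [exact: cut_cob|exact: cut_cob|exact: cut_src|exact: cut_src|..];
  apply/seteqP; split => // z [].
- move=> /inZ[z2 _] [y /inP[y1 _] yz].
  have : (O1 `&` O2) z by split => //; rewrite -yz.
  by rewrite h12.
- move=> /inZ[_ z2] [y /inQ[y1 _] yz].
  have : (O3 `&` O4) z by split => //; rewrite -yz.
  by rewrite h34.
- move=> [y' /inP[_ y'1] y'z] [y /inQ[_ y1] yz].
  have : (O5 `&` O6) z by split; [rewrite -y'z|rewrite -yz].
  by rewrite h56.
Qed.

Let mover w : rng w <> src w -> exists T, [/\ full_group G T, T w, T (ginv w) &
  (rng w <> x -> src w <> x -> T x)].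
Proof.
move=> rs; have [rx|rx] := pselect (rng w <> x /\ src w <> x); last first.
  have [V [cV Vw dis]] := disjoint_cob_basis hample hcompact rs.
  exists (transposition V); split; first exact: transposition_full.
  - by left; left.
  - by left; right; rewrite /binv/= ginvK.
  - by move=> ? ?; exfalso; apply: rx.
have [r1 s1] := rx.
have [V [cV Vw dis]] := disjoint_cob_basis hample hcompact rs.
have [ O1 [ O2 [ o1 o2 h1 h2 h12]]] := separate r1.
have [ O3 [ O4 [ o3 o4 h3 h4 h34]]] := separate s1.
have oV : open V by case: cV => _ [].
have pre (f : G -> G) N : continuous f -> open N -> open (f @^-1` N).
  by move=> cf oN; apply: open_comp => // y _; exact: cf.
have [| |V' [cV' V'w VV']] := @co_bisection_basis _ hample hcompact w
    (V `&` (rng @^-1` O1 `&` src @^-1` O3)).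
- apply: openI => //; apply: openI; apply: pre => //.
    exact: rng_cont.
  exact: src_cont.
- by [].
exists (transposition V'); split.
- apply: transposition_full => //; apply/seteqP; split => // y [[a /VV'[Va _] ay] [b /VV'[Vb _] yb]].
  have : (rng @` V `&` src @` V) y by split; [exists a|exists b].
  by rewrite dis.
- by left; left.
- by left; right; rewrite /binv/= ginvK.
- move=> _ _; right; split => // -[[a /VV'[_ [Oa _]] ay]|[a /VV'[_ [_ Oa]] ay]].
    have : (O1 `&` O2) x by split => //; rewrite -ay.
    by rewrite h12.
  have : (O3 `&` O4) x by split => //; rewrite -ay.
  by rewrite h34.
Qed.

Let near_unit : near_co (fun Z => Z `<=` G0 /\ compact_and_open Z).
Proof. by exists G0; split => //; exact: unit_co. Qed.

(** If [u] and [v] have the same range, a third point [rng c] of the orbit and a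
    transposition [T] that fixes [x] and moves [rng c] to [rng v] reduce the claim to
    the arrows [u] and [c]. *)
Let D_moving P Q u v : co_bisection P -> co_bisection Q -> P u -> Q v -> src u = x -> src v = x ->
  rng u <> x -> rng v <> x -> near_co (fun Z => B (D P Q Z)).
Proof.
move=> cP cQ Pu Qv su sv rux rvx.
have [ruv|ruv] := pselect (rng u = rng v); last exact: (D_distinct cP cQ Pu Qv).
have [c [sc rcx rcu]] := third_point horbit (rng u) ux.
have [Vc [cVc Vcc _]] := co_bisection_basis hample hcompact openT (I : setT c).
have vc : src v = rng (ginv c) by rewrite rng_ginv sv sc.
pose w := gmul v (ginv c).
have rw : rng w = rng v by rewrite /w rng_gmul.
have sw : src w = rng c by rewrite /w src_gmul// src_ginv.
have [|T [fT Tw _ Tx]] := @mover w; first by rewrite rw sw -ruv; exact/nesym.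
have {}Tx : T x by apply: Tx; rewrite ?rw ?sw.
have cT := full_cob fT; have cTV := bmul_cob hample cT cVc.
have TVv : bmul T Vc v.
  exists w, c; split => //; rewrite /w -gmulA ?src_ginv//.
  by rewrite gmulVg sc -sv gmul_src.
have cG : co_bisection G0 by apply: unit_cob => //; exact: unit_co.
have g1 := germ cTV cQ TVv Qv sv.
have g2 := germ cT cG Tx ux (unit_src ux).
have Dc := D_distinct cP cVc Pu Vcc su sc rux rcx (nesym rcu).
apply: near_co_mono (near_coI near_unit (near_coI Dc (near_coI g1 g2))).
move=> Z [[ZG cZ] [BDc [E1 E2]]].
rewrite (iota_unit hample hcompact hA) cmul1r in E2.
rewrite -e_mul// -cmulA in E1.
have sZ := star_eZ cZ ZG.
suff -> : D P Q Z = D P Vc Z ** star (e T) by apply: BM => //; apply: BS; exact: Bfull.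
rewrite /D -cmulA; congr (_ ** _); rewrite cmulBl.
have -> : e Z ** star (e T) = e Z by rewrite -{1}sZ -starM E2 sZ.
by rewrite -{2}sZ -starM -E1 starM starM sZ.
Qed.

(** An isotropy arrow is a product of two arrows moving their sources, and
    [1 - T ** V = (1 - T) + T ** (1 - V)]. *)
Let D_split P Q u : co_bisection P -> P u -> src u = x ->
  (forall P' u', co_bisection P' -> P' u' -> src u' = x -> rng u' <> x ->
    near_co (fun Z => B (D P' Q Z))) ->
  near_co (fun Z => B (D P Q Z)).
Proof.
move=> cP Pu su H; have [rux|rux] := pselect (rng u = x); last exact: (H P u).
have [c [sc rcx _]] := third_point horbit x ux.
have [Vc [cVc Vcc _]] := co_bisection_basis hample hcompact openT (I : setT c).
have uc : src u = rng (ginv c) by rewrite rng_ginv su sc.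
(* The arrow [u] is the product of [w] and [c]. *)
pose w := gmul u (ginv c).
have rw : rng w = x by rewrite /w rng_gmul.
have sw : src w = rng c by rewrite /w src_gmul// src_ginv.
have [|T [fT Tw Tw' _]] := @mover w; first by rewrite rw sw; exact/nesym.
have cT := full_cob fT; have cTV := bmul_cob hample cT cVc.
have TVu : bmul T Vc u.
  exists w, c; split => //; rewrite /w -gmulA ?src_ginv//.
  by rewrite gmulVg sc -su gmul_src.
have g1 := germ cTV cP TVu Pu su.
have H1 : near_co (fun Z => B (D T Q Z)).
  by apply: (H T (ginv w)) => //; rewrite ?src_ginv ?rng_ginv ?rw ?sw.
have H2 : near_co (fun Z => B (D Vc Q Z)) by exact: (H Vc c).
apply: near_co_mono (near_coI g1 (near_coI H1 H2)) => Z [E1 [B1' B2]].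
suff -> : D P Q Z = D T Q Z + e T ** D Vc Q Z.
  by apply: BD => //; apply: BM => //; exact: Bfull.
rewrite /D [e T ** (_ ** _)]cmulA -cmulDl; congr (_ ** _).
by rewrite cmulBr cmulA (e_mul cT cVc) E1 addrA subrK.
Qed.

Let D_star P Q : near_co (fun Z => B (D Q P Z)) -> near_co (fun Z => B (D P Q Z)).
Proof.
move=> H; apply: near_co_mono (near_coI near_unit H) => Z [[ZG cZ] BQP].
have sZ := star_eZ cZ ZG.
suff -> : D P Q Z = star (D Q P Z) by exact: BS.
by rewrite /D starM !starB !starM !starK sZ.
Qed.

(** [D_split] applies to the left factor and, after taking adjoints, to the
    right factor. *)
Let D_any P Q u v : co_bisection P -> co_bisection Q -> P u -> Q v -> src u = x -> src v = x ->
  near_co (fun Z => B (D P Q Z)).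
Proof.
move=> cP cQ Pu Qv su sv; apply: (D_split cP Pu su) => P' u' cP' Pu' su' ru'.
apply: D_star; apply: (D_split cQ Qv sv) => Q' v' cQ' Qv' sv' rv'.
exact: (D_moving cQ' cP' Qv' Pu').
Qed.

Lemma corner_local U W : full_group G U -> full_group G W ->
  exists K, [/\ compact_and_open K, K x & forall Z, compact_and_open Z -> Z `<=` K ->
    B ((cone - e U) ** e Z ** (cone - e W))].
Proof.
move=> fU fW; have fW' := full_group_binv fW.
have [u Uu su] := full_src x fU; have [v Wv sv] := full_src x fW'.
rewrite (unit_src ux) in su sv.
have H := D_any (full_cob fU) (full_cob fW') Uu Wv su sv.
apply: near_co_mono (near_coI near_unit H) => Z [[ZG cZ]].
have -> // : D U (binv W) Z = (cone - e U) ** e Z ** (cone - e W).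
have cW := full_cob fW; have coW : compact_and_open W by case: cW.
rewrite /D -e_star// starK.
have zz : e Z ** e Z = e Z.
  have czZ : co_bisection Z by exact: unit_cob.
  rewrite e_mul//; congr (iota \1__).
  by have [_ sZ] := unit_rs ZG; rewrite -{2}sZ bmul_src.
have -> : e Z - e U ** e Z = (cone - e U) ** e Z by rewrite cmulBl cmul1r.
have -> : e Z - e Z ** e W = e Z ** (cone - e W) by rewrite cmulBr cmulr1.
by rewrite cmulA -[(cone - e U) ** e Z ** e Z]cmulA zz.
Qed.

End Germs.

Let corner_clopen U W Z : full_group G U -> full_group G W -> compact_and_open Z -> Z `<=` G0 ->
  B ((cone - e U) ** e Z ** (cone - e W)).
Proof.
move=> fU fW cZ ZG.
pose Q Z := B ((cone - e U) ** e Z ** (cone - e W)).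
apply: (@compact_open_ind _ haus Q Z cZ).
- rewrite /Q (e_set0 hample hcompact hA) cmul0r cmul0l.
  exact: (cstar_subalgebra0 B_cstar_subalgebra).
- move=> K L cK cL KL QK QL.
  by rewrite /Q e_disj// [_ ** (e K + e L)]cmulDr cmulDl; exact: (BD QK QL).
- by move=> x /ZG ux; exact: corner_local.
Qed.

(** By density it suffices to take [a = e V ** e Z]; then [e V] can be moved to
    the left of the first factor by conjugating [U]. *)
Let corner_all U W a : full_group G U -> full_group G W ->
  B ((cone - e U) ** a ** (cone - e W)).
Proof.
move=> fU fW.
pose S : set A := [set a | forall U W, full_group G U -> full_group G W ->
  B ((cone - e U) ** a ** (cone - e W))].
suff : S a by apply.
apply: (span_dense hample hcompact horbit hA).
- move=> U' W' _ _; rewrite cmul0r cmul0l; exact: (cstar_subalgebra0 B_cstar_subalgebra).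
- by move=> b c Sb Sc U1 W1 fU1 fW1; rewrite [_ ** (b + c)]cmulDr cmulDl; apply: BD; [exact: Sb|exact: Sc].
- by move=> k b Sb U' W' fU' fW'; rewrite cmulZr cmulZl; apply: BZ; exact: Sb.
- move=> b /closureP cb U' W' fU' fW'.
  apply: (closed_nrm (cstar_subalgebra_closed B_cstar_subalgebra)) => eps e0.
  have e4 : 0 < eps / 5 by rewrite divr_gt0.
  have [b' Sb' bb'] := cb _ e4.
  exists ((cone - e U') ** b' ** (cone - e W')); first exact: Sb'.
  rewrite -cmulBl -cmulBr; apply: le_lt_trans (nrmM _ _) _.
  have n1 : nrm (cone : A) <= 1 by exact: nrm1_le1.
  have nU : nrm (cone - e U') <= 2.
    have := nrmB cone (e U'); have := nrm_full hample hcompact hA fU'; lra.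
  have nW : nrm (cone - e W') <= 2.
    have := nrmB cone (e W'); have := nrm_full hample hcompact hA fW'; lra.
  have h1 : nrm ((cone - e U') ** (b - b')) <= 2 * nrm (b - b').
    by apply: le_trans (nrmM _ _) _; rewrite ler_wpM2r ?nrm_ge0.
  have h2 : nrm ((cone - e U') ** (b - b')) * nrm (cone - e W') <=
      2 * nrm (b - b') * 2 by apply: ler_pM; rewrite ?nrm_ge0.
  by apply: le_lt_trans h2 _; lra.
- move=> V Z fV cZ ZG U' W' fU' fW'.
  have fV' := full_group_binv fV.
  pose U'' := bmul (binv V) (bmul U' V).
  have fUV := full_group_bmul hample fU' fV.
  have fU'' : full_group G U'' by exact: full_group_bmul.
  have coV : compact_and_open V by case: (full_cob fV).
  have -> : (cone - e U') ** (e V ** e Z) ** (cone - e W') =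
     e V ** ((cone - e U'') ** e Z ** (cone - e W')).
    rewrite !cmulA; congr (_ ** _ ** _).
    rewrite cmulBl cmulBr cmul1r cmulr1 /U''; congr (_ - _).
    rewrite -!e_mul//; try exact: full_cob.
    by rewrite -e_star// cmulA (e_full_starr hample hcompact hA)// cmul1r.
  by apply: BM; [exact: Bfull|exact: corner_clopen].
Qed.

(** Elements of the augmentation ideal, as combinations of the [1 - e U]. *)
Let augmentation (s : seq (C * full_group G)) : A :=
  \sum_(p <- s) p.1 *: (cone - full_group_rep iota p.2).

Let augmentation_corner s t a : B (augmentation s ** a ** augmentation t).
Proof.
rewrite /augmentation; elim: t => [|q t IHt].
  by rewrite big_nil cmul0r; exact: (cstar_subalgebra0 B_cstar_subalgebra).
rewrite big_cons cmulDr; apply: BD => //; rewrite cmulZr; apply: BZ => {IHt}.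
elim: s => [|p s IHs].
  by rewrite big_nil !cmul0l; exact: (cstar_subalgebra0 B_cstar_subalgebra).
rewrite big_cons; set T := \sum_(_ <- s) _ in IHs *; set b := _ *: _.
rewrite [(b + T) ** a]cmulDl [(b ** a + T ** a) ** _]cmulDl.
apply: BD => //; rewrite /b !cmulZl; apply: BZ.
by apply: corner_all; exact: set_mem (valP _).
Qed.

(** If a combination of the [e U] has norm less than the absolute value of its
    coefficient sum, normalizing this sum yields [y] of norm less than [1] such that
    [1 - y] is in the augmentation ideal; [1 - cmul_exp y n] is a multiple of [1 - y]. *)
Lemma full_group_cstar_eqT :
  ~ weakly_contains (full_group_rep iota) (@trivial_rep R (full_group G)) ->
  B = [set: A].
Proof.
move=> /existsNP[s /negP]; rewrite [X in X <= _]nrmE [X in _ <= X]nrmE lecR -ltNge.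
set N := nrm _; set M := nrm _ => NM.
pose sm : C := \sum_(p <- s) p.1.
have ME : M = cabs sm.
  rewrite /M /nrm /cabs; congr (complex.Re `|_|); apply: eq_bigr => q _.
  by rewrite /trivial_rep; exact: mulr1.
have sm0 : sm != 0.
  apply/eqP => h; move: NM; rewrite ME h /cabs normr0 /= ltNge.
  by rewrite /N nrm_ge0.
have csm : 0 < cabs sm by rewrite -ME; apply: le_lt_trans NM; exact: nrm_ge0.
pose y : A := sm^-1 *: \sum_(p <- s) p.1 *: full_group_rep iota p.2.
have ny : nrm y < 1.
  have cV : cabs sm^-1 = (cabs sm)^-1.
    apply: (mulfI (lt0r_neq0 csm)); rewrite -cabsM divff// mulfV ?lt0r_neq0//.
    by rewrite /cabs normr1.
  rewrite nrmZ cV mulrC ltr_pdivrMr// mul1r -ME; exact: NM.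
have jE : cone - y = sm^-1 *: \sum_(p <- s) p.1 *: (cone - full_group_rep iota p.2).
  have -> : \sum_(p <- s) p.1 *: (cone - full_group_rep iota p.2) =
     sm *: cone - \sum_(p <- s) p.1 *: full_group_rep iota p.2.
    rewrite /sm scaler_suml -sumrB; apply: eq_bigr => p _.
    by rewrite scalerBr.
  by rewrite scalerBr scalerA mulVf// scale1r.
have jBj a : B ((cone - y) ** a ** (cone - y)).
  by rewrite jE cmulZl cmulZl cmulZr; do 2 apply: BZ; exact: augmentation_corner.
apply/seteqP; split => // a _.
apply: (closed_nrm (cstar_subalgebra_closed B_cstar_subalgebra)) => eps e0.
have k0 : 0 < 3 * nrm a + 1 by rewrite ltr_wpDl// mulr_ge0// nrm_ge0.
have ay : `|nrm y| < 1 by rewrite ger0_norm ?nrm_ge0.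
have /cvgrPdist_lt/(_ _ (divr_gt0 e0 k0))[n _ /(_ n (leqnn n))/=] := cvg_expr ay.
rewrite sub0r normrN ger0_norm ?exprn_ge0 ?nrm_ge0// => yn.
set Y := cmul_exp y n; have nY : nrm Y <= nrm y ^+ n by exact: nrm_cmul_exp.
have nY1 : nrm Y <= 1 by apply: le_trans nY _; rewrite exprn_ile1 ?nrm_ge0// ltW.
exists ((cone - Y) ** a ** (cone - Y)).
  rewrite -{1}(geometric_sumr y n) -(geometric_suml y n).
  by rewrite -!cmulA [_ ** (a ** _)]cmulA [_ ** (_ ** (cone - y))]cmulA cmulA; exact: jBj.
have -> : a - (cone - Y) ** a ** (cone - Y) = Y ** a + (cone - Y) ** a ** Y.
  rewrite [_ ** (cone - Y)]cmulBr cmulr1 [(cone - Y) ** a]cmulBl cmul1r.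
  by rewrite opprB addrCA subKr addrC.
apply: le_lt_trans (nrmD _ _) _.
have h1 : nrm (Y ** a) <= nrm Y * nrm a by exact: nrmM.
have n1 : nrm (cone - Y) <= 2.
  have := nrmB cone Y; have h : nrm (cone : A) <= 1 by exact: nrm1_le1.
  lra.
have h2 : nrm ((cone - Y) ** a ** Y) <= 2 * nrm a * nrm Y.
  apply: le_trans (nrmM _ _) _; rewrite ler_wpM2r ?nrm_ge0//.
  by apply: le_trans (nrmM _ _) _; rewrite ler_wpM2r ?nrm_ge0.
move: yn; rewrite ltr_pdivlMr// => yn.
have h3 : nrm Y * (3 * nrm a + 1) <= nrm y ^+ n * (3 * nrm a + 1).
  by rewrite ler_wpM2r// ltW.
have := nrm_ge0 Y; lra.
Qed.

End Rigidity.


(** * The theorem *)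

Theorem theorem4p6 (R : realType) (G : topGroupoidType)
    (A : cstarAlgType R) (iota : (G -> R[i]) -> A)
    (hample : ample G) (hcompact : compact (unit_space G))
    (horbit : forall x : G, unit_space G x -> `I_3 #<= groupoid_orbit x)
    (hA : groupoid_cstar iota) :
  [<-> ~ (exists tau : {scalar A}, tracial_state tau);
       ~ (exists chi : A -> R[i], character (full_group_cstar iota) chi);
       ~ weakly_contains (full_group_rep iota) (@trivial_rep R (full_group G));
       full_group_cstar iota = [set: A] ].
Proof.
have noWC := full_group_cstar_eqT hample hcompact horbit hA.
have noChi := no_character_eqT hample hcompact horbit hA.
have Wphi := weakly_contains_state hample hcompact hA.
tfae.
- move=> notau [chi cchi]; apply: notau.
  have [/Wphi[phi [pD pZ pn ps pU]]|/noWC BT] := pselect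
    (weakly_contains (full_group_rep iota) (@trivial_rep R (full_group G))).
    exact: (state_trace hample hcompact horbit hA pD pZ pn ps pU).
  by have := noChi _ BT cchi.
- move=> nochi /Wphi[phi [pD pZ pn ps pU]]; apply: nochi; exists phi.
  exact: (state_character hample hcompact hA).
- exact: noWC.
- move=> BT [tau ttau].
  have [phi [pD pZ pn ps pU]] := Wphi (tracial_state_weakly_contains hample hcompact horbit hA ttau).
  by apply: (noChi phi BT); exact: (state_character hample hcompact hA).
Qed.
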